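(* Assume A1, A2, A3, B1 and B2 (stated in the context), for fixed $\epsilon>0$ and $\delta>0$. Then there exists a unique solution $(X_\epsilon,Y_\epsilon)\in\mathcal{S}^2([0,T])$ to the McKean--Vlasov system $$dX_{\epsilon,t}=\tilde b_\epsilon\big(t,(X_{\epsilon,t},Y_{\epsilon,t}),\mu_t\big)\,dt+\tilde\sigma_\epsilon\big(t,(X_{\epsilon,t},Y_{\epsilon,t}),\mu_t\big)\,dW^x_t,\qquad dY_{\epsilon,t}=m(\theta-Y_{\epsilon,t})\,dt+\gamma\,dW^y_t,\qquad t\in[0,T],$$ with initial value $(X_{\epsilon,0},Y_{\epsilon,0})$, where $\mu_t$ denotes the law of $(X_{\epsilon,t},Y_{\epsilon,t})$.
   Context: Fix $T>0$ and a complete filtered probability space $(\Omega,\mathcal F,(\mathcal F_t)_{t\in[0,T]},\mathbb P)$, where the filtration is the augmented filtration of a standard multidimensional Brownian motion. $(W^x,W^y)$ is a two-dimensional Brownian motion with $dW^x_t\,dW^y_t=\rho_{X,Y}\,dt$. The parameters $m>0$, $\theta,\gamma\in\mathbb R$ are constants. $\mathcal S^2([0,T])$ is the space of adapted continuous processes $Z$ on $[0,T]$ with $\mathbb E[\sup_{t\in[0,T]}|Z_t|^2]<\infty$. $\mathcal P(\mathbb R^2)$ is the set of Borel probability measures on $\mathbb R^2$. Data: a function $g:\mathbb R\to\mathbb R$; a function $\sigma_{\mathrm{Dup}}:[0,T]\times(0,\infty)\to\mathbb R$ (local volatility); a kernel $K:\mathbb R\to[0,\infty)$ with $\int_{\mathbb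 R}K(u)\,du=1$ and $K(u)=K(-u)$ for all $u$. Coefficients: for $t\in[0,T]$, $(x,y)\in\mathbb R^2$, $\mu\in\mathcal P(\mathbb R^2)$, $$\tilde\sigma_\epsilon(t,(x,y),\mu)=g(y)\,\sigma_{\mathrm{Dup}}(t,e^x)\,\frac{\sqrt{\mathbb E^\mu[K(\frac{X-x}{\epsilon})]+\delta}}{\sqrt{\mathbb E^\mu[g^2(Y)K(\frac{X-x}{\epsilon})]+\delta}},\qquad \tilde b_\epsilon=-\tfrac12\tilde\sigma_\epsilon^2,$$ where $\mathbb E^\mu$ denotes expectation with $(X,Y)\sim\mu$. Assumptions. A1: there are constants $A_1,L_g$ with $|g(y_1)|\le A_1$ and $|g(y_1)-g(y_2)|\le L_g|y_1-y_2|$ for all $y_1,y_2\in\mathbb R$. A2: there are constants $A_2,L_{\mathrm{Dup}}$ with $|\sigma_{\mathrm{Dup}}(t_1,\cdot)|\le A_2$ and $|\sigma_{\mathrm{Dup}}(t_1,e^{x_1})-\sigma_{\mathrm{Dup}}(t_2,e^{x_2})|\le L_{\mathrm{Dup}}(|t_1-t_2|^{1/2}+|x_1-x_2|)$ for all $t_1,t_2\in[0,T]$, $x_1,x_2\in\mathbb R$. A3: there are constants $A_3,L_K$ with $|K(x_1)|\le A_3$ and $|K(x_1)-K(x_2)|\le L_K|x_1-x_2|$ for all $x_1,x_2\in\mathbb R$. B1: $(X_{\epsilon,0},Y_{\epsilon,0})\in L^p(\mathcal F_0;\mathbb R^2;\mathbb P)$ for some $p\ge2$, independent of the Brownian motion.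 B2: $\mathbb E\big[(\int_0^T|\tilde b_\epsilon(t,0,\mu_0)|\,dt)^2\big]+\mathbb E\big[(\int_0^T|\tilde\sigma_\epsilon(t,0,\mu_0)|\,dt)^2\big]<\infty$, where $\mu_0$ is the law of $(X_{\epsilon,0},Y_{\epsilon,0})$. *)

(* Defs.v *)
From HB Require Import structures.
From mathcomp Require Import all_boot all_order all_algebra.
From mathcomp Require Import all_classical all_reals all_analysis.

Set Implicit Arguments.
Unset Strict Implicit.
Unset Printing Implicit Defensive.

Import Order.TTheory GRing.Theory Num.Theory.
Import numFieldNormedType.Exports.

Local Open Scope classical_set_scope.
Local Open Scope ring_scope.

Section random_pair.
Context d (Omega : measurableType d) (R : realType).

Definition rpair (X Y : {mfun Omega >-> R}) (w : Omega) : R * R := (X w, Y w).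

Let measurable_rpair (X Y : {mfun Omega >-> R}) :
  measurable_fun [set: Omega] (rpair X Y).
Proof. exact: measurable_fun_pair. Qed.

HB.instance Definition _ (X Y : {mfun Omega >-> R}) :=
  isMeasurableFun.Build _ _ _ _ (rpair X Y) (measurable_rpair X Y).

End random_pair.

Definition joint_law d (Omega : measurableType d) (R : realType)
    (P : probability Omega R) (X Y : {RV P >-> R}) :
    probability (R * R)%type R :=
  distribution P (rpair X Y).

(* Stochastic processes on the time interval [0, T].  A process is a function
   of a real time; its values outside [0, T] are never constrained. *)
Section processes.
Context d (Omega : measurableType d) (R : realType) (P : probability Omega R).

Definition sigma_of d' (E : measurableType d') (Z : Omega -> E) :
    set (set Omega) :=
  preimage_set_system setT Z measurable.

Definition independent (G H : set (set Omega)) :=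
  forall A B, G A -> H B -> P (A `&` B) = (P A * P B)%E.

Definition sigma_of_process (n : nat) (D : set R)
    (B : 'I_n -> R -> Omega -> R) : set (set Omega) :=
  <<s [set A | exists i s, D s /\ sigma_of (B i s) A] >>.

(* G0 is the initial information; the purely Brownian augmented filtration is
   the case where G0 is trivial. *)
Definition augmented_filtration (G0 : set (set Omega)) (n : nat)
    (B : 'I_n -> R -> Omega -> R) (t : R) : set (set Omega) :=
  <<s G0 `|` sigma_of_process `[0, t] B `|` P.-negligible >>.

Variables (T : R) (F : R -> set (set Omega)).

Definition adapted (Z : R -> Omega -> R) :=
  forall t : R, t \in `[0, T] -> sigma_of (Z t) `<=` F t.

Definition continuous_paths (Z : R -> Omega -> R) :=
  forall w, {within `[0, T], continuous (fun t => Z t w)}.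

Definition in_S2 (Z : R -> Omega -> R) :=
  [/\ adapted Z, continuous_paths Z &
    (\int[P]_w ereal_sup [set (`|Z t w| ^+ 2)%:E | t in `[0%R, T]] < +oo)%E].

(* The centered normal law of variance v.  The case v = 0 is separated because
   [normal_prob m 0] is not a Dirac mass but the uniform law on [0, 1]. *)
Definition centered_normal (v : R) : set R -> \bar R :=
  if v == 0 then \d_(0 : R) else normal_prob 0 (Num.sqrt v).

(* n-dimensional Brownian motion relative to the filtration F, with
   d<B_i, B_j>_t = C i j dt; the Gaussian law N(0, (t - s) C) of the increment
   is expressed through all its one-dimensional projections. *)
Definition brownian_motion (n : nat) (C : 'M[R]_n)
    (B : 'I_n -> R -> Omega -> R) :=
  [/\ forall i, adapted (B i) /\ continuous_paths (B i),
      forall i, {ae P, forall w, B i 0 w = 0},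
      forall s t, 0 <= s -> s <= t -> t <= T ->
        independent (F s)
          <<s [set A | exists i, sigma_of (fun w => B i t w - B i s w) A] >> &
      forall s t (a : 'rV[R]_n), 0 <= s -> s <= t -> t <= T ->
        forall A, measurable A ->
          P ((fun w => \sum_(i < n) a 0 i * (B i t w - B i s w)) @^-1` A) =
          centered_normal ((t - s) * (a *m C *m a^T) 0 0) A].

(* H_t = \sum_(i < n) xi_i 1_(t_i, t_(i+1)](t), with xi_i bounded and
   F_(t_i)-measurable. *)
Record simple_process := SimpleProcess {
  sp_size : nat ;
  sp_time : nat -> R ;
  sp_coef : nat -> Omega -> R ;
  sp_time0 : sp_time 0 = 0 ;
  sp_timeT : sp_time sp_size = T ;
  sp_time_le : forall i, (i < sp_size)%N -> sp_time i <= sp_time i.+1 ;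
  sp_coef_meas : forall i, (i < sp_size)%N ->
    sigma_of (sp_coef i) `<=` F (sp_time i) ;
  sp_coef_bnd : exists M : R, forall i w, (i < sp_size)%N ->
    `|sp_coef i w| <= M
}.

Definition sp_val (S : simple_process) (t : R) (w : Omega) : R :=
  \sum_(i < sp_size S)
    sp_coef S i w * \1_(`]sp_time S i, sp_time S i.+1]) t.

Definition sp_integral (S : simple_process) (W : R -> Omega -> R)
    (t : R) (w : Omega) : R :=
  \sum_(i < sp_size S) sp_coef S i w *
    (W (Num.min (sp_time S i.+1) t) w - W (Num.min (sp_time S i) t) w).

Definition ito_integrand (H : R -> Omega -> R) :=
  [/\ measurable_fun (`[0, T] `*` [set: Omega])
        (fun p : R * Omega => H p.1 p.2),
      adapted H &
      (\int[P]_w \int[lebesgue_measure]_(t in `[0%R, T]) (H t w ^+ 2)%:E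
         < +oo)%E].

(* I is (a continuous version of) the Ito integral process \int_0^. H dW: the
   L^2 limit of the integrals of simple processes approximating H in
   L^2(dt x P). *)
Definition is_ito_integral (W H I : R -> Omega -> R) :=
  [/\ ito_integrand H, adapted I, continuous_paths I &
    exists S : nat -> simple_process,
      (fun n => \int[P]_w \int[lebesgue_measure]_(t in `[0%R, T])
                  ((sp_val (S n) t w - H t w) ^+ 2)%:E)%E @ \oo --> 0%E /\
      forall t : R, t \in `[0, T] ->
        (fun n => \int[P]_w
                  ((sp_integral (S n) W t w - I t w) ^+ 2)%:E)%E @ \oo --> 0%E].

(* dZ_t = b_t dt + h_t dW_t on [0, T], with Z_0 = z0. *)
Definition ito_equation (W Z b h : R -> Omega -> R) (z0 : Omega -> R) :=
  {ae P, forall w, (@lebesgue_measure R).-integrable `[0, T]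
                     (fun t => (b t w)%:E)} /\
  exists2 I : R -> Omega -> R, is_ito_integral W h I &
    {ae P, forall w, forall t : R, t \in `[0, T] ->
      Z t w = z0 w + \int[lebesgue_measure]_(s in `[0, t]) b s w + I t w}.

End processes.

Section coefficients.
Context (R : realType).

Definition bounded_lipschitz (f : R -> R) :=
  exists A L : R, (forall x, `|f x| <= A) /\
    forall x1 x2, `|f x1 - f x2| <= L * `|x1 - x2|.

(* The second argument of sigma is a spot price, hence only its values at
   positive reals matter. *)
Definition local_vol_regular (T : R) (sigma : R -> R -> R) :=
  exists A L : R,
    (forall t s, t \in `[0, T] -> 0 < s -> `|sigma t s| <= A) /\
    forall t1 t2 x1 x2, t1 \in `[0, T] -> t2 \in `[0, T] ->
      `|sigma t1 (expR x1) - sigma t2 (expR x2)| <=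
      L * (Num.sqrt `|t1 - t2| + `|x1 - x2|).

Variables (g : R -> R) (sigma : R -> R -> R) (K : R -> R) (eps delta : R).

Definition vol_coef (t : R) (z : R * R) (mu : probability (R * R)%type R) : R :=
  g z.2 * sigma t (expR z.1) *
  (Num.sqrt (\int[mu]_u K ((u.1 - z.1) / eps) + delta) /
   Num.sqrt (\int[mu]_u (g u.2 ^+ 2 * K ((u.1 - z.1) / eps)) + delta)).

Definition drift_coef (t : R) (z : R * R) (mu : probability (R * R)%type R) : R :=
  - 2^-1 * vol_coef t z mu ^+ 2.

End coefficients.

Definition is_MV_solution d (Omega : measurableType d) (R : realType)
    (P : probability Omega R) (T : R) (F : R -> set (set Omega))
    (b sig : R -> R * R -> probability (R * R)%type R -> R) (m theta gamma : R)
    (Wx Wy : R -> {RV P >-> R}) (X0 Y0 : {RV P >-> R})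
    (X Y : R -> {RV P >-> R}) :=
  ito_equation P T F Wx X
    (fun t w => b t (X t w, Y t w) (joint_law (X t) (Y t)))
    (fun t w => sig t (X t w, Y t w) (joint_law (X t) (Y t))) X0 /\
  ito_equation P T F Wy Y
    (fun t w => m * (theta - Y t w)) (fun _ _ => gamma) Y0.

(* Main.v *)
Require Import Defs.
From HB Require Import structures.
From mathcomp Require Import all_boot all_order all_algebra.
From mathcomp Require Import all_classical all_reals all_analysis.
From mathcomp Require Import measurable_realfun ring lra.

Set Implicit Arguments.
Unset Strict Implicit.
Unset Printing Implicit Defensive.

Import Order.TTheory GRing.Theory Num.Theory.
Import numFieldNormedType.Exports.

Local Open Scope classical_set_scope.
Local Open Scope ring_scope.

(* The McKean-Vlasov solutions are the fixed points of a Picard map on pairs of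
   S^2 processes: freeze the coefficients along (X, Y) and integrate.

   Since delta > 0 keeps both square roots away from 0, the volatility is bounded
   and Lipschitz in (sqrt |t|, x, y) and in the law, the latter through the mean
   square distance of any coupling.  Hence along S^2 processes the coefficients
   are bounded adapted continuous processes, and the mean square distance a' of
   the images at time t is at most k \int_0^t a ds, a being the mean square
   distance of the arguments.  Weighting by an exponential in t turns this into a
   contraction, which gives convergence of the iterates (Doob's inequality
   controls the running maxima) and uniqueness.

   Of a Brownian motion only this is needed: its increments are orthogonal to the
   past and have conditional second moment at most c (t - s).  The Ito isometry
   then holds as an inequality up to a constant, which is all the estimates use. *)

(** * Limits and square integrals *)

(** The coefficients depend on the unknown law at each time, and their values along a process must
    be fit for an integral built from simple processes. Freezing settles both. Two pairs compared
    live on one probability space and so form a coupling of their laws. For bounded adapted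
    continuous integrands, simple processes taking left-endpoint values converge in L^2(dt x P) by
    dominated convergence. Distances stay squared and in \bar R: estimates can be stated before
    finiteness is known, but each triangle inequality costs a factor 2, whence the constants 16 c,
    64 c and 128 c. The common rate is 8^-n: even weighted by 4^n, the squared suprema of the
    increments have summable expectations, which yields uniform convergence of almost all paths. The
    same completeness argument produces the Ito integral and the limit of the Picard iterates. Since
    null sets belong to every [F t], such limits can be redefined on a null set and remain
    adapted. *)

Section ereal_limits.
Context {R : realType}.
Implicit Type u : nat -> \bar R.

Lemma cvge0P u : (forall n, 0 <= u n)%E ->
  (u n @[n --> \oo] --> 0%E) <->
  (forall e : R, 0 < e -> exists N, forall n, (N <= n)%N -> (u n <= e%:E)%E).
Proof.
move=> u0; split=> [cu e e0|H].
  have : \forall x \near \oo, (u x < e%:E)%E.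
    apply: (cu [set y | (y < e%:E)%E]).
    by apply: open_ereal_lt'; rewrite lte_fin.
  by move=> [N _ HN]; exists N => n Nn; apply: ltW; exact: HN.
have ufin : \forall n \near \oo, u n \is a fin_num.
  have [N HN] := H 1 ltr01.
  exists N => // n /= /HN; rewrite ge0_fin_numE// => h.
  by rewrite (le_lt_trans h)// ltry.
apply: cvg_EFin => //; apply/cvgrPdist_le => e e0.
have [N HN] := H e e0; exists N => // n /= Nn.
rewrite sub0r normrN ger0_norm; last exact: fine_ge0.
have un := HN n Nn; rewrite -lee_fin fineK// ge0_fin_numE//.
by rewrite (le_lt_trans un)// ltry.
Qed.

Lemma cvge0_le u v : (forall n, 0 <= v n)%E -> (forall n, v n <= u n)%E ->
  (u n @[n --> \oo] --> 0%E) -> (v n @[n --> \oo] --> 0%E).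
Proof.
move=> v0 vu cu; apply: (@squeeze_cvge _ _ _ _ (fun=> 0%E) v u) => //.
- by near=> n; rewrite v0 vu.
- exact: cvg_cst.
Unshelve. all: by end_near. Qed.

Lemma le_cvge0 (x : \bar R) u : (forall n, x <= u n)%E ->
  (u n @[n --> \oo] --> 0%E) -> (x <= 0)%E.
Proof.
move=> xu cu; apply: (cvge_to_ge cu); exact: nearW.
Qed.

(** This is how uniqueness concludes: the distance of two fixed points obeys the bound of the n-th
    Picard increment for every n at once. *)
Lemma le_geometric_eq0 (x : \bar R) (A : R) : (0 <= x)%E ->
  (forall n, x <= (A * 8^-1 ^+ n)%:E)%E -> x = 0%E.
Proof.
move=> x0 H; apply/eqP; rewrite eq_le x0 andbT.
apply: (le_cvge0 H); apply: cvg_EFin; first exact: nearW.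
apply: cvg_geometric; rewrite ger0_norm//; lra.
Qed.

End ereal_limits.

Section square_integrals.
Context d {X : measurableType d} {R : realType}.
Variable mu : {measure set X -> \bar R}.
Implicit Types (D : set X) (f g h : X -> R).

(** The squared L^2 norm, used both for P and for Lebesgue measure on a time interval. *)
Definition sqint D f : \bar R := (\int[mu]_(x in D) (f x ^+ 2)%:E)%E.

Lemma sqint_ge0 D f : (0 <= sqint D f)%E.
Proof. by apply: integral_ge0 => x _; rewrite lee_fin sqr_ge0. Qed.

Lemma measurable_sqE D f : measurable_fun D f ->
  measurable_fun D (fun x => (f x ^+ 2)%:E).
Proof. by move=> mf; apply/measurable_EFinP; exact: measurable_funX. Qed.

Lemma le_sqint D f g : measurable D -> measurable_fun D f ->
  measurable_fun D g -> (forall x, D x -> `|f x| <= `|g x|) ->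
  (sqint D f <= sqint D g)%E.
Proof.
move=> mD mf mg fg; apply: ge0_le_integral => //=.
- by move=> x _; rewrite lee_fin sqr_ge0.
- exact: measurable_sqE.
- exact: measurable_sqE.
- move=> x Dx; rewrite lee_fin -(real_normK (num_real (f x))).
  by rewrite -(real_normK (num_real (g x))) lerXn2r ?nnegrE//; exact: fg.
Qed.

Lemma sqintZ D f (k : R) : measurable D -> measurable_fun D f ->
  sqint D (fun x => k * f x) = ((k ^+ 2)%:E * sqint D f)%E.
Proof.
move=> mD mf; rewrite /sqint -ge0_integralZl//.
- by apply: eq_integral => x _; rewrite exprMn EFinM.
- exact: measurable_sqE.
- by move=> x _; rewrite lee_fin sqr_ge0.
- by rewrite lee_fin sqr_ge0.
Qed.

(** From (a + b)^2 <= 2 a^2 + 2 b^2, that is (a - b)^2 >= 0; this replaces Minkowski's inequality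
    throughout. *)
Lemma sqintD D f g : measurable D -> measurable_fun D f -> measurable_fun D g ->
  (sqint D (fun x => f x + g x)%R <= 2%:E * sqint D f + 2%:E * sqint D g)%E.
Proof.
move=> mD mf mg; rewrite /sqint.
have s0 h x : (0 <= (h x ^+ 2)%:E)%E by rewrite lee_fin sqr_ge0.
rewrite -!ge0_integralZl//; try exact: measurable_sqE.
rewrite -ge0_integralD//; try by move=> x _; rewrite mule_ge0.
- apply: ge0_le_integral => //.
  + by move=> x _; rewrite lee_fin sqr_ge0.
  + exact: (measurable_sqE (measurable_funD mf mg)).
  + apply: emeasurable_funD; apply: emeasurable_funM => //;
    exact: measurable_sqE.
  + move=> x _; rewrite -!EFinM -EFinD lee_fin.
    have := sqr_ge0 (f x - g x); nra.
- by apply: emeasurable_funM => //; exact: measurable_sqE.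
- by apply: emeasurable_funM => //; exact: measurable_sqE.
Qed.

Lemma sqint_eq D f g : (forall x, D x -> f x ^+ 2 = g x ^+ 2) -> sqint D f = sqint D g.
Proof. by move=> fg; apply: eq_integral => x /[1!inE] Dx; rewrite fg. Qed.

Lemma sqintB_tri D f g h : measurable D -> measurable_fun D f ->
  measurable_fun D g -> measurable_fun D h ->
  (sqint D (fun x => f x - h x)%R <=
   2%:E * sqint D (fun x => f x - g x)%R + 2%:E * sqint D (fun x => g x - h x)%R)%E.
Proof.
move=> mD mf mg mh.
rewrite (@sqint_eq _ _ (fun x => (f x - g x) + (g x - h x))); last first.
  by move=> x _; congr (_ ^+ 2); ring.
by apply: sqintD => //; exact: measurable_funB.
Qed.

(** On a set of finite measure, |f| <= 1 + f^2 suffices. *)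
Lemma sqint_lt0_integrable D f : measurable D -> (mu D < +oo)%E ->
  measurable_fun D f -> (sqint D f < +oo)%E -> mu.-integrable D (EFin \o f).
Proof.
move=> mD muD mf foo; apply/integrableP; split; first exact/measurable_EFinP.
apply: (@le_lt_trans _ _ (\int[mu]_(x in D) ((1 : R)%:E + (f x ^+ 2)%:E))%E).
  apply: ge0_le_integral => //=.
  - by apply/measurable_EFinP; exact: measurableT_comp.
  - apply: emeasurable_funD; first exact: measurable_cst.
    exact: measurable_sqE.
  - move=> x _; rewrite lee_fin -real_normK ?num_real//.
    have := sqr_ge0 (`|f x| - 2^-1); have := normr_ge0 (f x); nra.
rewrite ge0_integralD//; first last.
- exact: measurable_sqE.
- by move=> x _; rewrite lee_fin sqr_ge0.
- by rewrite lte_add_pinfty// integral_cst// mul1e.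
Qed.

Lemma sqint_mul_integrable D f g : measurable D ->
  measurable_fun D f -> measurable_fun D g ->
  (sqint D f < +oo)%E -> (sqint D g < +oo)%E ->
  mu.-integrable D (fun x => (f x * g x)%:E).
Proof.
move=> mD mf mg foo goo; apply/integrableP; split.
  by apply/measurable_EFinP; exact: measurable_funM.
apply: (@le_lt_trans _ _ (\int[mu]_(x in D) ((f x ^+ 2)%:E + (g x ^+ 2)%:E))%E).
  apply: ge0_le_integral => //=.
  - by apply/measurable_EFinP; apply: measurableT_comp => //; exact: measurable_funM.
  - by apply: emeasurable_funD; exact: measurable_sqE.
  - move=> x _; rewrite lee_fin normrM -[f x ^+ 2]real_normK ?num_real//.
    rewrite -[g x ^+ 2]real_normK ?num_real//.
    have := sqr_ge0 (`|f x| - `|g x|); have := normr_ge0 (f x).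
    have := normr_ge0 (g x); nra.
rewrite ge0_integralD//.
- by rewrite lte_add_pinfty.
- by move=> x _; rewrite lee_fin sqr_ge0.
- exact: measurable_sqE.
- by move=> x _; rewrite lee_fin sqr_ge0.
- exact: measurable_sqE.
Qed.

(* With A = \int |f|, B = \int f^2: integrating 2 c |f| <= f^2 + c^2 gives
   2 c A <= B + c^2 m, and c = A / m is optimal. *)
Lemma sqr_integral_le D f (m : R) : measurable D -> 0 < m ->
  (mu D <= m%:E)%E -> measurable_fun D f ->
  ((\int[mu]_(x in D) `|f x|%:E) ^+ 2 <= m%:E * sqint D f)%E.
Proof.
move=> mD m0 muD mf.
have [foo|] := ltP (sqint D f) +oo%E; last first.
  by rewrite leye_eq => /eqP ->; rewrite gt0_muley ?lte_fin// leey.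
have Doo : (mu D < +oo)%E by rewrite (le_lt_trans muD)// ltry.
have /integrableP[_ Aoo] := sqint_lt0_integrable mD Doo mf foo.
rewrite /= in Aoo.
set A' := (\int[mu]_(x in D) `|f x|%:E)%E in Aoo *.
have A0 : (0 <= A')%E by apply: integral_ge0 => x _; rewrite lee_fin.
have Afin : A' \is a fin_num by rewrite ge0_fin_numE.
have Bfin : sqint D f \is a fin_num by rewrite ge0_fin_numE// sqint_ge0.
have key (c : R) : 0 <= c -> 2 * c * fine A' <= fine (sqint D f) + c ^+ 2 * m.
  move=> c0; rewrite -lee_fin EFinD !EFinM !fineK//.
  rewrite -EFinM /A' -ge0_integralZl//=; last 2 first.
  - by apply/measurable_EFinP; exact: measurableT_comp.
  - by rewrite lee_fin mulr_ge0.
  apply: (@le_trans _ _ (\int[mu]_(x in D) ((f x ^+ 2)%:E + (c ^+ 2)%:E))%E).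
    apply: ge0_le_integral => //=.
    - by move=> x _; rewrite lee_fin !mulr_ge0.
    - apply: emeasurable_funM => //; apply/measurable_EFinP.
      exact: measurableT_comp.
    - apply: emeasurable_funD; last exact: measurable_cst.
      exact: measurable_sqE.
    - move=> x _; rewrite -EFinM -EFinD lee_fin -[f x ^+ 2]real_normK ?num_real//.
      have := sqr_ge0 (`|f x| - c); nra.
  rewrite ge0_integralD//; last 3 first.
  - by move=> x _; rewrite lee_fin sqr_ge0.
  - exact: measurable_sqE.
  - by move=> x _; rewrite lee_fin sqr_ge0.
  rewrite leeD2l// integral_cst// expr2 EFinM.
  by rewrite lee_wpmul2l// -EFinM lee_fin -expr2 sqr_ge0.
rewrite -(fineK Afin) -(fineK Bfin) -EFin_expe -EFinM lee_fin.
have a0 : 0 <= fine A' by exact: fine_ge0.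
have := key (fine A' / m) (divr_ge0 a0 (ltW m0)).
rewrite -(ler_pM2l m0).
have -> : m * (2 * (fine A' / m) * fine A') = 2 * fine A' ^+ 2.
  by field; rewrite gt_eqF.
rewrite mulrDr.
have -> : m * ((fine A' / m) ^+ 2 * m) = fine A' ^+ 2.
  by field; rewrite gt_eqF.
lra.
Qed.

End square_integrals.

(** * Adapted continuous processes *)

Section clamp.
Context {R : realType}.
Implicit Types (T t : R).

(* Composing with clamp T turns continuity within [0, T] into continuity on R. *)
Definition clamp T t : R := Num.max 0 (Num.min t T).

Lemma clamp_itv T t : 0 <= T -> clamp T t \in `[0, T].
Proof. by move=> T0; rewrite in_itv/= /clamp le_max lexx/= ge_max T0 ge_min lexx orbT. Qed.

Lemma clamp_id T t : t \in `[0, T] -> clamp T t = t.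
Proof. by rewrite in_itv/= => /andP[t0 tT]; rewrite /clamp min_l// max_r. Qed.

Lemma clamp_lip T s t : `|clamp T s - clamp T t| <= `|s - t|.
Proof.
have : t - s <= `|s - t| by rewrite distrC ler_norm.
have := ler_norm (s - t).
move: `|s - t| => N N1 N2; rewrite ler_norml /clamp.
by case: (lerP s T) => sT; case: (lerP t T) => tT;
  case: (lerP 0 s) => s0; case: (lerP 0 t) => t0; case: (lerP 0 T) => T0;
  apply/andP; split; lra.
Qed.

Lemma continuous_clamp T : continuous (clamp T).
Proof.
move=> t; apply/cvgrPdist_lt => e e0; near=> s.
apply: (le_lt_trans (clamp_lip _ _ _)).
near: s; exact: cvgr_dist_lt.
Unshelve. all: by end_near. Qed.

Lemma within_clamp T (f : R -> R) : 0 <= T ->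
  {within `[0, T], continuous f} <-> continuous (f \o clamp T).
Proof.
move=> T0; split=> [|cf].
  move=> /subspace_continuousP cf t; apply/cvgrPdist_lt => e e0.
  have /(_ _)/cvgrPdist_lt/(_ e e0) := cf (clamp T t).
  move=> /(_ (clamp_itv _ T0)); rewrite near_withinE => H.
  have := continuous_clamp H.
  move=> Hc; apply: (@filterS _ (nbhs t) _ _ _ _ Hc) => s /= Hs.
  exact: (Hs (clamp_itv _ T0)).
apply: (@subspace_eq_continuous _ _ _ (f \o clamp T)).
  by move=> t; rewrite inE/= => tT; rewrite clamp_id.
exact: continuous_subspaceT.
Qed.

End clamp.

Section joint_measurability.
Context d {O : measurableType d} {R : realType}.

(* Z (floor (t n) / n) w --> Z t w, and each approximation takes, on countably
   many time slabs, a value depending on w only. *)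
Lemma measurable_joint (Z : R -> O -> R) :
  (forall w, continuous (Z ^~ w)) ->
  (forall t, measurable_fun setT (Z t)) ->
  measurable_fun setT (fun p : R * O => Z p.1 p.2).
Proof.
move=> cZ mZ.
pose q (n : nat) (k : int) : R := k%:~R / n.+1%:R.
pose Zn n (p : R * O) := Z (q n (Num.floor (p.1 * n.+1%:R))) p.2.
apply: (@measurable_fun_cvg _ _ _ _ Zn).
- move=> n _ Y mY; rewrite setTI.
  have -> : Zn n @^-1` Y = \bigcup_(k : int)
      ([set t : R | q n k <= t < q n (k + 1)] `*` (Z (q n k) @^-1` Y)).
    apply/seteqP; split=> [[t w] /= Yt|[t w] [k _ [/= /andP[k1 k2] Yk]]].
      exists (Num.floor (t * n.+1%:R)) => //; split => //=.
      rewrite /q ler_pdivrMr// ltr_pdivlMr//; exact: floor_itv.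
    rewrite /Zn /= (@floor_def _ _ k)//.
    by move: k1 k2; rewrite /q ler_pdivrMr// ltr_pdivlMr// => -> ->.
  apply: countable_bigcupT_measurable => //.
  move=> k; apply: measurableX.
    have -> : [set t : R | q n k <= t < q n (k + 1)] = `[q n k, q n (k + 1)[%classic.
      by apply/seteqP; split => t /=; rewrite in_itv.
    exact: measurable_itv.
  by rewrite -[X in measurable X]setTI; apply: mZ.
- move=> [t w] _ /=.
  apply: (@cvg_comp _ _ _ (fun n => q n (Num.floor (t * n.+1%:R))) (Z ^~ w) _ (nbhs t)); last exact: cZ.
  apply/cvgrPdist_le => e e0.
  have [N _ HN] := near_infty_natSinv_lt (PosNum e0).
  exists N => // n /HN /= Hn; apply: le_trans (ltW Hn).
  have /andP[h1 h2] := floor_itv (t * n.+1%:R).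
  rewrite /q ger0_norm ?subr_ge0 ?ler_pdivrMr//.
  rewrite -(ler_pM2r (_ : 0 < n.+1%:R))// mulrBl divfK ?mulVf//.
  move: h2; rewrite intrD; lra.
Qed.

End joint_measurability.

Section subsigma.
Context d (Omega : measurableType d) (R : realType).
Implicit Types (G : set (set Omega)) (Z : Omega -> R).

(** Adaptedness becomes ordinary measurability on another measurable type, so that the closure
    properties of measurable functions apply to it directly. *)
Lemma sub_measurableP G Z : sigma_algebra setT G ->
  sigma_of Z `<=` G <->
  measurable_fun setT (Z : g_sigma_algebraType G -> R).
Proof.
move=> sG; split=> [ZG _ Y mY|mZ A [Y mY <-]].
  rewrite /measurable/= sigma_algebra_id//; apply: ZG; by exists Y.
by have := mZ measurableT _ mY; rewrite /measurable/= sigma_algebra_id.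
Qed.

End subsigma.

Lemma measurable_bigmax d (O : measurableType d) (R : realType) (I : finType)
    (f : I -> O -> R) : (forall i, measurable_fun setT (f i)) ->
  measurable_fun setT (fun w => \big[Num.max/0]_i f i w).
Proof.
move=> mf; elim: (index_enum I) => [|k s IH].
  by under eq_fun do rewrite big_nil; exact: measurable_cst.
by under eq_fun do rewrite big_cons; exact: measurable_maxr.
Qed.

Section processes.
Context d (Omega : measurableType d) (R : realType) (P : probability Omega R).
Variables (T : R) (F : R -> set (set Omega)).

(* Right-continuity is not required. *)
Definition usual_filtration :=
  [/\ forall t, t \in `[0, T] -> sigma_algebra setT (F t),
      forall t, t \in `[0, T] -> F t `<=` measurable,
      forall s t, s \in `[0, T] -> t \in `[0, T] -> s <= t -> F s `<=` F t &
      forall t, t \in `[0, T] -> P.-negligible `<=` F t].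

Definition acprocess (Z : R -> Omega -> R) :=
  adapted T F Z /\ continuous_paths T Z.

Definition supsq (Z : R -> Omega -> R) (w : Omega) : \bar R :=
  ereal_sup [set (`|Z t w| ^+ 2)%:E | t in [set t | t \in `[0%R, T]]].

Definition normS2 (Z : R -> Omega -> R) : \bar R := (\int[P]_w supsq Z w)%E.

Definition gridpt (N k : nat) : R := k%:R * T / (2 ^ N)%:R.

(** Finite approximation of [supsq] along the dyadic grid of level N. The grids are nested, so these
    maxima increase with N: the measurability of [supsq] and monotone convergence both come from
    this. *)
Definition maxsq (N : nat) (Z : R -> Omega -> R) (w : Omega) : R :=
  \big[Num.max/0]_(k < (2 ^ N).+1) Z (gridpt N k) w ^+ 2.

Hypothesis T_gt0 : 0 < T.
Hypothesis uF : usual_filtration.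

Let T_ge0 : 0 <= T. Proof. exact: ltW. Qed.

Lemma adapted_sub_measurableP (Z : Omega -> R) t : t \in `[0, T] ->
  sigma_of Z `<=` F t <->
  measurable_fun setT (Z : g_sigma_algebraType (F t) -> R).
Proof. by case: uF => sF _ _ _ tT; apply: sub_measurableP; exact: sF. Qed.

Lemma sub_filtration (Z : Omega -> R) s t : s \in `[0, T] -> t \in `[0, T] ->
  s <= t -> sigma_of Z `<=` F s -> sigma_of Z `<=` F t.
Proof. by case: uF => _ _ Fst _ sT tT st Zs; apply: subset_trans Zs (Fst _ _ sT tT st). Qed.

Lemma filtration_measurable (Z : Omega -> R) t : t \in `[0, T] ->
  sigma_of Z `<=` F t -> measurable_fun setT Z.
Proof. by case: uF => _ Fm _ _ tT Zt _ Y mY; apply/(Fm _ tT)/Zt; exists Y. Qed.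

Lemma adapted_measurable Z t : adapted T F Z -> t \in `[0, T] ->
  measurable_fun setT (Z t).
Proof. by move=> aZ tT; apply: (filtration_measurable tT); exact: aZ. Qed.

Lemma acprocess_measurable Z t : acprocess Z -> t \in `[0, T] ->
  measurable_fun setT (Z t).
Proof. by move=> [aZ _]; exact: adapted_measurable. Qed.

Lemma acprocess_continuous Z w : acprocess Z ->
  continuous (fun t => Z (clamp T t) w).
Proof. by move=> [_ cZ]; apply/(@within_clamp _ _ (Z ^~ w)) => //; exact: cZ. Qed.

Lemma acprocess_joint Z : acprocess Z ->
  measurable_fun setT (fun p : R * Omega => Z (clamp T p.1) p.2).
Proof.
move=> aZ; apply: (@measurable_joint _ _ _ (fun t w => Z (clamp T t) w)).
  by move=> w; exact: acprocess_continuous.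
by move=> t; apply: acprocess_measurable => //; exact: clamp_itv.
Qed.

(** Measurability of [op] is asked over all measurable types because it is applied on
    [g_sigma_algebraType (F t)], a different type for each t. *)
Lemma acprocess_op (op : R -> R -> R) Z1 Z2 :
  (forall d' (O : measurableType d') (f g : O -> R), measurable_fun setT f ->
    measurable_fun setT g -> measurable_fun setT (fun w => op (f w) (g w))) ->
  (forall f g : R -> R, continuous f -> continuous g ->
     continuous (fun t => op (f t) (g t))) ->
  acprocess Z1 -> acprocess Z2 -> acprocess (fun t w => op (Z1 t w) (Z2 t w)).
Proof.
move=> mop cop aZ1 aZ2; split.
  move=> t tT; apply/(adapted_sub_measurableP _ tT); apply: mop.
  - by apply/(adapted_sub_measurableP _ tT); apply: aZ1.1.
  - by apply/(adapted_sub_measurableP _ tT); apply: aZ2.1.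
move=> w; apply/within_clamp => //; apply: cop; exact: acprocess_continuous.
Qed.

Lemma acprocessD Z1 Z2 : acprocess Z1 -> acprocess Z2 ->
  acprocess (fun t w => Z1 t w + Z2 t w).
Proof.
apply: (@acprocess_op (fun a b => a + b)) => [d' O f g mf mg|f g cf cg t].
  exact: measurable_funD.
by apply: cvgD; [exact: cf|exact: cg].
Qed.

Lemma acprocessM Z1 Z2 : acprocess Z1 -> acprocess Z2 ->
  acprocess (fun t w => Z1 t w * Z2 t w).
Proof.
apply: (@acprocess_op (fun a b => a * b)) => [d' O f g mf mg|f g cf cg t].
  exact: measurable_funM.
by apply: cvgM; [exact: cf|exact: cg].
Qed.

Lemma acprocess_cst (f : Omega -> R) : sigma_of f `<=` F 0 ->
  acprocess (fun _ => f).
Proof.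
move=> f0; split; last by move=> w t; exact: cvg_cst.
move=> t tT; have := tT; rewrite in_itv/= => /andP[t0 _].
apply: (@sub_filtration _ 0) => //.
by rewrite in_itv/= lexx.
Qed.

Lemma acprocess_scalar (r : R) : acprocess (fun _ _ => r).
Proof.
apply: acprocess_cst; apply/adapted_sub_measurableP; last exact: measurable_cst.
by rewrite in_itv/= lexx.
Qed.

Lemma acprocessB Z1 Z2 : acprocess Z1 -> acprocess Z2 ->
  acprocess (fun t w => Z1 t w - Z2 t w).
Proof.
apply: (@acprocess_op (fun a b => a - b)) => [d' O f g mf mg|f g cf cg t].
  exact: measurable_funB.
by apply: cvgB; [exact: cf|exact: cg].
Qed.

Lemma gridpt_itv N k : (k <= 2 ^ N)%N -> gridpt N k \in `[0, T].
Proof.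
move=> kN; rewrite in_itv/= /gridpt.
rewrite divr_ge0 ?mulr_ge0//= ler_pdivrMr// mulrC ler_wpM2l//.
by rewrite ler_nat.
Qed.

Lemma gridpt_refine N k : gridpt N k = gridpt N.+1 (2 * k).
Proof.
by rewrite /gridpt expnS !natrM; field.
Qed.

(** The index is the integer part of 2^N t / T, so the grid point lies at most T 2^-N to the left of
    t. *)
Lemma gridpt_approx t : t \in `[0, T] ->
  exists k : nat -> nat, (forall N, (k N <= 2 ^ N)%N) /\
    gridpt N (k N) @[N --> \oo] --> t.
Proof.
rewrite in_itv/= => /andP[t0 tT].
pose k N := Num.truncn (t / T * (2 ^ N)%:R).
have k1 N : (k N)%:R <= t / T * (2 ^ N)%:R.
  by rewrite truncn_le mulr_ge0// divr_ge0.
have k2 N : t / T * (2 ^ N)%:R < (k N).+1%:R by exact: truncnS_gt.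
exists k; split.
  move=> N; rewrite -(ler_nat R); apply: (le_trans (k1 N)).
  by rewrite ler_piMl// ler_pdivrMr// mul1r.
have gk N : gridpt N (k N) <= t <= gridpt N (k N) + T * 2^-1 ^+ N.
  rewrite /gridpt.
  have -> : 2^-1 ^+ N = ((2 ^ N)%:R)^-1 :> R by rewrite exprVn natrX.
  have e1 : t / T * (2 ^ N)%:R * T = t * (2 ^ N)%:R by field; rewrite gt_eqF.
  have := k1 N; rewrite -(ler_pM2r T_gt0) e1 -ler_pdivrMr// => -> /=.
  have -> : (k N)%:R * T / (2 ^ N)%:R + T / (2 ^ N)%:R = (k N).+1%:R * T / (2 ^ N)%:R.
    by rewrite -natr1 !mulrDl mul1r.
  have := ltW (k2 N); rewrite -(ler_pM2r T_gt0) e1.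
  by rewrite ler_pdivlMr.
apply: (@squeeze_cvgr _ _ _ _ (fun N => t - T * 2^-1 ^+ N) (fun=> t)).
- by near=> N; have /andP[h1 h2] := gk N; apply/andP; split => //; lra.
- rewrite -[X in _ --> X]subr0; apply: cvgB; first exact: cvg_cst.
  by apply: cvg_geometric; rewrite ger0_norm//; lra.
- exact: cvg_cst.
Unshelve. all: by end_near. Qed.

Lemma maxsq_ge0 N Z w : 0 <= maxsq N Z w.
Proof. exact: bigmax_ge_id. Qed.

Lemma maxsq_nd Z w : nondecreasing_seq (fun N => maxsq N Z w).
Proof.
apply/nondecreasing_seqP => N; apply: bigmax_le; first exact: maxsq_ge0.
move=> k _; rewrite gridpt_refine.
have kN : (2 * k < (2 ^ N.+1).+1)%N.
  by rewrite ltnS expnS leq_mul2l/= -ltnS.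
exact: (le_bigmax _ (fun k : 'I_(2 ^ N.+1).+1 => Z (gridpt N.+1 k) w ^+ 2) (Ordinal kN)).
Qed.

Lemma supsq_ge0 Z w : (0 <= supsq Z w)%E.
Proof.
apply: (@le_trans _ _ (`|Z 0 w| ^+ 2)%:E); first by rewrite lee_fin sqr_ge0.
by apply: ereal_sup_ubound; exists 0 => //=; rewrite in_itv/= lexx.
Qed.

Lemma le_supsq Z w t : t \in `[0, T] -> ((Z t w ^+ 2)%:E <= supsq Z w)%E.
Proof.
move=> tT; apply: ereal_sup_ubound; exists t => //=.
by rewrite real_normK ?num_real.
Qed.

Lemma supsq_le Z w (x : \bar R) :
  (forall t, t \in `[0, T] -> ((Z t w ^+ 2)%:E <= x)%E) -> (supsq Z w <= x)%E.
Proof.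
move=> H; apply: ge_ereal_sup => _ [t tT <-].
by rewrite real_normK ?num_real//; exact: H.
Qed.

Lemma maxsq_le_supsq N Z w : ((maxsq N Z w)%:E <= supsq Z w)%E.
Proof.
have := supsq_ge0 Z w.
case E : (supsq Z w) => [s| |] // s0; last by rewrite leey.
rewrite lee_fin; apply: bigmax_le => // k _; rewrite -lee_fin -E.
by apply: le_supsq; apply: gridpt_itv; rewrite -ltnS.
Qed.

(** By continuity each squared value is a limit of squared values at dyadic points, hence at most
    the supremum of the maxima; a nondecreasing sequence converges to its supremum. *)
Lemma maxsq_cvg Z w : {within `[0, T], continuous (Z ^~ w)} ->
  (maxsq N Z w)%:E @[N --> \oo] --> supsq Z w.
Proof.
move=> /(@within_clamp _ _ (Z ^~ w) T_ge0) cZ.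
have -> : supsq Z w = ereal_sup (range (fun N => (maxsq N Z w)%:E)).
  apply/eqP; rewrite eq_le; apply/andP; split; last first.
    by apply: ge_ereal_sup => _ [N _ <-]; exact: maxsq_le_supsq.
  apply: supsq_le => t tT; have [k [kN gk]] := gridpt_approx tT.
  have : (Z (clamp T (gridpt N (k N))) w ^+ 2)%:E @[N --> \oo] --> (Z t w ^+ 2)%:E.
    apply: cvg_EFin; first exact: nearW.
    rewrite /comp/=.
    have -> : Z t w = Z (clamp T t) w by rewrite clamp_id.
    under eq_fun do rewrite expr2.
    rewrite expr2.
    by apply: cvgM; exact: (cvg_comp _ _ gk (cZ t)).
  move/cvge_to_le; apply; apply: nearW => N.
  apply: (@le_trans _ _ (maxsq N Z w)%:E); last first.
    by apply: ereal_sup_ubound; exists N.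
  rewrite clamp_id ?gridpt_itv// lee_fin.
  exact: (le_bigmax _ (fun k : 'I_(2 ^ N).+1 => Z (gridpt N k) w ^+ 2) (Ordinal (kN N : (k N < (2 ^ N).+1)%N))).
apply: ereal_nondecreasing_cvgn => n m nm; rewrite lee_fin.
exact: maxsq_nd.
Qed.

Lemma measurable_maxsq N Z : adapted T F Z -> measurable_fun setT (maxsq N Z).
Proof.
move=> aZ; rewrite /maxsq.
apply: measurable_bigmax => k; apply: measurable_funX.
by apply: adapted_measurable => //; apply: gridpt_itv; rewrite -ltnS.
Qed.

Lemma measurable_supsq Z : acprocess Z -> measurable_fun setT (supsq Z).
Proof.
move=> aZ; apply: (@emeasurable_fun_cvg _ _ _ _ (fun N w => (maxsq N Z w)%:E)).
  by move=> N; apply/measurable_EFinP; apply: measurable_maxsq; exact: aZ.1.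
by move=> w _; apply: maxsq_cvg; exact: aZ.2.
Qed.

(** Monotone convergence along the nested grids. Doob's inequality, proved in discrete time, reaches
    the continuous-time supremum through this lemma. *)
Lemma normS2_le_maxsq Z (C : \bar R) : acprocess Z ->
  (forall N, \int[P]_w (maxsq N Z w)%:E <= C)%E -> (normS2 Z <= C)%E.
Proof.
move=> aZ H.
have mZ N : measurable_fun setT (fun w => (maxsq N Z w)%:E).
  by apply/measurable_EFinP; apply: measurable_maxsq; exact: aZ.1.
have -> : normS2 Z = (\int[P]_w limn (fun N => (maxsq N Z w)%:E))%E.
  apply: eq_integral => w _; apply/esym/cvg_lim => //.
  by apply: maxsq_cvg; exact: aZ.2.
have nd w : nondecreasing_seq (fun N => (maxsq N Z w)%:E).
  by move=> n m nm; rewrite lee_fin; exact: maxsq_nd.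
have mx0 N w : (0 <= (maxsq N Z w)%:E)%E by rewrite lee_fin maxsq_ge0.
rewrite monotone_convergence//.
apply: lime_le; last exact: nearW.
apply: ereal_nondecreasing_is_cvgn => n m nm.
apply: ge0_le_integral => //; by move=> w _; exact: nd.
Qed.

Lemma sqint_le_normS2 Z t : acprocess Z -> t \in `[0, T] ->
  (sqint P setT (Z t) <= normS2 Z)%E.
Proof.
move=> aZ tT; apply: ge0_le_integral => //.
- by move=> w _; rewrite lee_fin sqr_ge0.
- by apply: measurable_sqE; exact: acprocess_measurable.
- exact: measurable_supsq.
- by move=> w _; exact: le_supsq.
Qed.

Lemma supsqD Z1 Z2 w :
  (supsq (fun t w => Z1 t w + Z2 t w)%R w <= 2%:E * supsq Z1 w + 2%:E * supsq Z2 w)%E.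
Proof.
apply: supsq_le => t tT.
apply: (@le_trans _ _ (2%:E * (Z1 t w ^+ 2)%:E + 2%:E * (Z2 t w ^+ 2)%:E)%E).
  rewrite -!EFinM -EFinD lee_fin; have := sqr_ge0 (Z1 t w - Z2 t w); nra.
by rewrite leeD// lee_pmul// ?lee_fin ?sqr_ge0//; exact: le_supsq.
Qed.

Lemma normS2D Z1 Z2 : acprocess Z1 -> acprocess Z2 ->
  (normS2 (fun t w => Z1 t w + Z2 t w)%R <= 2%:E * normS2 Z1 + 2%:E * normS2 Z2)%E.
Proof.
move=> a1 a2; rewrite /normS2.
have m1 := measurable_supsq a1; have m2 := measurable_supsq a2.
have s1 := supsq_ge0 Z1; have s2 := supsq_ge0 Z2.
rewrite -!ge0_integralZl// -ge0_integralD//; last 4 first.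
- by move=> w _; rewrite mule_ge0.
- exact: emeasurable_funM.
- by move=> w _; rewrite mule_ge0.
- exact: emeasurable_funM.
apply: ge0_le_integral => //.
- by move=> w _; exact: supsq_ge0.
- by apply: measurable_supsq; exact: acprocessD.
- by apply: emeasurable_funD; exact: emeasurable_funM.
- by move=> w _; exact: supsqD.
Qed.

Lemma normS2_ge0 Z : (0 <= normS2 Z)%E.
Proof. by apply: integral_ge0 => w _; exact: supsq_ge0. Qed.

(** The supremum stands inside the integral, so a single null set serves all times: vanishing S^2
    distance means indistinguishability. *)
Lemma normS2_eq0 Z : acprocess Z -> normS2 Z = 0%E ->
  {ae P, forall w, forall t, t \in `[0, T] -> Z t w = 0}.
Proof.
move=> aZ Z0.
have : (\int[P]_w `|supsq Z w| = 0)%E.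
  by rewrite -Z0; apply: eq_integral => w _; rewrite gee0_abs// supsq_ge0.
move/(ae_eq_integral_abs _ _ (measurable_supsq aZ)) => /(_ measurableT).
apply: filterS => w /(_ Logic.I) sw t tT.
have := le_supsq Z w tT; rewrite sw lee_fin => z0.
by apply/eqP; rewrite -sqrf_eq0 eq_le z0 sqr_ge0.
Qed.

Lemma in_S2E Z : in_S2 P T F Z <-> acprocess Z /\ (normS2 Z < +oo)%E.
Proof. by split=> [[aZ cZ N]|[[aZ cZ] N]]. Qed.

End processes.

(** * Brownian increments *)

Section gaussian.
Context {R : realType}.
Notation mu := (@lebesgue_measure R).

(** Change of measure with the Radon-Nikodym derivative, which agrees almost everywhere with
    [normal_pdf] because both have the same integral over every measurable set. *)
Lemma ge0_integral_normal_prob (s : R) (f : R -> \bar R) :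
  measurable_fun setT f -> (forall x, 0 <= f x)%E ->
  (\int[normal_prob 0 s]_x f x = \int[mu]_x (f x * (normal_pdf 0 s x)%:E))%E.
Proof.
move=> mf f0; have dom := normal_prob_dominates (0 : R) s.
rewrite -(Radon_Nikodym_SigmaFinite.change_of_variables dom)//.
have mpdf : measurable_fun setT (EFin \o normal_pdf 0 s).
  by apply/measurable_EFinP; exact: measurable_normal_pdf.
have RNi := Radon_Nikodym_SigmaFinite.f_integrable dom.
apply: ae_eq_integral => //.
- by apply: emeasurable_funM => //; exact: (measurable_int mu).
- exact: emeasurable_funM.
- apply: ae_eqe_mul2l; apply: integral_ae_eq => // E _ mE.
  by rewrite -Radon_Nikodym_SigmaFinite.f_integral.
Qed.

(* x^2 <= 4 s^2 exp (x^2 / (4 s^2)) turns the density of N(0, s^2) into that of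
   N(0, 2 s^2), up to a factor. *)
Lemma normal_prob_second_moment (s : R) : s != 0 ->
  (\int[normal_prob 0 s]_x (x ^+ 2)%:E <= (4 * Num.sqrt 2 * s ^+ 2)%:E)%E.
Proof.
move=> s0; rewrite ge0_integral_normal_prob; last 2 first.
- by apply: measurable_sqE; exact: measurable_id.
- by move=> x; rewrite lee_fin sqr_ge0.
set s' := Num.sqrt 2 * s.
have s'0 : s' != 0 by rewrite mulf_neq0// gt_eqF.
have s2 : 0 < s ^+ 2 by rewrite exprn_even_gt0.
apply: (@le_trans _ _ (\int[mu]_x ((4 * Num.sqrt 2 * s ^+ 2)%:E * (normal_pdf 0 s' x)%:E))%E).
  apply: ge0_le_integral => //.
  - by move=> x _; rewrite -EFinM lee_fin mulr_ge0 ?sqr_ge0 ?normal_pdf_ge0.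
  - apply: emeasurable_funM; first by apply: measurable_sqE; exact: measurable_id.
    by apply/measurable_EFinP; exact: measurable_normal_pdf.
  - apply: emeasurable_funM => //.
    by apply/measurable_EFinP; exact: measurable_normal_pdf.
  move=> x _; rewrite -!EFinM lee_fin !normal_pdfE// /normal_fun subr0.
  have -> : normal_peak s = Num.sqrt 2 * normal_peak s'.
    rewrite /normal_peak /s'.
    have -> : (Num.sqrt 2 * s) ^+ 2 * pi *+ 2 = 2 * (s ^+ 2 * pi *+ 2).
      by rewrite exprMn sqr_sqrtr// !mulr2n; ring.
    by rewrite sqrtrM// invfM mulVKf// gt_eqF.
  have -> : s' ^+ 2 *+ 2 = 4 * s ^+ 2.
    by rewrite /s' exprMn sqr_sqrtr// !mulr2n; ring.
  have e : - x ^+ 2 / (s ^+ 2 *+ 2) = - x ^+ 2 / (4 * s ^+ 2) - x ^+ 2 / (4 * s ^+ 2).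
    by rewrite mulr2n; field; rewrite s0 gt_eqF// addr_gt0.
  rewrite e expRD.
  have h : x ^+ 2 * expR (- (x ^+ 2 / (4 * s ^+ 2))) <= 4 * s ^+ 2.
    rewrite expRN ler_pdivrMr ?expR_gt0//.
    apply: (@le_trans _ _ (4 * s ^+ 2 * (1 + x ^+ 2 / (4 * s ^+ 2)))).
      have -> : 4 * s ^+ 2 * (1 + x ^+ 2 / (4 * s ^+ 2)) = 4 * s ^+ 2 + x ^+ 2.
        by field.
      by rewrite lerDr; lra.
    by rewrite ler_pM2l; [exact: expR_ge1Dx|rewrite pmulr_rgt0].
  have p0 := normal_peak_ge0 s'; have x0 := expR_ge0 (- x ^+ 2 / (4 * s ^+ 2)).
  have pq : 0 <= Num.sqrt 2 * normal_peak s' * expR (- x ^+ 2 / (4 * s ^+ 2)).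
    by rewrite !mulr_ge0// ltW.
  have H := ler_wpM2l pq h.
  apply: le_trans (le_trans _ H) _; rewrite le_eqVlt; apply/orP; left;
    apply/eqP; ring.
rewrite ge0_integralZl//.
- by rewrite integral_normal_pdf mule1.
- by apply/measurable_EFinP; exact: measurable_normal_pdf.
- by move=> x _; rewrite lee_fin normal_pdf_ge0.
- by rewrite lee_fin mulr_ge0 ?sqr_ge0// mulr_ge0// ltW.
Qed.

End gaussian.

Section independence.
Context d (Omega : measurableType d) (R : realType) (P : probability Omega R).
Implicit Types U V : {RV P >-> R}.

(* The hypothesis says that (U, V') has law (law of U) x (law of V). *)
Lemma integral_indep_pair U V V' (h : R * R -> \bar R) :
  (forall A B, measurable A -> measurable B ->
    P (U @^-1` A `&` V' @^-1` B) = (P (U @^-1` A) * P (V @^-1` B))%E) ->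
  measurable_fun setT h -> (forall z, 0 <= h z)%E ->
  (\int[P]_w h (U w, V' w) =
   \int[distribution P U]_x \int[distribution P V]_y h (x, y))%E.
Proof.
move=> indep mh h0.
have mUV : measurable_fun setT (fun w => (U w, V' w)) by exact: measurable_fun_pair.
rewrite -(@fubini_tonelli1 _ _ _ _ _ (distribution P U) (distribution P V) h)//.
rewrite -(@ge0_integral_pushforward _ _ _ _ _ _ mUV P setT h)//.
by apply: eq_measure_integral => A mA _; apply/esym/product_measure_unique.
Qed.

Lemma sqint_mul_indep U V :
  (forall A B, measurable A -> measurable B ->
    P (U @^-1` A `&` V @^-1` B) = (P (U @^-1` A) * P (V @^-1` B))%E) ->
  sqint P setT (fun w => U w * V w) = (sqint P setT U * sqint P setT V)%E.
Proof.
move=> indep.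
have msq : measurable_fun setT (fun x : R => (x ^+ 2)%:E).
  by apply: measurable_sqE; exact: measurable_id.
have mh : measurable_fun setT (fun z : R * R => (z.1 ^+ 2)%:E * (z.2 ^+ 2)%:E)%E.
  by apply: emeasurable_funM; apply: measurable_sqE.
have sE (X : {RV P >-> R}) : sqint P setT X = (\int[distribution P X]_x (x ^+ 2)%:E)%E.
  by rewrite ge0_integral_distribution// => x; rewrite lee_fin sqr_ge0.
rewrite /sqint.
under eq_integral do rewrite exprMn EFinM.
rewrite (integral_indep_pair indep mh)/=; last first.
  by move=> z; rewrite mule_ge0// lee_fin sqr_ge0.
rewrite -/(sqint P setT U) -/(sqint P setT V) !sE.
have s0 (x : R) : (0 <= (x ^+ 2)%:E)%E by rewrite lee_fin sqr_ge0.
under eq_integral => x _ do rewrite ge0_integralZl//.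
rewrite ge0_integralZr//.
by apply: integral_ge0 => x _; exact: s0.
Qed.

(** V and -V have the same law and U is independent of both, so U V and -U V have the same law. The
    positive and negative parts of U V then have equal integrals, which integrability makes
    finite. *)
Lemma integral_mul_indep0 U V :
  (forall A B, measurable A -> measurable B ->
    P (U @^-1` A `&` V @^-1` B) = (P (U @^-1` A) * P (V @^-1` B))%E) ->
  (forall A, measurable A ->
    P ((fun w => - V w) @^-1` A) = P (V @^-1` A)) ->
  P.-integrable setT (fun w => (U w * V w)%:E) ->
  (\int[P]_w (U w * V w)%:E = 0)%E.
Proof.
move=> indep symV UVi.
pose V' : {RV P >-> R} := [the {mfun _ >-> _} of (\- V)].
have indep' A B : measurable A -> measurable B ->
    P (U @^-1` A `&` V' @^-1` B) = (P (U @^-1` A) * P (V @^-1` B))%E.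
  move=> mA mB; rewrite -(symV _ mB); apply: (indep A (-%R @^-1` B)) => //.
  by rewrite -[X in measurable X]setTI; exact: oppr_measurable.
pose h (z : R * R) : \bar R := ((fun z : R * R => z.1 * z.2)^\+ z)%:E.
have mh : measurable_fun setT h.
  by apply/measurable_EFinP; apply: measurable_funrpos; exact: measurable_funM.
have h0 z : (0 <= h z)%E by rewrite lee_fin funrpos_ge0.
rewrite integralE.
have e1 : (\int[P]_w (fun w => (U w * V w)%:E)^\+ w = \int[P]_w h (U w, V w))%E.
  by apply: eq_integral => w _; rewrite /h/= funeposE /funrpos/= EFin_max.
have e2 : (\int[P]_w (fun w => (U w * V w)%:E)^\- w = \int[P]_w h (U w, V' w))%E.
  apply: eq_integral => w _; rewrite /h/= funenegE /funrpos/= EFin_max.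
  by rewrite mulrN EFinN.
rewrite e1 e2 (integral_indep_pair indep mh h0) (integral_indep_pair indep' mh h0).
apply: subee; rewrite -(integral_indep_pair indep mh h0) -e1.
exact: integrable_pos_fin_num.
Qed.

End independence.

Section drivers.
Context d (Omega : measurableType d) (R : realType) (P : probability Omega R).
Variables (T : R) (F : R -> set (set Omega)).

(* The only properties of Brownian motion used to build the Ito integral: the
   increments after time s are orthogonal to F s, and their second moment given
   F s is at most c (t - s). *)
Definition ito_driver (c : R) (W : R -> Omega -> R) :=
  [/\ acprocess T F W,
    forall s t (U : Omega -> R), s \in `[0, T] -> t \in `[0, T] -> s <= t ->
      sigma_of U `<=` F s -> (sqint P setT U < +oo)%E ->
      (\int[P]_w (U w * (W t w - W s w))%:E = 0)%E &
    forall s t (U : Omega -> R), s \in `[0, T] -> t \in `[0, T] -> s <= t ->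
      sigma_of U `<=` F s -> (sqint P setT U < +oo)%E ->
      (sqint P setT (fun w => U w * (W t w - W s w))%R <=
       (c * (t - s))%:E * sqint P setT U)%E].

Hypothesis uF : usual_filtration P T F.

Let mkRV (f : Omega -> R) (mf : measurable_fun setT f) : {RV P >-> R} :=
  HB.pack f (isMeasurableFun.Build _ _ _ _ f mf).

(** The exact value is v; the factor comes from the crude Gaussian bound and becomes the constant c
    of the driver. *)
Lemma centered_normal_second_moment (V : {RV P >-> R}) (v : R) : 0 <= v ->
  (forall A, measurable A -> P (V @^-1` A) = centered_normal v A) ->
  (sqint P setT V <= (4 * Num.sqrt 2 * v)%:E)%E.
Proof.
move=> v0 VE; pose TR := measurableTypeR R.
have mV : measurable_fun setT (V : Omega -> TR).
  by move=> _ Y mY; exact: (measurable_funPT V).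
have msq : measurable_fun setT (fun x : TR => (x ^+ 2)%:E : \bar R).
  by apply: measurable_sqE; exact: measurable_id.
have -> : sqint P setT V = (\int[pushforward P (V : Omega -> TR)]_(x in setT) (x ^+ 2)%:E)%E.
  by rewrite (ge0_integral_pushforward mV)// => x _; rewrite lee_fin sqr_ge0.
move: VE; rewrite /centered_normal; case: ifPn => [/eqP-> VE|v_neq0 VE].
  rewrite (@eq_measure_integral _ _ _ _ (\d_(0 : TR)))/=; last first.
    by move=> A mA _; exact: VE.
  by rewrite integral_dirac// expr0n/= mule0 mulr0.
rewrite (@eq_measure_integral _ TR _ _ (normal_prob 0 (Num.sqrt v)))/=; last first.
  by move=> A mA _; exact: VE.
rewrite -[X in (4 * Num.sqrt 2 * X)%:E](sqr_sqrtr v0).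
apply: normal_prob_second_moment.
by rewrite gt_eqF// sqrtr_gt0 lt_neqAle eq_sym v_neq0.
Qed.

Lemma brownian_ito_driver (n : nat) (C : 'M[R]_n) (B : 'I_n -> R -> Omega -> R) i :
  C i i = 1 -> brownian_motion P T F C B -> ito_driver (4 * Num.sqrt 2) (B i).
Proof.
move=> Cii [aB _ indepB lawB].
(* The projection on e times the i-th basis vector. Taking e = 1 and e = -1 shows that the increment
   and its opposite share one law, the symmetry that gives orthogonality to the past. *)
have law s t (e : R) (A : set R) : 0 <= s -> s <= t -> t <= T -> e ^+ 2 = 1 -> measurable A ->
    P ((fun w => e * (B i t w - B i s w)) @^-1` A) = centered_normal (t - s) A.
  move=> s0 st tT e1 mA.
  have := lawB s t (e *: delta_mx 0 i) s0 st tT A mA.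
  have -> : (fun w => \sum_(j < n) (e *: delta_mx 0 i : 'rV[R]_n) 0 j * (B j t w - B j s w)) =
      (fun w => e * (B i t w - B i s w)).
    apply/funext => w; rewrite (bigD1 i)//= big1 ?addr0 => [|j ji].
      by rewrite !mxE !eqxx mulr1.
    by rewrite !mxE (negbTE ji) andbF mulr0 mul0r.
  move=> ->; congr (centered_normal _ A).
  have -> : ((e *: delta_mx 0 i : 'rV[R]_n) *m C *m (e *: delta_mx 0 i : 'rV[R]_n)^T) 0 0 = e ^+ 2 * C i i.
    rewrite !mxE (bigD1 i)//= big1 ?addr0 => [|j ji]; last first.
      by rewrite !mxE (negbTE ji) andbF !mulr0.
    rewrite !mxE !eqxx/= (bigD1 i)//= big1 ?addr0 => [|j ji]; last first.
      by rewrite !mxE (negbTE ji) andbF mulr0 mul0r.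
    by rewrite !mxE !eqxx/= mulr1 mulrAC expr2.
  by rewrite e1 Cii !mulr1.
have indep s t (U : Omega -> R) A A' : s \in `[0, T] -> t \in `[0, T] -> s <= t ->
    sigma_of U `<=` F s -> measurable A -> measurable A' ->
    P (U @^-1` A `&` (fun w => B i t w - B i s w)%R @^-1` A') =
    (P (U @^-1` A) * P ((fun w => B i t w - B i s w)%R @^-1` A'))%E.
  rewrite !in_itv/= => /andP[s0 sT] /andP[t0 tT] st Us mA mA'.
  apply: (indepB s t s0 st tT).
    by apply: Us; exists A => //; rewrite setTI.
  apply: sub_sigma_algebra; exists i; exists A' => //; by rewrite setTI.
have mB t : t \in `[0, T] -> measurable_fun setT (B i t).
  by move=> tT; apply: (acprocess_measurable uF) tT; have [] := aB i.
have mom s t (sT : s \in `[0, T]) (tT : t \in `[0, T]) (st : s <= t) :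
    (sqint P setT (fun w => B i t w - B i s w)%R <= (4 * Num.sqrt 2 * (t - s))%:E)%E.
  have mV := measurable_funB (mB t tT) (mB s sT).
  apply: (@centered_normal_second_moment (mkRV mV)); first by rewrite subr_ge0.
  move=> A mA; move: sT tT; rewrite !in_itv/= => /andP[s0 _] /andP[_ tT].
  rewrite -(law s t 1)//; last by rewrite expr1n.
  by congr (P (_ @^-1` A)); apply/funext => w; rewrite mul1r.
split; first exact: aB.
- move=> s t U sT tT st Us Uoo.
  have mU := filtration_measurable uF sT Us.
  have mV := measurable_funB (mB t tT) (mB s sT).
  apply: (@integral_mul_indep0 _ _ _ _ (mkRV mU) (mkRV mV)) => /=.
  + by move=> A A' mA mA'; exact: indep.
  + move=> A mA; move: sT tT; rewrite !in_itv/= => /andP[s0 _] /andP[_ tT].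
    transitivity (centered_normal (t - s) A).
      rewrite -(law s t (-1))//; last by rewrite sqrrN expr1n.
      by congr (P (_ @^-1` A)); apply/funext => w; rewrite mulN1r.
    rewrite -(law s t 1)//; last by rewrite expr1n.
    by congr (P (_ @^-1` A)); apply/funext => w; rewrite mul1r.
  + apply: sqint_mul_integrable => //.
    by rewrite (le_lt_trans (mom _ _ sT tT st))// ltry.
- move=> s t U sT tT st Us Uoo.
  have mU := filtration_measurable uF sT Us.
  have mV := measurable_funB (mB t tT) (mB s sT).
  rewrite (@sqint_mul_indep _ _ _ _ (mkRV mU) (mkRV mV)); last first.
    by move=> A A' mA mA'; exact: indep.
  rewrite muleC lee_wpmul2r ?sqint_ge0//; exact: mom.
Qed.

End drivers.

(** * Integrals of simple processes *)

Section grids.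
Context d (Omega : measurableType d) (R : realType).
Variables (T : R) (F : R -> set (set Omega)).
Hypothesis T_gt0 : 0 < T.

(** An infinite sequence in which points may repeat: repeated points carry zero increments, so a
    finite list of times becomes a grid by staying at T. *)
Definition time_grid (u : nat -> R) :=
  [/\ nondecreasing_seq u, u 0 = 0 & forall k, u k \in `[0, T]].

Lemma exists_time_grid (l : seq R) : {in l, forall a, a \in `[0, T]} ->
  exists2 u, time_grid u & {in l, forall a, exists j, u j = a}.
Proof.
(* Adding 0 makes the sorted list start there, and T is the default value of [nth], which continues
   the grid beyond the list. *)
move=> lT; pose s := sort <=%R (0 :: T :: l).
have sT a : a \in s -> a \in `[0, T].
  rewrite mem_sort 2!in_cons => /or3P[/eqP->|/eqP->|/lT//].
  - by rewrite in_itv/= lexx ltW.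
  - by rewrite in_itv/= lexx ltW.
have nT k : nth T s k \in `[0, T].
  have [ks|ks] := ltnP k (size s); first by apply: sT; exact: mem_nth.
  by rewrite nth_default// in_itv/= lexx ltW.
have srt : sorted <=%R s by apply: sort_sorted; exact: le_total.
have nd i j : (i <= j)%N -> nth T s i <= nth T s j.
  move=> ij; have [js|js] := ltnP j (size s).
    by apply: (sorted_leq_nth le_trans lexx) => //; rewrite inE (leq_ltn_trans ij).
  rewrite [leRHS]nth_default//.
  by have := nT i; rewrite in_itv/= => /andP[].
exists (fun k => nth T s k).
  split => //.
  have [j js e0] : exists2 j, (j < size s)%N & nth T s j = 0.
    have s0 : 0 \in s by rewrite mem_sort inE eqxx.
    exists (index 0 s); first by rewrite index_mem.
    exact: nth_index.
  apply/eqP; rewrite eq_le; apply/andP; split.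
    by rewrite -[leRHS]e0; exact: nd.
  by have := nT 0; rewrite in_itv/= => /andP[].
move=> a al; exists (index a s); apply: nth_index.
by rewrite mem_sort !inE al !orbT.
Qed.

Implicit Types (S : simple_process T F).

Lemma sp_time_nd S i j : (i <= j)%N -> (j <= sp_size S)%N ->
  sp_time S i <= sp_time S j.
Proof.
elim: j => [|j IH]; first by rewrite leqn0 => /eqP->.
rewrite leq_eqVlt => /predU1P[->//|ij] js.
by apply: le_trans (IH _ _) (sp_time_le js) => //; exact: ltnW.
Qed.

Lemma sp_time_itv S i : (i <= sp_size S)%N -> sp_time S i \in `[0, T].
Proof.
move=> iS; rewrite in_itv/=; apply/andP; split.
  by have := sp_time_nd (leq0n i) iS; rewrite sp_time0.
by have := sp_time_nd iS (leqnn _); rewrite sp_timeT.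
Qed.

Definition refines (u : nat -> R) S :=
  forall i, (i <= sp_size S)%N -> exists j, u j = sp_time S i.

Lemma grid_between (u : nat -> R) j k : nondecreasing_seq u -> u j < u k.+1 -> u j <= u k.
Proof.
move=> nd; rewrite ltNge => H; apply: (nd); rewrite leqNgt; apply: contra H => kj.
exact: nd.
Qed.

(** No jump time lies strictly inside a grid interval. The value is read at the right endpoint
    because the intervals of [sp_val] are closed on the right; hence the ubiquitous [u k.+1]. *)
Lemma sp_val_grid u S k s w : time_grid u -> refines u S ->
  u k < s <= u k.+1 -> sp_val S s w = sp_val S (u k.+1) w.
Proof.
move=> [nd _ _] uS /andP[ks sk]; apply: eq_bigr => i _; congr (_ * _).
have [j ej] := uS i (ltnW (ltn_ord i)); have [j' ej'] := uS i.+1 (ltn_ord i).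
rewrite !indicE; congr (_%:R); congr nat_of_bool; rewrite -ej -ej'.
apply/idP/idP; rewrite !inE/= !in_itv/= => /andP[h1 h2].
- rewrite (lt_le_trans h1 sk)/= leNgt; apply/negP => h3.
  by have := grid_between nd h3; rewrite leNgt (lt_le_trans ks h2).
- by rewrite (le_lt_trans (grid_between nd h1) ks) (le_trans sk h2).
Qed.

Lemma sp_val_bounded S : exists2 M : R, 0 <= M & forall s w, `|sp_val S s w| <= M.
Proof.
have [M HM] := sp_coef_bnd S.
exists (\sum_(i < sp_size S) `|M|); first by apply: sumr_ge0.
move=> s w; apply: (le_trans (ler_norm_sum _ _ _)); apply: ler_sum => i _.
rewrite normrM; apply: le_trans (_ : `|M| * 1 <= _); last by rewrite mulr1.
apply: ler_pM => //; first by apply: le_trans (HM i w (ltn_ord i)) (ler_norm _).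
by rewrite indicE; case: (_ \in _); rewrite ?normr1 ?normr0.
Qed.

Lemma measurable_sp_val S w : measurable_fun setT (fun s => sp_val S s w).
Proof.
apply: measurable_sum => i; apply: measurable_funM; first exact: measurable_cst.
exact: measurable_indic.
Qed.

(** The indicator keeps the increments up to [u l], which telescope. Past index l it can hold only
    where the grid repeats the value [u l], and there the increment is 0. *)
Lemma grid_sum_le (u : nat -> R) j l (f : R -> R) : nondecreasing_seq u ->
  \sum_(0 <= k < j) (u k.+1 <= u l)%R%:R * (f (u k.+1) - f (u k)) =
  f (Num.min (u l) (u j)) - f (u 0).
Proof.
move=> nd.
have tel i : (i <= l)%N -> \sum_(0 <= k < i) (u k.+1 <= u l)%R%:R * (f (u k.+1) - f (u k)) =
    f (u i) - f (u 0).
  move=> il; rewrite -(telescope_sumr (f \o u) (leq0n i)) !big_nat.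
  apply: eq_bigr => k /andP[_ ki] /=.
  by rewrite nd ?mul1r// (leq_trans ki).
have [jl|lj] := leqP j l; first by rewrite tel// min_r// nd.
rewrite min_l ?nd ?(ltnW lj)// (big_cat_nat (n := l))//=; last exact: ltnW.
rewrite tel// big_nat big1 ?addr0// => k /andP[lk _].
case: leP => [kl|_]; last by rewrite mul0r.
have e1 : u k.+1 = u l by apply/eqP; rewrite eq_le kl nd// (leq_trans lk).
have e2 : u k = u l by apply/eqP; rewrite eq_le (nd _ _ lk) -e1 nd.
by rewrite e1 e2 subrr mulr0.
Qed.

Lemma indic_oc (a b s : R) : a <= b -> \1_(`]a, b]) s = (s <= b)%R%:R - (s <= a)%R%:R :> R.
Proof.
move=> ab; rewrite indicE mem_setE in_itv/= ltNge.
case: (leP s a) => [sa|_] /=; last by rewrite subr0.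
by rewrite (le_trans sa ab) subrr.
Qed.

(** After exchanging the two sums, the indicator of each interval of S is a difference of two
    indicators of half-lines, and the grid increments telescope. *)
Lemma sp_integral_grid u S (W : R -> Omega -> R) j w : time_grid u -> refines u S ->
  sp_integral S W (u j) w =
  \sum_(0 <= k < j) sp_val S (u k.+1) w * (W (u k.+1) w - W (u k) w).
Proof.
move=> [nd u0 _] uS; rewrite /sp_integral /sp_val.
under [RHS]eq_bigr do rewrite mulr_suml.
rewrite exchange_big/=; apply: eq_bigr => i _.
under [RHS]eq_bigr do rewrite -mulrA.
rewrite -mulr_sumr; congr (_ * _).
have [l el] := uS i (ltnW (ltn_ord i)); have [l' el'] := uS i.+1 (ltn_ord i).
rewrite -el -el'.
under eq_bigr do rewrite indic_oc ?el ?el' ?sp_time_le// -?el -?el' mulrBl.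
rewrite big_split/= sumrN !(grid_sum_le _ _ (W ^~ w) nd).
by rewrite opprB addrA subrK.
Qed.

Lemma sp_val_sq_integral u (f : R -> R) (D : nat -> R) j : time_grid u ->
  measurable_fun setT f ->
  (forall k s, u k < s <= u k.+1 -> f s = D k) ->
  sqint (@lebesgue_measure R) `[0, u j] f =
  (\sum_(0 <= k < j) D k ^+ 2 * (u k.+1 - u k))%:E.
Proof.
move=> [nd u0 uT] mf fD.
have msq : measurable_fun setT (fun s => (f s ^+ 2)%:E) by exact: measurable_sqE.
have sq0 s : (0 <= (f s ^+ 2)%:E)%E by rewrite lee_fin sqr_ge0.
elim: j => [|j IH].
  by rewrite u0 big_nil /sqint set_itv1 integral_set1.
have uj0 : 0 <= u j by have := uT j; rewrite in_itv/= => /andP[].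
have ujj : u j <= u j.+1 by exact: nd.
rewrite big_nat_recr//= EFinD -IH /sqint.
have -> : `[0, u j.+1]%classic = `[0, u j]%classic `|` `]u j, u j.+1]%classic.
  by rewrite -itv_bndbnd_setU// bnd_simp.
rewrite ge0_integral_setU//.
- congr (_ + _)%E.
  rewrite (@eq_integral _ _ _ _ _ (cst (D j ^+ 2)%:E)); last first.
    by move=> s; rewrite inE/= in_itv/= => /fD ->.
  rewrite integral_cst//= lebesgue_measure_itv/= lte_fin.
  have := ujj; rewrite le_eqVlt => /predU1P[<-|->//].
  by rewrite ltxx subrr mulr0 mule0.
- exact: measurable_funTS.
- apply/disj_setPS => s []/=; rewrite !in_itv/= => /andP[_ h] /andP[h' _].
  by move: (lt_le_trans h' h); rewrite ltxx.
Qed.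

End grids.

Section grid_sums.
Context d (Omega : measurableType d) (R : realType) (P : probability Omega R).
Variables (T : R) (F : R -> set (set Omega)).
Local Notation sq := (sqint P setT).
Hypothesis uF : usual_filtration P T F.
Variables (c : R) (W : R -> Omega -> R).
Hypothesis dW : ito_driver P T F c W.

(* The martingale property is tested against square-integrable F s-measurable
   variables, which avoids conditional expectations. *)
Definition martingale2 (M : R -> Omega -> R) :=
  (forall t, t \in `[0, T] -> (sq (M t) < +oo)%E) /\
  forall s t (U : Omega -> R), s \in `[0, T] -> t \in `[0, T] -> s <= t ->
    sigma_of U `<=` F s -> (sq U < +oo)%E ->
    (\int[P]_w (U w * (M t w - M s w))%:E = 0)%E.

Lemma adapted_op2 (op : R -> R -> R) t (f g : Omega -> R) :
  (forall d' (O : measurableType d') (f g : O -> R), measurable_fun setT f ->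
    measurable_fun setT g -> measurable_fun setT (fun w => op (f w) (g w))) ->
  t \in `[0, T] -> sigma_of f `<=` F t -> sigma_of g `<=` F t ->
  sigma_of (fun w => op (f w) (g w)) `<=` F t.
Proof.
move=> mop tT /(adapted_sub_measurableP uF _ tT) mf /(adapted_sub_measurableP uF _ tT) mg.
by apply/(adapted_sub_measurableP uF _ tT); apply: mop.
Qed.

Lemma adapted_add t (f g : Omega -> R) : t \in `[0, T] ->
  sigma_of f `<=` F t -> sigma_of g `<=` F t -> sigma_of (fun w => f w + g w) `<=` F t.
Proof.
by apply: (@adapted_op2 (fun a b => a + b)) => d' O f' g'; exact: measurable_funD.
Qed.

Lemma adapted_sub t (f g : Omega -> R) : t \in `[0, T] ->
  sigma_of f `<=` F t -> sigma_of g `<=` F t -> sigma_of (fun w => f w - g w) `<=` F t.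
Proof.
by apply: (@adapted_op2 (fun a b => a - b)) => d' O f' g'; exact: measurable_funB.
Qed.

Lemma adapted_mul t (f g : Omega -> R) : t \in `[0, T] ->
  sigma_of f `<=` F t -> sigma_of g `<=` F t -> sigma_of (fun w => f w * g w) `<=` F t.
Proof.
by apply: (@adapted_op2 (fun a b => a * b)) => d' O f' g'; exact: measurable_funM.
Qed.

Lemma adapted_cst t (r : R) : t \in `[0, T] -> sigma_of (fun _ : Omega => r) `<=` F t.
Proof. by move=> tT; apply/(adapted_sub_measurableP uF _ tT); exact: measurable_cst. Qed.

Lemma adapted_sum t n (f : nat -> Omega -> R) : t \in `[0, T] ->
  (forall k, (k < n)%N -> sigma_of (f k) `<=` F t) ->
  sigma_of (fun w => \sum_(0 <= k < n) f k w) `<=` F t.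
Proof.
move=> tT; elim: n => [|n IH] Hf.
  by under [X in sigma_of X]eq_fun do rewrite big_nil; exact: adapted_cst.
under [X in sigma_of X]eq_fun do rewrite big_nat_recr//=.
by apply: adapted_add => //; [apply: IH => k kn; apply: Hf; rewrite (ltn_trans kn)|exact: Hf].
Qed.

Lemma sqint_mul_bounded (U D : Omega -> R) (M : R) :
  measurable_fun setT U -> measurable_fun setT D -> (forall w, `|D w| <= M) ->
  (sq U < +oo)%E -> (sq (fun w => U w * D w)%R < +oo)%E.
Proof.
move=> mU mD DM Uoo.
apply: (@le_lt_trans _ _ (sq (fun w => M * U w)%R)).
  apply: le_sqint => //; first exact: measurable_funM.
    exact: measurable_funM.
  move=> w _; rewrite !normrM mulrC ler_wpM2r//.
  by apply: le_trans (DM w) (ler_norm _).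
rewrite sqintZ//; move: Uoo (sqint_ge0 P setT U).
by case: (sq U) => [r| |]// _ _; rewrite -EFinM ltry.
Qed.

Lemma sqint_cst (r : R) : sq (fun=> r) = (r ^+ 2)%:E.
Proof.
rewrite /sqint (integral_cst P measurableT (r ^+ 2)%:E).
by rewrite [X in (_ * X)%E](_ : _ = 1%E) ?mule1//; exact: probability_setT.
Qed.

Lemma driver_increment_lty s t : s \in `[0, T] -> t \in `[0, T] -> s <= t ->
  (sq (fun w => W t w - W s w)%R < +oo)%E.
Proof.
move=> sT tT st; have [aW _ bnd] := dW.
have one := sqint_cst 1; rewrite expr1n in one.
have := bnd s t (fun=> 1) sT tT st (adapted_cst sT); rewrite one => /(_ (ltry _)).
rewrite mule1 => H; apply: le_lt_trans (ltry (c * (t - s))).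
by apply: le_trans H; rewrite (@sqint_eq _ _ _ _ _ _ (fun w => 1 * (W t w - W s w)))// => w _; rewrite mul1r.
Qed.

Variable u : nat -> R.
Hypothesis gu : time_grid T u.

Let uT k : u k \in `[0, T]. Proof. by case: gu. Qed.
Let und : nondecreasing_seq u. Proof. by case: gu. Qed.
Let mW k : measurable_fun setT (W (u k)).
Proof. by have [aW _ _] := dW; exact: (acprocess_measurable uF aW). Qed.
Let aW k j : (k <= j)%N -> sigma_of (W (u k)) `<=` F (u j).
Proof.
move=> kj; have [[adW _] _ _] := dW.
by apply: (sub_filtration uF (uT k)) => //; [exact: und|exact: adW].
Qed.

Variables (D : nat -> Omega -> R) (M : R).
Hypothesis aD : forall k, sigma_of (D k) `<=` F (u k).
Hypothesis bD : forall k w, `|D k w| <= M.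

Let mD k : measurable_fun setT (D k).
Proof. exact: (filtration_measurable uF (uT k) (@aD k)). Qed.

Definition grid_sum (j : nat) (w : Omega) : R :=
  \sum_(0 <= k < j) D k w * (W (u k.+1) w - W (u k) w).

Lemma adapted_grid_sum j : sigma_of (grid_sum j) `<=` F (u j).
Proof.
apply: (@adapted_sum _ _ (fun k w => D k w * (W (u k.+1) w - W (u k) w))) => // k kj.
apply: adapted_mul => //.
  by apply: (sub_filtration uF (uT k)) => //; exact/und/ltnW.
by apply: adapted_sub => //; apply: aW => //; exact: ltnW.
Qed.

Let mJ j : measurable_fun setT (grid_sum j).
Proof. exact: (filtration_measurable uF (uT j) (@adapted_grid_sum j)). Qed.

Let incr_int k U : sigma_of U `<=` F (u k) -> (sq U < +oo)%E ->
  P.-integrable setT (fun w => (U w * (W (u k.+1) w - W (u k) w))%:E).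
Proof.
move=> aU Uoo; apply: sqint_mul_integrable => //.
- exact: (filtration_measurable uF (uT k)).
- exact: measurable_funB.
- by apply: driver_increment_lty => //; exact: und.
Qed.

Let incr0 k U : sigma_of U `<=` F (u k) -> (sq U < +oo)%E ->
  (\int[P]_w (U w * (W (u k.+1) w - W (u k) w))%:E = 0)%E.
Proof.
by move=> aU Uoo; have [_ + _] := dW; apply => //; exact: und.
Qed.

Let D_lty k : (sq (D k) < +oo)%E.
Proof.
have one : (sq (fun=> 1%R) < +oo)%E.
  by rewrite sqint_cst ltry.
have := @sqint_mul_bounded (fun=> 1) (D k) M (measurable_cst _) (@mD k) (@bD k) one.
by rewrite (@sqint_eq _ _ _ _ _ (fun w => 1 * D k w) (D k))// => w _; rewrite mul1r.
Qed.

(** Discrete Ito isometry. In the square of J + D dW the cross term has mean 0, because J D is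
    square integrable and known at [u j]. Finiteness is part of the induction since orthogonality
    can only be applied to square integrable factors. *)
Lemma grid_sum_sqint j : (sq (grid_sum j) < +oo)%E /\
  (sq (grid_sum j) <=
   \sum_(0 <= k < j) (c * (u k.+1 - u k))%:E * sq (D k))%E.
Proof.
elim: j => [|j [IHoo IH]].
  rewrite big_nil; have -> : sq (grid_sum 0) = 0%E.
    rewrite /sqint; under eq_integral do rewrite /grid_sum big_nil expr0n/=.
    by rewrite integral0.
  by split.
pose dj w := W (u j.+1) w - W (u j) w.
have mdj : measurable_fun setT dj by exact: measurable_funB.
have JD : sigma_of (fun w => grid_sum j w * D j w) `<=` F (u j).
  by apply: adapted_mul => //; exact: adapted_grid_sum.
have JDoo : (sq (fun w => grid_sum j w * D j w)%R < +oo)%E.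
  exact: sqint_mul_bounded.
have Dd : (sq (fun w => D j w * dj w)%R <=
    (c * (u j.+1 - u j))%:E * sq (D j))%E.
  by have [_ _ bnd] := dW; apply: bnd => //; exact: und.
have Ddoo : (sq (fun w => D j w * dj w)%R < +oo)%E.
  apply: (le_lt_trans Dd); move: (D_lty j) (sqint_ge0 P setT (D j)).
  by case: (sq (D j)) => [r| |]// _ _; rewrite -EFinM ltry.
have sqi f : measurable_fun setT f -> (sq f < +oo)%E ->
    P.-integrable setT (fun w => (f w ^+ 2)%:E).
  move=> mf foo; under [X in P.-integrable _ X]eq_fun do rewrite expr2.
  exact: sqint_mul_integrable.
have E : sq (grid_sum j.+1) =
    (sq (grid_sum j) + sq (fun w => D j w * dj w)%R)%E.
  rewrite {1}/sqint.
  rewrite (@eq_integral _ _ _ _ _ (fun w => ((grid_sum j w ^+ 2)%:E +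
     (2%:E * ((grid_sum j w * D j w) * dj w)%:E + ((D j w * dj w) ^+ 2)%:E))%E)); last first.
    move=> w _; rewrite -EFinM -!EFinD; congr EFin.
    by rewrite /grid_sum big_nat_recr//= -/(dj w) sqrrD -mulr_natl; ring.
  have i1 : P.-integrable setT (fun w => ((grid_sum j w * D j w) * dj w)%:E).
    exact: incr_int.
  have i2 := sqi _ (measurable_funM (@mD j) mdj) Ddoo.
  rewrite integralD//; last 2 first.
  - exact: sqi.
  - by apply: integrableD => //; exact: integrableZl.
  rewrite integralD//; last exact: integrableZl.
  by rewrite integralZl// incr0// mule0 add0e.
rewrite E big_nat_recr//=; split; first exact: lte_add_pinfty.
exact: leeD.
Qed.

(** Each further step adds U D dW, whose factor U D is known at the start of the increment. *)
Lemma grid_sum_orthogonal i j U : (i <= j)%N -> sigma_of U `<=` F (u i) ->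
  (sq U < +oo)%E ->
  (\int[P]_w (U w * (grid_sum j w - grid_sum i w))%:E = 0)%E.
Proof.
move=> ij aU Uoo; elim: j ij => [|j IH].
  rewrite leqn0 => /eqP->; rewrite integral0_eq// => w _.
  by rewrite subrr mulr0.
rewrite leq_eqVlt => /predU1P[->|ij].
  by rewrite integral0_eq// => w _; rewrite subrr mulr0.
have mU := filtration_measurable uF (uT i) aU.
have aU' : sigma_of U `<=` F (u j) by apply: (sub_filtration uF (uT i)) => //; exact: und.
have aUD : sigma_of (fun w => U w * D j w) `<=` F (u j) by exact: adapted_mul.
have UDoo : (sq (fun w => U w * D j w)%R < +oo)%E by exact: sqint_mul_bounded.
rewrite (@eq_integral _ _ _ _ _ (fun w => ((U w * (grid_sum j w - grid_sum i w))%:E +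
     ((U w * D j w) * (W (u j.+1) w - W (u j) w))%:E)%E)); last first.
  move=> w _; rewrite -EFinD; congr EFin.
  by rewrite {1}/grid_sum big_nat_recr//= -/(grid_sum j w); ring.
rewrite integralD//; last 2 first.
- apply: sqint_mul_integrable => //; first exact: measurable_funB.
  apply: le_lt_trans (_ : (2%:E * sq (grid_sum j) + 2%:E * sq (grid_sum i) < +oo)%E).
    rewrite (@sqint_eq _ _ _ _ _ _ (fun w => grid_sum j w + (- 1) * grid_sum i w)); last first.
      by move=> w _; rewrite mulN1r.
    apply: (le_trans (sqintD _ _ _ _)) => //; first exact: measurable_funM.
    by rewrite sqintZ// sqrrN expr1n mul1e.
  have [Hi _] := grid_sum_sqint i; have [Hj _] := grid_sum_sqint j.
  by rewrite lte_add_pinfty// lte_mul_pinfty.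
- exact: incr_int.
by rewrite IH// incr0// adde0.
Qed.

End grid_sums.

Lemma continuous_sum (R : realType) I (r : seq I) (f : I -> R -> R) :
  (forall i, continuous (f i)) -> continuous (fun t => \sum_(i <- r) f i t).
Proof.
move=> cf; elim: r => [|i r IH] t.
  by under eq_fun do rewrite big_nil; exact: cvg_cst.
by under eq_fun do rewrite big_cons; apply: cvgD; [exact: cf|exact: IH].
Qed.

Section simple_integrals.
Context d (Omega : measurableType d) (R : realType) (P : probability Omega R).
Variables (T : R) (F : R -> set (set Omega)).
Hypothesis T_gt0 : 0 < T.
Hypothesis uF : usual_filtration P T F.
Variables (c : R) (W : R -> Omega -> R).
Hypothesis dW : ito_driver P T F c W.
Implicit Types S : simple_process T F.

Definition sqint2 (t : R) (V : R -> Omega -> R) : \bar R :=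
  (\int[P]_w sqint (@lebesgue_measure R) `[0%R, t] (V ^~ w))%E.

(** Predictability. A coefficient contributes at [u k.+1] only if its starting time is below
    [u k.+1]; being a grid point, that time is then at most [u k]. *)
Lemma adapted_sp_val S u k : time_grid T u -> refines u S ->
  sigma_of (sp_val S (u k.+1)) `<=` F (u k).
Proof.
move=> [und u0 uT] uS.
pose f i w := sp_coef S i w * (\1_`]sp_time S i, sp_time S i.+1] (u k.+1) : R).
have -> : sp_val S (u k.+1) = fun w => \sum_(0 <= i < sp_size S) f i w.
  by apply/funext => w; rewrite /sp_val big_mkord.
apply: (@adapted_sum _ _ _ _ _ _ uF _ _ f) => // i iS; rewrite /f.
have [j ej] := uS i (ltnW iS).
have [tu|ut] := ltP (sp_time S i) (u k.+1); last first.
  rewrite (_ : (fun w => _) = fun=> 0); first exact: (adapted_cst uF).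
  apply/funext => w; rewrite indicE memNset ?mulr0//= in_itv/= => /andP[].
  by rewrite ltNge ut.
apply: (adapted_mul uF) => //; last exact: (adapted_cst uF).
apply: (sub_filtration uF _ _ _ (@sp_coef_meas _ _ _ _ _ S i iS)) => //.
  by rewrite -ej.
by move: tu; rewrite -ej; exact: grid_between.
Qed.

(** On a common grid the difference of two simple integrals is a single [grid_sum]; the list l
    forces prescribed times into the grid. *)
Lemma refine_two S S' (l : seq R) : {in l, forall a, a \in `[0, T]} ->
  exists u, [/\ time_grid T u, refines u S, refines u S' &
    {in l, forall a, exists j, u j = a}].
Proof.
move=> lT; pose tS (S : simple_process T F) := [seq sp_time S i | i <- iota 0 (sp_size S).+1].
have tST S0 a : a \in tS S0 -> a \in `[0, T].
  by move=> /mapP[i]; rewrite mem_iota add0n => /= iS ->; apply: sp_time_itv.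
have tSP S0 i : (i <= sp_size S0)%N -> sp_time S0 i \in tS S0.
  by move=> iS; apply/mapP; exists i => //; rewrite mem_iota.
have [a|u gu ul] := @exists_time_grid _ T T_gt0 (tS S ++ tS S' ++ l).
  by rewrite !mem_cat => /or3P[/tST|/tST|/lT].
exists u; split => //.
- by move=> i iS; apply: ul; rewrite !mem_cat tSP.
- by move=> i iS; apply: ul; rewrite !mem_cat tSP ?orbT.
- by move=> a al; apply: ul; rewrite !mem_cat al !orbT.
Qed.

Lemma sp_integral_martingale2 S : martingale2 P T F (sp_integral S W).
Proof.
have [M M0 SM] := sp_val_bounded S.
have E u : time_grid T u -> refines u S -> forall j,
    sp_integral S W (u j) = grid_sum W u (fun k => sp_val S (u k.+1)) j.
  by move=> gu uS j; apply/funext => w; rewrite (sp_integral_grid _ _ _ gu uS).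
split.
  move=> t tT; have [a|u [gu uS _ ul]] := @refine_two S S [:: t].
    by rewrite inE => /eqP->.
  have [j ej] := ul t (mem_head _ _); rewrite -ej E//.
  apply: (proj1 (grid_sum_sqint uF dW gu _ (fun k w => SM (u k.+1) w) j)) => k.
  exact: adapted_sp_val.
move=> s t U sT tT st aU Uoo.
have [a|u [gu uS _ ul]] := @refine_two S S [:: s; t].
  by rewrite !inE => /orP[]/eqP->.
have [i ei] := ul s (mem_head _ _); have [|j ej] := ul t; first by rewrite !inE eqxx orbT.
have [und _ _] := gu.
have [ij|ji] := leqP i j.
  rewrite -ei -ej !E//; apply: (grid_sum_orthogonal uF dW gu _ (fun k w => SM (u k.+1) w)) => //.
    by move=> k; exact: adapted_sp_val.
  by rewrite ei.
(* Grid points may repeat, so the indices can come in the wrong order; the two times then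
   coincide. *)
have -> : t = s.
  by apply/eqP; rewrite eq_le st andbT -ei -ej und// ltnW.
by rewrite integral0_eq// => w _; rewrite subrr mulr0.
Qed.

Lemma sp_integral_acprocess S : acprocess T F (sp_integral S W).
Proof.
have [M M0 SM] := sp_val_bounded S; have [aW _ _] := dW.
split.
  move=> t tT; have [a|u [gu uS _ ul]] := @refine_two S S [:: t].
    by rewrite inE => /eqP->.
  have [j ej] := ul t (mem_head _ _); rewrite -ej.
  have -> : sp_integral S W (u j) = grid_sum W u (fun k => sp_val S (u k.+1)) j.
    by apply/funext => w; rewrite (sp_integral_grid _ _ _ gu uS).
  apply: (adapted_grid_sum uF dW gu) => k; exact: adapted_sp_val.
move=> w; have T0 := ltW T_gt0.
apply: (@subspace_eq_continuous _ _ _ (fun t => \sum_(i < sp_size S) sp_coef S i w *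
    (W (clamp T (Num.min (sp_time S i.+1) t)) w - W (clamp T (Num.min (sp_time S i) t)) w))).
  move=> t; rewrite inE/= => tT; apply: eq_bigr => i _.
  have mT i' : (i' <= sp_size S)%N -> Num.min (sp_time S i') t \in `[0, T].
    move=> iS; case: (leP (sp_time S i') t) => // _; exact: sp_time_itv.
  by rewrite !clamp_id ?mT// ltnW.
apply: continuous_subspaceT; apply: continuous_sum => i t.
apply: cvgM; first exact: cvg_cst.
have ct a : {for t, continuous (fun t => W (clamp T (Num.min a t)) w)}.
  apply: (@continuous_comp _ _ _ (fun t => Num.min a t) (fun t => W (clamp T t) w)).
    apply: continuous_min; [exact: cvg_cst|exact: cvg_id].
  exact: (acprocess_continuous T_gt0 aW).
by apply: cvgB; exact: ct.
Qed.

(** The Ito isometry as an inequality: on a common grid the weighted sum given by [grid_sum_sqint]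
    is the integral of a squared step function. *)
Lemma sp_integralB_sqint S S' t : t \in `[0, T] ->
  (sqint P setT (fun w => sp_integral S W t w - sp_integral S' W t w)%R <=
   c%:E * sqint2 t (fun s w => sp_val S s w - sp_val S' s w)%R)%E.
Proof.
move=> tT; have [M M0 SM] := sp_val_bounded S; have [M' M'0 SM'] := sp_val_bounded S'.
have [a|u [gu uS uS' ul]] := @refine_two S S' [:: t].
  by rewrite inE => /eqP->.
have [j ej] := ul t (mem_head _ _); rewrite -ej.
pose D k w := sp_val S (u k.+1) w - sp_val S' (u k.+1) w.
have DM k w : `|D k w| <= M + M' by rewrite (le_trans (ler_normB _ _))// lerD.
have uT k : u k \in `[0, T] by case: gu.
have und : nondecreasing_seq u by case: gu.
have aD k : sigma_of (D k) `<=` F (u k).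
  by apply: (adapted_sub uF) => //; exact: adapted_sp_val.
have mD k := filtration_measurable uF (uT k) (@aD k).
have -> : (fun w => sp_integral S W (u j) w - sp_integral S' W (u j) w) = grid_sum W u D j.
  apply/funext => w; rewrite !(sp_integral_grid _ _ _ gu)// -sumrB.
  by apply: eq_bigr => k _; rewrite -mulrBl.
apply: (le_trans (proj2 (grid_sum_sqint uF dW gu aD DM j))).
rewrite /sqint2; under eq_integral => w _.
  rewrite (@sp_val_sq_integral _ T u _ (D ^~ w))//; last 2 first.
  - by apply: measurable_funB; exact: measurable_sp_val.
  - by move=> k s usk; rewrite !(sp_val_grid _ gu _ usk).
  over.
rewrite /=; under eq_integral do rewrite -sumEFin.
have du k : 0 <= u k.+1 - u k by rewrite subr_ge0; exact: und.
have i0 k w : (0 <= (D k w ^+ 2 * (u k.+1 - u k))%:E)%E.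
  by rewrite lee_fin mulr_ge0 ?sqr_ge0.
rewrite ge0_integral_sum//; last first.
  by move=> k; apply/measurable_EFinP; apply: measurable_funM => //; exact: measurable_funX.
rewrite ge0_sume_distrr; last by move=> k _; exact: integral_ge0.
apply: lee_sum => k _; rewrite EFinM -muleA /sqint -ge0_integralZl//.
- by under [in leRHS]eq_integral do rewrite mulrC EFinM.
- exact: measurable_sqE.
- by move=> w _; rewrite lee_fin sqr_ge0.
- by rewrite lee_fin.
Qed.

End simple_integrals.

(** * Doob's inequality and completeness *)

Section doob_pathwise.
Context {R : realType}.
Implicit Types x : nat -> R.

Fixpoint runmax x n : R :=
  if n is m.+1 then Num.max (runmax x m) `|x m.+1| else `|x 0|.

Lemma runmax_ge0 x n : 0 <= runmax x n.
Proof. by elim: n => [|n IH] /=; rewrite ?normr_ge0// le_max IH. Qed.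

Lemma le_runmax x k n : (k <= n)%N -> `|x k| <= runmax x n.
Proof.
elim: n => [|n IH]; first by rewrite leqn0 => /eqP->.
rewrite leq_eqVlt => /predU1P[->|kn] /=; first by rewrite le_max lexx orbT.
by rewrite le_max IH.
Qed.

(* The pathwise form of Doob's L^2 inequality (Acciaio et al.): with the running
   maximum m and the increments dx, the quantity
   m_n^2 - 2 m_n |x_n| + 2 \sum m_k sg(x_k) dx_k is nonincreasing in n. *)
Lemma doob_pathwise x n :
  runmax x n ^+ 2 +
    4 * \sum_(0 <= k < n) runmax x k * Num.sg (x k) * (x k.+1 - x k) <=
  4 * x n ^+ 2.
Proof.
have key : runmax x n ^+ 2 - 2 * runmax x n * `|x n| +
    2 * \sum_(0 <= k < n) runmax x k * Num.sg (x k) * (x k.+1 - x k) <= 0.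
  elim: n => [|n IH].
    by rewrite big_nil /= mulr0 addr0; have := sqr_ge0 (`|x 0|); nra.
  rewrite big_nat_recr//=; set S := \sum_(_ <= _ < _) _ in IH *.
  (* The sign is a subgradient of the absolute value. What remains depends on whether the running
     maximum grows at this step. *)
  have sgle : Num.sg (x n) * (x n.+1 - x n) <= `|x n.+1| - `|x n|.
    rewrite mulrBr -normrEsg lerD2r.
    case: (sgrP (x n)) => _; rewrite ?mul0r ?normr_ge0// ?mul1r ?ler_norm// mulN1r.
    by rewrite -normrN ler_norm.
  have := ler_wpM2l (runmax_ge0 x n) sgle; rewrite mulrA.
  have m0 := runmax_ge0 x n; have y0 := normr_ge0 (x n.+1).
  set a := runmax x n in IH m0 *; set b := `|x n.+1| in y0 *.
  set e := _ * (x n.+1 - x n); set s := `|x n| in IH *.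
  by case: (leP a b) => ab; nra.
(* Subtracting this square from twice [key] removes the product of the maximum and the final value
   and leaves 4 x_n^2. *)
have := sqr_ge0 (runmax x n - 2 * `|x n|).
rewrite -[x n ^+ 2]real_normK ?num_real//.
set a := runmax x n in key *; set s := `|x n| in key *.
by set S := \sum_(_ <= _ < _) _ in key *; nra.
Qed.

Lemma measurable_sgr : measurable_fun setT (@Num.sg R).
Proof.
apply: nondecreasing_measurable => // x y xy.
case: (sgrP x) => hx; case: (sgrP y) => hy; rewrite ?lexx ?ler01 ?lerN10//; try lra.
Qed.

End doob_pathwise.

Section martingales.
Context d (Omega : measurableType d) (R : realType) (P : probability Omega R).
Variables (T : R) (F : R -> set (set Omega)).
Local Notation sq := (sqint P setT).
Hypothesis T_gt0 : 0 < T.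
Hypothesis uF : usual_filtration P T F.
Implicit Types M : R -> Omega -> R.

Let sqi f : measurable_fun setT f -> (sq f < +oo)%E ->
  P.-integrable setT (fun w => (f w ^+ 2)%:E).
Proof.
move=> mf foo; under [X in P.-integrable _ X]eq_fun do rewrite expr2.
exact: sqint_mul_integrable.
Qed.

Lemma sqintB_lty (f g : Omega -> R) : measurable_fun setT f -> measurable_fun setT g ->
  (sq f < +oo)%E -> (sq g < +oo)%E ->
  (sq (fun w => f w - g w)%R < +oo)%E.
Proof.
move=> mf mg foo goo.
rewrite (@sqint_eq _ _ _ _ _ _ (fun w => f w + (- 1) * g w)); last first.
  by move=> w _; rewrite mulN1r.
apply: (le_lt_trans (sqintD _ _ _ _)) => //; first exact: measurable_funM.
by rewrite sqintZ// sqrrN expr1n mul1e lte_add_pinfty// lte_mul_pinfty.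
Qed.

(** Integrate [doob_pathwise]: its sum pairs each increment of M with a square integrable variable
    known before it, hence has mean 0. *)
Lemma doob_grid M u n : adapted T F M -> martingale2 P T F M ->
  nondecreasing_seq u -> (forall k, u k \in `[0, T]) ->
  (sq (fun w => runmax (fun k => M (u k) w) n) <=
   4%:E * sq (M (u n)))%E.
Proof.
move=> aM [Moo Morth] und uT.
pose mx k w := runmax (fun k => M (u k) w) k.
pose xi k w := mx k w * Num.sg (M (u k) w).
have meas (f : Omega -> R) k : sigma_of f `<=` F (u k) <->
    measurable_fun setT (f : g_sigma_algebraType (F (u k)) -> R).
  exact: (adapted_sub_measurableP uF).
have amx k : sigma_of (mx k) `<=` F (u k).
  elim: k => [|k IH]; apply/meas.
    by apply: measurableT_comp => //; apply/meas; exact: aM.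
  apply: measurable_maxr.
    by apply/meas; apply: (sub_filtration uF (uT k)) => //; exact: und.
  by apply: measurableT_comp => //; apply/meas; exact: aM.
have axi k : sigma_of (xi k) `<=` F (u k).
  apply/meas; apply: measurable_funM; first exact/meas.
  by apply: (measurableT_comp measurable_sgr); apply/meas; exact: aM.
have mM k : measurable_fun setT (M (u k)).
  exact: (filtration_measurable uF (uT k) (aM _ (uT k))).
have mmx k : measurable_fun setT (mx k) := filtration_measurable uF (uT k) (amx k).
have mxi k : measurable_fun setT (xi k) := filtration_measurable uF (uT k) (axi k).
have mxoo k : (sq (mx k) < +oo)%E.
  elim: k => [|k IH].
    apply: le_lt_trans (Moo _ (uT 0)); apply: le_sqint => // w _.
    by rewrite /mx/= normr_id.
  apply: (@le_lt_trans _ _ (sq (fun w => mx k w + `|M (u k.+1) w|)%R)).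
    apply: le_sqint => //.
      by apply: measurable_funD => //; exact: measurableT_comp.
    move=> w _; have m0 := runmax_ge0 (fun k => M (u k) w) k.
    rewrite ger0_norm; last exact: runmax_ge0.
    rewrite ger0_norm ?addr_ge0// /mx/= ge_max; apply/andP; split.
      by rewrite lerDl.
    by rewrite lerDr.
  apply: (le_lt_trans (sqintD _ _ _ _)) => //; first exact: measurableT_comp.
  rewrite lte_add_pinfty ?lte_mul_pinfty//.
  apply: le_lt_trans (Moo _ (uT k.+1)); apply: le_sqint => //.
    exact: measurableT_comp.
  by move=> w _; rewrite normr_id.
have xioo k : (sq (xi k) < +oo)%E.
  apply: (@sqint_mul_bounded _ _ _ P (mx k) (fun w => Num.sg (M (u k) w)) 1) => //.
    exact: (measurableT_comp measurable_sgr).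
  by move=> w; case: (sgrP (M (u k) w)) => _; rewrite ?normrN ?normr1 ?normr0.
have icr k : P.-integrable setT (fun w => (xi k w * (M (u k.+1) w - M (u k) w))%:E).
  apply: sqint_mul_integrable => //; first exact: measurable_funB.
  by apply: sqintB_lty => //; exact: Moo.
have iS : P.-integrable setT (fun w =>
    \sum_(0 <= k < n) (xi k w * (M (u k.+1) w - M (u k) w))%:E)%E.
  exact: integrable_sum.
have S0 : (\int[P]_w \sum_(0 <= k < n) (xi k w * (M (u k.+1) w - M (u k) w))%:E = 0)%E.
  rewrite integral_sum// big1// => k _.
  by apply: Morth => //; exact: und.
have E0 : sq (mx n) = (\int[P]_w ((mx n w ^+ 2)%:E +
    4%:E * \sum_(0 <= k < n) (xi k w * (M (u k.+1) w - M (u k) w))%:E))%E.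
  rewrite integralD//; last 2 first.
  - exact: sqi.
  - exact: integrableZl.
  by rewrite integralZl// S0 mule0 adde0.
rewrite -/(mx n) E0 /sqint -ge0_integralZl//; last 2 first.
- exact: measurable_sqE.
- by move=> w _; rewrite lee_fin sqr_ge0.
apply: le_integral => //.
- exact: (integrableD measurableT (sqi (mmx n) (mxoo n)) (integrableZl measurableT 4 iS)).
- exact: (integrableZl measurableT 4 (sqi (mM n) (Moo _ (uT n)))).
- move=> w _; rewrite sumEFin -!EFinM -EFinD lee_fin.
  exact: (doob_pathwise (fun k => M (u k) w) n).
Qed.

Lemma normS2_martingale M : acprocess T F M -> martingale2 P T F M ->
  (normS2 P T M <= 4%:E * sq (M T))%E.
Proof.
move=> aM mM; apply: (normS2_le_maxsq T_gt0 uF aM) => N.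
(* Stopping the index at 2^N keeps this infinite sequence inside [0, T]. *)
pose u k := gridpt T N (minn k (2 ^ N)).
have uT k : u k \in `[0, T] by apply: (gridpt_itv T_gt0); exact: geq_minr.
have und : nondecreasing_seq u.
  move=> i j ij; rewrite /u /gridpt; apply: ler_wpM2r; first by rewrite invr_ge0.
  apply: ler_wpM2r; first exact: ltW.
  by rewrite ler_nat leq_min geq_minr andbT (leq_trans (geq_minl _ _)).
have uE : u (2 ^ N)%N = T.
  by rewrite /u minnn /gridpt mulrAC divff ?mul1r// pnatr_eq0 -lt0n expn_gt0.
have := @doob_grid M u (2 ^ N)%N aM.1 mM und uT; rewrite uE; apply: le_trans.
apply: ge0_le_integral => //.
- by move=> w _; rewrite lee_fin maxsq_ge0.
- by apply/measurable_EFinP; apply: (measurable_maxsq T_gt0 uF); exact: aM.1.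
- apply: measurable_sqE; elim: (2 ^ N)%N => [|k IH] /=.
    by apply: measurableT_comp => //; exact: (acprocess_measurable uF aM).
  apply: measurable_maxr => //; apply: measurableT_comp => //.
  exact: (acprocess_measurable uF aM).
move=> w _; rewrite lee_fin; apply: bigmax_le; first exact: sqr_ge0.
move=> k _; have kN : (k <= 2 ^ N)%N by rewrite -ltnS.
have := le_runmax (fun k => M (u k) w) kN.
rewrite /u (minn_idPl kN) => h.
by rewrite -[X in X <= _]real_normK ?num_real// lerXn2r ?nnegrE ?runmax_ge0.
Qed.

(** Young's inequality with a free weight e, in the role of Cauchy-Schwarz. *)
Lemma abse_integral_mul_le (U D : Omega -> R) (e : R) : 0 < e ->
  measurable_fun setT U -> measurable_fun setT D ->
  (`|\int[P]_w (U w * D w)%:E| <= e%:E * sq U + e^-1%:E * sq D)%E.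
Proof.
move=> e0 mU mD.
apply: (le_trans (le_abse_integral _ _ _)) => //.
  by apply/measurable_EFinP; exact: measurable_funM.
have sq0 (f : Omega -> R) w : (0 <= (f w ^+ 2)%:E)%E by rewrite lee_fin sqr_ge0.
rewrite /sqint -!ge0_integralZl//; last 4 first.
- exact: measurable_sqE.
- by rewrite lee_fin invr_ge0 ltW.
- exact: measurable_sqE.
- by rewrite lee_fin ltW.
rewrite -ge0_integralD//; last 4 first.
- by move=> w _; rewrite mule_ge0// lee_fin ltW.
- by apply: emeasurable_funM => //; exact: measurable_sqE.
- by move=> w _; rewrite mule_ge0// lee_fin invr_ge0 ltW.
- by apply: emeasurable_funM => //; exact: measurable_sqE.
apply: ge0_le_integral => //.
- apply: measurableT_comp => //.
  by apply/measurable_EFinP; exact: measurable_funM.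
- by apply: emeasurable_funD; apply: emeasurable_funM => //; exact: measurable_sqE.
move=> w _; rewrite -!EFinM -EFinD lee_fin normrM.
rewrite -[U w ^+ 2]real_normK ?num_real// -[D w ^+ 2]real_normK ?num_real//.
have := sqr_ge0 (e * `|U w| - `|D w|).
rewrite -(ler_pM2l e0) mulrDr mulVKf ?gt_eqF//.
have := mulr_ge0 (normr_ge0 (U w)) (normr_ge0 (D w)); nra.
Qed.

(** Against a test variable U, the increments of M and of [Mn n] differ by an error that is small in
    L^2; Young's inequality makes its pairing with U arbitrarily small. *)
Lemma martingale2_lim M (Mn : nat -> R -> Omega -> R) : adapted T F M ->
  (forall n, adapted T F (Mn n)) -> (forall n, martingale2 P T F (Mn n)) ->
  (forall t, t \in `[0, T] ->
     sq (fun w => Mn n t w - M t w) @[n --> \oo] --> 0%E) ->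
  martingale2 P T F M.
Proof.
move=> aM aMn mMn cM.
have mM t : t \in `[0, T] -> measurable_fun setT (M t) := adapted_measurable uF aM.
have mMn' n t : t \in `[0, T] -> measurable_fun setT (Mn n t) := adapted_measurable uF (aMn n).
have small t (e : R) : t \in `[0, T] -> 0 < e -> exists N, forall n, (N <= n)%N ->
    (sq (fun w => Mn n t w - M t w)%R <= e%:E)%E.
  move=> tT e0.
  by have /cvge0P := cM t tT; apply => // n; exact: sqint_ge0.
have Moo t : t \in `[0, T] -> (sq (M t) < +oo)%E.
  move=> tT; have [N /(_ N (leqnn _)) HN] := small t 1 tT ltr01.
  have [Noo _] := mMn N.
  rewrite (@sqint_eq _ _ _ _ _ _ (fun w => Mn N t w - (Mn N t w - M t w))); last first.
    by move=> w _; congr (_ ^+ 2); ring.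
  apply: sqintB_lty; [exact: mMn'|apply: measurable_funB; [exact: mMn'|exact: mM]| |].
    exact: Noo.
  by rewrite (le_lt_trans HN)// ltry.
split => // s t U sT tT st aU Uoo.
have mU := filtration_measurable uF sT aU.
apply/eqP; rewrite -abse_eq0 eq_le abse_ge0 andbT.
have int f g : f \in `[0, T] -> g \in `[0, T] ->
    P.-integrable setT (fun w => (U w * (M f w - M g w))%:E).
  move=> fT gT; apply: sqint_mul_integrable => //.
    by apply: measurable_funB; exact: mM.
  by apply: sqintB_lty; [exact: mM|exact: mM|exact: Moo|exact: Moo].
apply/lee_addgt0Pr => e e0; rewrite add0e.
have Afin : sq U \is a fin_num by rewrite ge0_fin_numE// sqint_ge0.
set A := fine (sq U).
have A0 : 0 <= A by rewrite fine_ge0// sqint_ge0.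
(* The weight h keeps h A below e / 2. Errors of at most e h / 8 at s and at t give [sq D] <= e h /
   2, which divided by h is again e / 2. *)
pose h := e / (2 * (A + 1)).
have h0 : 0 < h by rewrite divr_gt0// mulr_gt0// ltr_wpDl.
have k0 : 0 < e * h / 8 by rewrite divr_gt0// mulr_gt0.
have [N1 HN1] := small s _ sT k0; have [N2 HN2] := small t _ tT k0.
pose n := maxn N1 N2.
have {}HN1 := HN1 n (leq_maxl _ _); have {}HN2 := HN2 n (leq_maxr _ _).
pose D w := (Mn n s w - M s w) - (Mn n t w - M t w).
have mDs : measurable_fun setT (fun w => Mn n s w - M s w).
  by apply: measurable_funB; [exact: mMn'|exact: mM].
have mDt : measurable_fun setT (fun w => Mn n t w - M t w).
  by apply: measurable_funB; [exact: mMn'|exact: mM].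
have mD : measurable_fun setT D by exact: measurable_funB.
have [Mnoo Mnorth] := mMn n.
have -> : (\int[P]_w (U w * (M t w - M s w))%:E = \int[P]_w (U w * D w)%:E)%E.
  rewrite (@eq_integral _ _ _ _ _ (fun w => ((U w * D w)%:E + (U w * (Mn n t w - Mn n s w))%:E)%E)); last first.
    by move=> w _; rewrite -EFinD /D; congr EFin; ring.
  rewrite integralD//.
  - by rewrite Mnorth// adde0.
  - apply: sqint_mul_integrable => //; apply: sqintB_lty => //.
      by rewrite (le_lt_trans HN1)// ltry.
    by rewrite (le_lt_trans HN2)// ltry.
  - apply: sqint_mul_integrable => //.
      by apply: measurable_funB; exact: mMn'.
    by apply: sqintB_lty; [exact: mMn'|exact: mMn'|exact: Mnoo|exact: Mnoo].
apply: (le_trans (abse_integral_mul_le h0 mU mD)).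
have D4 : (sq D <= (e * h / 2)%:E)%E.
  rewrite (@sqint_eq _ _ _ _ _ _ (fun w => (Mn n s w - M s w) + (-1) * (Mn n t w - M t w))); last first.
    by move=> w _; rewrite mulN1r.
  apply: (le_trans (sqintD _ _ _ _)) => //; first exact: measurable_funM.
  rewrite sqintZ// sqrrN expr1n mul1e.
  have -> : (e * h / 2)%:E = (2%:E * (e * h / 8)%:E + 2%:E * (e * h / 8)%:E)%E.
    by rewrite -EFinM -EFinD; congr EFin; field.
  by apply: leeD; apply: lee_wpmul2l.
apply: (@le_trans _ _ (h%:E * A%:E + h^-1%:E * (e * h / 2)%:E)%E).
  by rewrite /A fineK// leeD2l// lee_wpmul2l// lee_fin invr_ge0 ltW.
rewrite -!EFinM -EFinD lee_fin.
have -> : h^-1 * (e * h / 2) = e / 2 by field; rewrite gt_eqF.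
suff : h * A <= e / 2 by lra.
have -> : h * A = (e / 2) * (A / (A + 1)) by rewrite /h; field; rewrite gt_eqF// ltr_wpDl.
apply: ler_piMr; first by rewrite divr_ge0// ltW.
by rewrite ler_pdivrMr ?ltr_wpDl// mul1r lerDl.
Qed.

Lemma martingale2B M M' : adapted T F M -> adapted T F M' ->
  martingale2 P T F M -> martingale2 P T F M' ->
  martingale2 P T F (fun t w => M t w - M' t w).
Proof.
move=> aM aM' [Moo Mo] [M'oo M'o].
have mM t : t \in `[0, T] -> measurable_fun setT (M t) := adapted_measurable uF aM.
have mM' t : t \in `[0, T] -> measurable_fun setT (M' t) := adapted_measurable uF aM'.
split.
  by move=> t tT; apply: sqintB_lty; [exact: mM|exact: mM'|exact: Moo|exact: M'oo].
move=> s t U sT tT st aU Uoo.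
have mU := filtration_measurable uF sT aU.
rewrite (@eq_integral _ _ _ _ _ (fun w => ((U w * (M t w - M s w))%:E - (U w * (M' t w - M' s w))%:E)%E)); last first.
  by move=> w _; rewrite -EFinB; congr EFin; ring.
rewrite integralB//.
- by rewrite Mo// M'o// subee.
- apply: sqint_mul_integrable => //; first by apply: measurable_funB; exact: mM.
  by apply: sqintB_lty; [exact: mM|exact: mM|exact: Moo|exact: Moo].
- apply: sqint_mul_integrable => //; first by apply: measurable_funB; exact: mM'.
  by apply: sqintB_lty; [exact: mM'|exact: mM'|exact: M'oo|exact: M'oo].
Qed.

End martingales.

Section completeness.
Context d (Omega : measurableType d) (R : realType) (P : probability Omega R).
Variables (T : R) (F : R -> set (set Omega)).
Hypothesis T_gt0 : 0 < T.
Hypothesis uF : usual_filtration P T F.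

(** The sequences x_n - 2 C 2^-n and x_n + 2 C 2^-n are monotone in opposite directions and enclose
    x_n; their gap tends to 0, so they also enclose the limit. *)
Lemma geometric_increments_cvg (x : nat -> R) (C : R) : 0 <= C ->
  (forall n, `|x n.+1 - x n| <= C * 2^-1 ^+ n) ->
  cvgn x /\ forall n, `|x n - limn x| <= 2 * C * 2^-1 ^+ n.
Proof.
move=> C0 H.
have p0 n : 0 <= C * 2^-1 ^+ n by rewrite mulr_ge0// exprn_ge0.
pose a n := x n - 2 * C * 2^-1 ^+ n; pose b n := x n + 2 * C * 2^-1 ^+ n.
have nda : nondecreasing_seq a.
  apply/nondecreasing_seqP => n; rewrite /a exprS.
  by have := H n; rewrite ler_norml => /andP[h _]; lra.
have nib : nonincreasing_seq b.
  apply/nonincreasing_seqP => n; rewrite /b exprS.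
  by have := H n; rewrite ler_norml => /andP[_ h]; lra.
have ab n : a n <= b n by rewrite /a /b; have := p0 n; lra.
have ca : cvgn a.
  apply: nondecreasing_is_cvgn => //; exists (b 0) => _ [n _ <-].
  by apply: le_trans (ab n) _; exact: nib.
have c0 : 2 * C * 2^-1 ^+ n @[n --> \oo] --> (0 : R).
  by apply: cvg_geometric; rewrite ger0_norm//; lra.
have xl : x @ \oo --> limn a.
  have -> : x = fun n => a n + 2 * C * 2^-1 ^+ n by apply/funext => n; rewrite /a subrK.
  by rewrite -[X in _ --> X]addr0; apply: cvgD.
have bl : b @ \oo --> limn a by rewrite -[X in _ --> X]addr0; apply: cvgD.
have lE : limn x = limn a by exact/cvg_lim.
split; first by apply/cvg_ex; exists (limn a).
move=> n; rewrite lE ler_norml.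
have h1 : a n <= limn a by exact: nondecreasing_cvgn_le.
have h2 : limn a <= b n.
  rewrite -(cvg_lim _ bl)//; apply: nonincreasing_cvgn_ge => //.
  by apply/cvg_ex; exists (limn a).
by rewrite /a /b in h1 h2; apply/andP; split; lra.
Qed.

(* G = \sum_n 4^n D_n, where D_n is the squared supremum of the n-th increment, is
   integrable; where G is finite the paths converge uniformly, at rate 2^-n.  On
   the null set G = +oo, which belongs to every F t, the limit is set to 0. *)
Lemma S2_complete (Z : nat -> R -> Omega -> R) (A : R) :
  (forall n, acprocess T F (Z n)) ->
  (forall n, normS2 P T (fun t w => Z n.+1 t w - Z n t w)%R <= (A * 8^-1 ^+ n)%:E)%E ->
  exists2 Zoo, acprocess T F Zoo &
    normS2 P T (fun t w => Z n t w - Zoo t w) @[n --> \oo] --> 0%E.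
Proof.
move=> aZ HZ.
have aD n : acprocess T F (fun t w => Z n.+1 t w - Z n t w) by exact: (acprocessB T_gt0 uF).
pose D n w := supsq T (fun t w => Z n.+1 t w - Z n t w) w.
have D0 n w : (0 <= D n w)%E by exact: (supsq_ge0 T_gt0).
have mD n : measurable_fun setT (D n) by exact: (measurable_supsq T_gt0 uF).
have A0 : 0 <= A.
  have := le_trans (normS2_ge0 P T_gt0 _) (HZ 0).
  by rewrite expr0 mulr1 lee_fin; exact.
pose f n w := ((4 ^+ n)%:E * D n w)%E.
have f0 n w : (0 <= f n w)%E by rewrite mule_ge0// lee_fin exprn_ge0.
have mf n : measurable_fun setT (f n) by exact: emeasurable_funM.
pose G w := (\sum_(n <oo) f n w)%E.
have G0 w : (0 <= G w)%E by exact: nneseries_ge0.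
have mG : measurable_fun setT G by apply: ge0_emeasurable_sum.
have fG n w : (f n w <= G w)%E.
  apply: (@le_trans _ _ (\sum_(0 <= k < n.+1) f k w)%E).
    by rewrite big_nat_recr//= leeDr// sume_ge0.
  exact: nneseries_lim_ge.
have IG : (\int[P]_w G w <= (2 * A)%:E)%E.
  rewrite integral_nneseries//; apply: lime_le; first by apply: is_cvg_nneseries => k _ _; exact: integral_ge0.
  apply: nearW => n.
  apply: (@le_trans _ _ (\sum_(0 <= k < n) (A * 2^-1 ^+ k)%:E)%E).
    apply: lee_sum => k _; rewrite ge0_integralZl//.
    apply: (@le_trans _ _ ((4 ^+ k)%:E * (A * 8^-1 ^+ k)%:E)%E).
      by rewrite lee_wpmul2l ?lee_fin ?exprn_ge0//; exact: HZ.
    rewrite -EFinM lee_fin mulrCA -exprMn.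
    by have -> : 4 * 8^-1 = 2^-1 :> R by field.
  rewrite sumEFin lee_fin -mulr_sumr mulrC ler_wpM2r//.
  have := @geometric_le_lim R n 1 2^-1.
  rewrite ler01 invr_gt0 ltr0n ger0_norm ?invr_ge0//.
  have -> : series (geometric 1 2^-1) n = \sum_(0 <= k < n) 2^-1 ^+ k :> R.
    by apply: eq_bigr => k _; rewrite /geometric/= mul1r.
  have -> : 1 / (1 - 2^-1) = 2 :> R by field.
  by apply => //; lra.
pose N := [set w | G w = +oo%E].
have IGoo : (\int[P]_w G w < +oo)%E by rewrite (le_lt_trans IG)// ltry.
have N0 : P.-negligible N.
  have iG : P.-integrable setT G.
    apply/integrableP; split => //.
    by under eq_integral do rewrite gee0_abs//.
  have := integrable_ae measurableT iG; apply: negligibleS => w /= -> /(_ Logic.I).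
  by [].
have Gfin w : ~ N w -> G w = (fine (G w))%:E.
  move=> Nw; rewrite fineK// ge0_fin_numE// lt_neqAle leey andbT.
  exact/eqP.
have g0 w : 0 <= fine (G w) by exact: fine_ge0.
have inc w n t : ~ N w -> t \in `[0, T] ->
    `|Z n.+1 t w - Z n t w| <= Num.sqrt (fine (G w)) * 2^-1 ^+ n.
  move=> Nw tT.
  have h : ((4 ^+ n)%:E * ((Z n.+1 t w - Z n t w) ^+ 2)%:E <= (fine (G w))%:E)%E.
    rewrite -Gfin//; apply: le_trans (fG n w).
    rewrite lee_wpmul2l// ?lee_fin ?exprn_ge0//.
    exact: (le_supsq (fun t w => Z n.+1 t w - Z n t w)).
  rewrite -EFinM lee_fin in h.
  rewrite exprVn ler_pdivlMr ?exprn_gt0// -(@ger0_norm _ (2 ^+ n)) ?exprn_ge0//.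
  rewrite -normrM -sqrtr_sqr ler_wsqrtr// exprMn -exprM mulnC exprM mulrC.
  by rewrite -[2 ^+ 2]/(2 * 2) -natrM.
pose Zoo t w := if w \in N then 0 else limn (fun n => Z n t w).
have near_lim w n t : ~ N w -> t \in `[0, T] ->
    `|Z n t w - Zoo t w| <= 2 * Num.sqrt (fine (G w)) * 2^-1 ^+ n.
  move=> Nw tT; rewrite /Zoo memNset//.
  have [_] := @geometric_increments_cvg (fun n => Z n t w) _ (sqrtr_ge0 _) (fun n => inc w n t Nw tT).
  exact.
have aZoo : adapted T F Zoo.
  move=> t tT; apply/(adapted_sub_measurableP uF _ tT).
  (* The indicator of the complement of N is measurable for [F t], which contains the null sets;
     multiplying by it makes the convergence hold everywhere. *)
  apply: (@measurable_fun_cvg _ (g_sigma_algebraType (F t)) R setT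
    (fun n w => Z n t w * \1_(~` N) w)).
    move=> n; apply: measurable_funM.
      by apply/(adapted_sub_measurableP uF _ tT); apply: (aZ n).1.
    apply: measurable_indic; apply: measurableC.
    rewrite /measurable/= sigma_algebra_id; last by case: uF => sF _ _ _; exact: sF.
    by case: uF => _ _ _; apply.
  move=> w _; rewrite /Zoo; case: ifPn => [/set_mem wN|/negP wN].
    rewrite (_ : (fun n => _) = fun=> 0); first exact: cvg_cst.
    by apply/funext => n; rewrite indicE memNset ?mulr0//; apply.
  have {}wN : ~ N w by move=> wN'; apply: wN; exact: mem_set.
  rewrite (_ : (fun n => _) = fun n => Z n t w); last first.
    by apply/funext => n; rewrite indicE mem_set ?mulr1.
  by have [] := @geometric_increments_cvg (fun n => Z n t w) _ (sqrtr_ge0 _) (fun n => inc w n t wN tT).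
have cZoo : continuous_paths T Zoo.
  move=> w; apply/within_clamp; first exact: ltW.
  have [wN|wN] := pselect (N w).
    by move=> t; rewrite /comp /Zoo mem_set//; exact: cvg_cst.
  move=> t; apply/cvgrPdist_lt => e e0.
  have c0 : 2 * Num.sqrt (fine (G w)) * 2^-1 ^+ n @[n --> \oo] --> (0 : R).
    by apply: cvg_geometric; rewrite ger0_norm//; lra.
  have e3 : 0 < e / 3 by lra.
  have /cvgrPdist_lt/(_ _ e3)[n _ /(_ n (leqnn n))] := c0.
  rewrite sub0r normrN => /(le_lt_trans (ler_norm _)) Hn.
  have cn := acprocess_continuous T_gt0 (w := w) (aZ n).
  have /cvgrPdist_lt/(_ _ e3) := cn t.
  apply: filterS => s hs /=.
  have T0 := ltW T_gt0.
  have h1 := near_lim w n (clamp T t) wN (clamp_itv t T0).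
  have h2 := near_lim w n (clamp T s) wN (clamp_itv s T0).
  have -> : Zoo (clamp T t) w - Zoo (clamp T s) w = (Z n (clamp T s) w - Zoo (clamp T s) w)
      - (Z n (clamp T t) w - Zoo (clamp T t) w) + (Z n (clamp T t) w - Z n (clamp T s) w) by ring.
  apply: (le_lt_trans (ler_normD _ _)); apply: (le_lt_trans (lerD (ler_normB _ _) (lexx _))).
  lra.
exists Zoo => //.
have aZD n : acprocess T F (fun t w => Z n t w - Zoo t w) by exact: (acprocessB T_gt0 uF).
(* The square of the pathwise rate 2 sqrt(G) 2^-n is 4 G 4^-n, and G has integral at most 2 A. *)
apply: (@cvge0_le _ (fun n => (8 * A * 4^-1 ^+ n)%:E)).
- by move=> n; exact: (normS2_ge0 P T_gt0).
- move=> n.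
  apply: (@le_trans _ _ (\int[P]_w ((4 * 4^-1 ^+ n)%:E * G w))%E).
    apply: ge0_le_integral => //.
    + by move=> w _; exact: (supsq_ge0 T_gt0).
    + exact: (measurable_supsq T_gt0 uF).
    + exact: emeasurable_funM.
    + move=> w _; have [wN|wN] := pselect (N w).
        have -> : G w = +oo%E by exact: wN.
        by rewrite gt0_muley ?leey// lte_fin mulr_gt0// exprn_gt0.
      apply: supsq_le => t tT; rewrite Gfin// -EFinM lee_fin.
      rewrite -real_normK ?num_real//.
      have -> : 4 * 4^-1 ^+ n * fine (G w) = (2 * Num.sqrt (fine (G w)) * 2^-1 ^+ n) ^+ 2.
        rewrite !exprMn sqr_sqrtr// -exprM mulnC exprM.
        have -> : 2^-1 ^+ 2 = 4^-1 :> R by field.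
        by ring.
      rewrite lerXn2r ?nnegrE// ?mulr_ge0 ?exprn_ge0//.
      exact: near_lim.
  rewrite ge0_integralZl//.
  apply: le_trans (lee_wpmul2l _ IG) _; first by rewrite lee_fin mulr_ge0// exprn_ge0.
  by rewrite -EFinM lee_fin le_eqVlt; apply/orP; left; apply/eqP; ring.
- apply: cvg_EFin; first exact: nearW.
  by apply: cvg_geometric; rewrite ger0_norm//; lra.
Qed.

End completeness.

(** * Ito integrals *)

Section more_limits.
Context {R : realType}.
Implicit Types u v : nat -> \bar R.

Lemma cvge0_lincomb u v (a b : R) : 0 <= a -> 0 <= b ->
  (forall n, 0 <= u n)%E -> (forall n, 0 <= v n)%E ->
  u n @[n --> \oo] --> 0%E -> v n @[n --> \oo] --> 0%E ->
  (a%:E * u n + b%:E * v n)%E @[n --> \oo] --> 0%E.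
Proof.
move=> a0 b0 u0 v0 /(cvge0P u0) cu /(cvge0P v0) cv.
apply/cvge0P => [n|e e0].
  by rewrite adde_ge0// mule_ge0// lee_fin.
pose k := e / (a + b + 1).
have s0 : 0 < a + b + 1 by rewrite ltr_wpDl// addr_ge0.
have k0 : 0 < k by rewrite divr_gt0.
have [N1 H1] := cu _ k0; have [N2 H2] := cv _ k0.
exists (maxn N1 N2) => n; rewrite geq_max => /andP[h1 h2].
apply: (@le_trans _ _ (a%:E * k%:E + b%:E * k%:E)%E).
  by apply: leeD; apply: lee_wpmul2l; rewrite ?lee_fin//; [exact: H1|exact: H2].
rewrite -!EFinM -EFinD lee_fin -mulrDl /k.
have -> : (a + b) * (e / (a + b + 1)) = e * ((a + b) / (a + b + 1)).
  by field; rewrite gt_eqF.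
apply: ler_piMr; first exact: ltW.
by rewrite ler_pdivrMr// mul1r lerDl.
Qed.

Lemma lee_add_cvge0 (x y : \bar R) u : (forall n, 0 <= u n)%E ->
  u n @[n --> \oo] --> 0%E -> (forall n, x <= u n + y)%E -> (x <= y)%E.
Proof.
move=> u0 /(cvge0P u0) cu H; apply/lee_addgt0Pr => e e0.
have [N /(_ N (leqnn _)) HN] := cu _ e0.
by apply: le_trans (H N) _; rewrite addeC leeD2l.
Qed.

(* Passes the bound j2 <= c s1 between squared distances of approximants to the
   limits; x and X are the squared distances of the limits, the r's those of the
   approximations. *)
Lemma lee_chain_cvge0 (x X : \bar R) (c : R) (j1 j2 s1 s2 r1 r2 r3 r4 : nat -> \bar R) :
  0 <= c -> (0 <= X)%E ->
  (forall n, 0 <= r1 n)%E -> (forall n, 0 <= r2 n)%E ->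
  (forall n, 0 <= r3 n)%E -> (forall n, 0 <= r4 n)%E ->
  r1 n @[n --> \oo] --> 0%E -> r2 n @[n --> \oo] --> 0%E ->
  r3 n @[n --> \oo] --> 0%E -> r4 n @[n --> \oo] --> 0%E ->
  (forall n, x <= 2%:E * r1 n + 2%:E * j1 n)%E ->
  (forall n, j1 n <= 2%:E * j2 n + 2%:E * r2 n)%E ->
  (forall n, j2 n <= c%:E * s1 n)%E ->
  (forall n, s1 n <= 2%:E * r3 n + 2%:E * s2 n)%E ->
  (forall n, s2 n <= 2%:E * X + 2%:E * r4 n)%E ->
  (x <= (16 * c)%:E * X)%E.
Proof.
move=> c0 X0 r10 r20 r30 r40 c1 c2 c3 c4 h1 h2 h3 h4 h5.
pose u12 n := (2%:E * r1 n + 4%:E * r2 n)%E.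
pose u34 n := ((8 * c)%:E * r3 n + (16 * c)%:E * r4 n)%E.
have c8 : 0 <= 8 * c by rewrite mulr_ge0.
have c16 : 0 <= 16 * c by rewrite mulr_ge0.
have u120 n : (0 <= u12 n)%E by rewrite /u12 adde_ge0// mule_ge0.
have u340 n : (0 <= u34 n)%E by rewrite /u34 adde_ge0// mule_ge0// lee_fin.
have cu12 : u12 n @[n --> \oo] --> 0%E by exact: cvge0_lincomb.
have cu34 : u34 n @[n --> \oo] --> 0%E by exact: cvge0_lincomb.
have u0 n : (0 <= 1%:E * u12 n + 1%:E * u34 n)%E by rewrite !mul1e adde_ge0.
apply: (lee_add_cvge0 u0); first by apply: cvge0_lincomb.
move=> n; rewrite !mul1e; apply: (le_trans (h1 n)).
have two0 : (0 <= 2%:E :> \bar R)%E by rewrite lee_fin.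
have cE0 : (0 <= c%:E)%E by rewrite lee_fin.
apply: (@le_trans _ _ (2%:E * r1 n + 2%:E * (2%:E * (c%:E *
    (2%:E * r3 n + 2%:E * (2%:E * X + 2%:E * r4 n))) + 2%:E * r2 n))%E).
  apply/leeD2l/lee_wpmul2l => //; apply: (le_trans (h2 n)).
  apply/leeD2r/lee_wpmul2l => //; apply: (le_trans (h3 n)).
  apply/lee_wpmul2l => //; apply: (le_trans (h4 n)).
  exact/leeD2l/lee_wpmul2l.
rewrite /u12 /u34 !ge0_muleDr ?mule_ge0 ?adde_ge0 ?mule_ge0 ?lee_fin//.
rewrite !muleA -!EFinM.
have -> : (2 * 2 = 4 :> R)%R by ring.
have -> : (4 * c * 2 * 2 = 16 * c)%R by ring.
have -> : (4 * c * 2 = 8 * c)%R by ring.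
move: (2%:E * r1 n)%E (4%:E * r2 n)%E ((8 * c)%:E * r3 n)%E ((16 * c)%:E * r4 n)%E
  ((16 * c)%:E * X)%E => a e b y z.
rewrite !addeA le_eqVlt; apply/orP; left; apply/eqP.
by rewrite (addeAC _ y e) (addeAC _ z e) (addeAC _ b e) (addeAC _ z y).
Qed.

End more_limits.

Section joint_square_integrals.
Context d (Omega : measurableType d) (R : realType) (P : probability Omega R).
Variable T : R.
Implicit Types V : R -> Omega -> R.

Definition jmeasurable V :=
  measurable_fun (`[0, T] `*` [set: Omega]) (fun p : R * Omega => V p.1 p.2).

Lemma measurable_strip (t : R) : measurable (`[0, t]%classic `*` [set: Omega] : set (R * Omega)).
Proof. exact: measurableX. Qed.

Lemma jmeasurable_section V w t : t <= T -> jmeasurable V ->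
  measurable_fun `[0, t] (fun s => V s w).
Proof.
move=> tT jV; apply: (@measurable_funS _ _ _ _ `[0, T]) => //.
  by move=> s /=; rewrite !in_itv/= => /andP[-> /le_trans->].
rewrite [X in measurable_fun X _](_ : _ = (fun s : R => (s, w)) @^-1` (`[0, T]%classic `*` [set: Omega])); last first.
  by apply/seteqP; split => s //= [].
move=> _ Y mY.
have := (pair2_measurable w) measurableT _ (jV (measurable_strip T) _ mY).
by rewrite setTI preimage_setI.
Qed.

Lemma jmeasurableB V V' : jmeasurable V -> jmeasurable V' ->
  jmeasurable (fun t w => V t w - V' t w).
Proof. by move=> jV jV'; exact: measurable_funB. Qed.

(** Tonelli, applied to f extended by 0 outside the strip [0, t] x Omega. *)
Lemma measurable_integral_time (f : R -> Omega -> \bar R) t : t <= T ->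
  measurable_fun (`[0, T] `*` [set: Omega]) (fun p : R * Omega => f p.1 p.2) ->
  (forall s w, 0 <= f s w)%E ->
  measurable_fun setT (fun w => \int[@lebesgue_measure R]_(s in `[0%R, t]) f s w)%E.
Proof.
move=> tT mf f0; pose TR := measurableTypeR R.
pose g (p : TR * Omega) := ((fun p : TR * Omega => f p.1 p.2) \_ (`[0, t]%classic `*` [set: Omega])) p.
have mg : measurable_fun setT g.
  apply/(measurable_restrictT _ _).1 => //; first exact: measurable_strip.
  have : measurable_fun (`[0, t] `*` [set: Omega]) (fun p : R * Omega => f p.1 p.2).
    apply: (measurable_funS (measurable_strip T) _ mf) => -[s w] /=.
    by rewrite !in_itv/= => -[/andP[-> /le_trans->]].
  by move=> h mD Y mY; exact: (h mD Y mY).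
have g0 p : (0 <= g p)%E by rewrite /g patchE; case: ifPn.
have := measurable_fun_fubini_tonelli_G (m1 := @lebesgue_measure R) g mg g0.
congr measurable_fun; apply/funext => w; rewrite /fubini_G.
rewrite [RHS]integral_mkcond; apply: eq_integral => s _.
rewrite /g !patchE; congr (if _ then _ else _).
by apply/idP/idP; rewrite !inE/= => // -[].
Qed.

Lemma measurable_sqint_time V t : t <= T -> jmeasurable V ->
  measurable_fun setT (fun w => sqint (@lebesgue_measure R) `[0, t] (V ^~ w)).
Proof.
move=> tT jV; apply: (@measurable_integral_time (fun s w => (V s w ^+ 2)%:E)) => //.
  exact: measurable_sqE.
by move=> s w; rewrite lee_fin sqr_ge0.
Qed.

Lemma sqint2_ge0 t V : (0 <= sqint2 P t V)%E.
Proof. by apply: integral_ge0 => w _; exact: sqint_ge0. Qed.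

Lemma sqint2B_tri t V1 V2 V3 : t <= T -> jmeasurable V1 -> jmeasurable V2 -> jmeasurable V3 ->
  (sqint2 P t (fun s w => V1 s w - V3 s w)%R <=
   2%:E * sqint2 P t (fun s w => V1 s w - V2 s w)%R +
   2%:E * sqint2 P t (fun s w => V2 s w - V3 s w)%R)%E.
Proof.
move=> tT j1 j2 j3.
have m12 := measurable_sqint_time tT (jmeasurableB j1 j2).
have m23 := measurable_sqint_time tT (jmeasurableB j2 j3).
have m13 := measurable_sqint_time tT (jmeasurableB j1 j3).
have s0 V w : (0 <= sqint (@lebesgue_measure R) `[0%R, t] (V ^~ w))%E by exact: sqint_ge0.
rewrite /sqint2 -!ge0_integralZl//; try by move=> w _; exact: sqint_ge0.
rewrite -ge0_integralD//; last 4 first.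
- by move=> w _; rewrite mule_ge0//; exact: sqint_ge0.
- exact: emeasurable_funM.
- by move=> w _; rewrite mule_ge0//; exact: sqint_ge0.
- exact: emeasurable_funM.
apply: ge0_le_integral => //; try by move=> w _; exact: sqint_ge0.
  by apply: emeasurable_funD; exact: emeasurable_funM.
by move=> w _; apply: sqintB_tri => //; exact: jmeasurable_section.
Qed.

Lemma sqint2_sym t V1 V2 : sqint2 P t (fun s w => V1 s w - V2 s w) =
  sqint2 P t (fun s w => V2 s w - V1 s w).
Proof.
by apply: eq_integral => w _; apply: sqint_eq => s _; rewrite -sqrrN opprB.
Qed.

Lemma sqint_sym (f g : Omega -> R) : sqint P setT (fun w => f w - g w) =
  sqint P setT (fun w => g w - f w).
Proof. by apply: sqint_eq => w _; rewrite -sqrrN opprB. Qed.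

Lemma normS2_sym Z1 Z2 : normS2 P T (fun t w => Z1 t w - Z2 t w) =
  normS2 P T (fun t w => Z2 t w - Z1 t w).
Proof.
apply: eq_integral => w _; congr ereal_sup.
by apply/seteqP; split => x [t tT <-]; exists t => //=; rewrite distrC.
Qed.

End joint_square_integrals.

Section ito_integral.
Context d (Omega : measurableType d) (R : realType) (P : probability Omega R).
Variables (T : R) (F : R -> set (set Omega)).
Hypothesis T_gt0 : 0 < T.
Hypothesis uF : usual_filtration P T F.
Variables (c : R) (W : R -> Omega -> R).
Hypothesis c_ge0 : 0 <= c.
Hypothesis dW : ito_driver P T F c W.

Lemma acprocess_jmeasurable Z : acprocess T F Z -> jmeasurable T Z.
Proof.
move=> aZ; apply: (@eq_measurable_fun _ _ _ _ _ (fun p => Z (clamp T p.1) p.2)).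
  by move=> [t w]; rewrite inE/= => -[tT _]; rewrite clamp_id.
by apply: measurable_funTS; exact: (acprocess_joint T_gt0 uF).
Qed.

Lemma sp_val_jmeasurable (S : simple_process T F) : jmeasurable T (sp_val S).
Proof.
apply: measurable_funTS; apply: measurable_sum => i; apply: measurable_funM.
  apply: (measurableT_comp _ measurable_snd).
  have iT := sp_time_itv (ltnW (ltn_ord i)).
  exact: (filtration_measurable uF iT (sp_coef_meas (ltn_ord i))).
exact: (measurableT_comp (measurable_indic _) measurable_fst).
Qed.

Lemma ito_integral_approx H I : is_ito_integral P T F W H I ->
  exists S : nat -> simple_process T F,
    sqint2 P T (fun s w => sp_val (S n) s w - H s w) @[n --> \oo] --> 0%E /\
    forall t, t \in `[0, T] ->
      sqint P setT (fun w => sp_integral (S n) W t w - I t w) @[n --> \oo] --> 0%E.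
Proof. by case=> _ _ _ [S [S1 S2]]; exists S. Qed.

Lemma ito_integral_acprocess H I : is_ito_integral P T F W H I -> acprocess T F I.
Proof. by case. Qed.

Lemma ito_integral_martingale2 H I : is_ito_integral P T F W H I ->
  martingale2 P T F I.
Proof.
move=> hI; have [S [_ SI]] := ito_integral_approx hI.
apply: (@martingale2_lim _ _ _ P T F uF I (fun n => sp_integral (S n) W)) => //.
- exact: (ito_integral_acprocess hI).1.
- by move=> n; exact: (sp_integral_acprocess T_gt0 uF dW (S n)).1.
- by move=> n; exact: (sp_integral_martingale2 T_gt0 uF dW).
Qed.

Lemma sqint2_le t V : t \in `[0, T] -> jmeasurable T V ->
  (sqint2 P t V <= sqint2 P T V)%E.
Proof.
rewrite in_itv/= => /andP[t0 tT] jV.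
apply: ge0_le_integral => //.
- by move=> w _; exact: sqint_ge0.
- exact: (measurable_sqint_time tT jV).
- exact: (measurable_sqint_time (lexx T) jV).
move=> w _; apply: ge0_subset_integral => //.
- by apply: measurable_sqE; exact: (jmeasurable_section w (lexx T) jV).
- by move=> s _; rewrite lee_fin sqr_ge0.
- by move=> s /=; rewrite !in_itv/= => /andP[-> /le_trans->].
Qed.

(** The inequality for simple processes passes to the limit through four triangle inequalities,
    whence 16 = 2^4. With H = H' it shows that the integral at time t does not depend, almost
    surely, on the approximating sequence. *)
Lemma ito_integralB_sqint H H' I I' t : t \in `[0, T] ->
  is_ito_integral P T F W H I -> is_ito_integral P T F W H' I' ->
  (sqint P setT (fun w => I t w - I' t w)%R <=
   (16 * c)%:E * sqint2 P t (fun s w => H s w - H' s w)%R)%E.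
Proof.
move=> tT hI hI'; have t_le : t <= T by move: tT; rewrite in_itv/= => /andP[].
have [S [SH SI]] := ito_integral_approx hI.
have [S' [SH' SI']] := ito_integral_approx hI'.
have jH : jmeasurable T H by case: hI => -[].
have jH' : jmeasurable T H' by case: hI' => -[].
pose J n := sp_integral (S n) W t; pose J' n := sp_integral (S' n) W t.
have mI : measurable_fun setT (I t) := acprocess_measurable uF (ito_integral_acprocess hI) tT.
have mI' : measurable_fun setT (I' t) := acprocess_measurable uF (ito_integral_acprocess hI') tT.
have mJ n : measurable_fun setT (J n).
  exact: (acprocess_measurable uF (sp_integral_acprocess T_gt0 uF dW (S n)) tT).
have mJ' n : measurable_fun setT (J' n).
  exact: (acprocess_measurable uF (sp_integral_acprocess T_gt0 uF dW (S' n)) tT).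
pose r1 n := sqint P setT (fun w => J n w - I t w).
pose r2 n := sqint P setT (fun w => J' n w - I' t w).
pose r3 n := sqint2 P T (fun s w => sp_val (S n) s w - H s w).
pose r4 n := sqint2 P T (fun s w => sp_val (S' n) s w - H' s w).
pose X := sqint2 P t (fun s w => H s w - H' s w).
have jS m := sp_val_jmeasurable (S m); have jS' m := sp_val_jmeasurable (S' m).
apply: (@lee_chain_cvge0 _ _ X c (fun n => sqint P setT (fun w => J n w - I' t w))
  (fun n => sqint P setT (fun w => J n w - J' n w))
  (fun n => sqint2 P t (fun s w => sp_val (S n) s w - sp_val (S' n) s w))
  (fun n => sqint2 P t (fun s w => H s w - sp_val (S' n) s w)) r1 r2 r3 r4).
- exact: c_ge0.
- exact: sqint2_ge0.
- by move=> n; exact: sqint_ge0.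
- by move=> n; exact: sqint_ge0.
- by move=> n; exact: sqint2_ge0.
- by move=> n; exact: sqint2_ge0.
- exact: SI.
- exact: SI'.
- exact: SH.
- exact: SH'.
- move=> n; rewrite /r1 [X in (_ <= _ * X + _)%E]sqint_sym.
  exact: (sqintB_tri P measurableT mI (mJ n) mI').
- by move=> n; exact: (sqintB_tri P measurableT (mJ n) (mJ' n) mI').
- by move=> n; exact: (sp_integralB_sqint T_gt0 uF dW).
- move=> n; apply: (le_trans (sqint2B_tri P t_le (jS n) jH (jS' n))).
  apply: leeD2r; apply: lee_wpmul2l; first by rewrite lee_fin.
  by apply: sqint2_le => //; exact: jmeasurableB.
- move=> n; apply: (le_trans (sqint2B_tri P t_le jH jH' (jS' n))).
  apply: leeD2l; apply: lee_wpmul2l; first by rewrite lee_fin.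
  by rewrite sqint2_sym; apply: sqint2_le => //; exact: jmeasurableB.
Qed.

End ito_integral.

(** * Existence of the Ito integral of a bounded adapted continuous process *)

Section ito_existence.
Context d (Omega : measurableType d) (R : realType) (P : probability Omega R).
Variables (T : R) (F : R -> set (set Omega)).
Hypothesis T_gt0 : 0 < T.
Hypothesis uF : usual_filtration P T F.
Variables (c : R) (W : R -> Omega -> R).
Hypothesis c_ge0 : 0 <= c.
Hypothesis dW : ito_driver P T F c W.

Let T_itv : T \in `[0, T]. Proof. by rewrite in_itv/= lexx ltW. Qed.

(** Doob's factor 4 times the constant 16 c at the final time; the difference of two Ito integrals
    is a martingale. *)
Lemma ito_integralB_normS2 H H' I I' :
  is_ito_integral P T F W H I -> is_ito_integral P T F W H' I' ->
  (normS2 P T (fun t w => I t w - I' t w)%R <=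
   (64 * c)%:E * sqint2 P T (fun s w => H s w - H' s w)%R)%E.
Proof.
move=> hI hI'.
have aI := ito_integral_acprocess hI; have aI' := ito_integral_acprocess hI'.
have mI := ito_integral_martingale2 T_gt0 uF dW hI.
have mI' := ito_integral_martingale2 T_gt0 uF dW hI'.
have mII := martingale2B uF aI.1 aI'.1 mI mI'.
apply: (le_trans (normS2_martingale T_gt0 uF (acprocessB T_gt0 uF aI aI') mII)).
have -> : (64 * c = 4 * (16 * c))%R by ring.
rewrite (EFinM 4) -muleA lee_wpmul2l//.
exact: (ito_integralB_sqint T_gt0 uF c_ge0 dW T_itv hI hI').
Qed.

Section left_approximation.
Variables (H : R -> Omega -> R) (M : R).
Hypothesis aH : acprocess T F H.
Hypothesis bH : forall t w, t \in `[0, T] -> `|H t w| <= M.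

Let tm (N i : nat) : R := i%:R * T / N.+1%:R.

Let tm_itv N i : (i <= N.+1)%N -> tm N i \in `[0, T].
Proof.
move=> iN; rewrite in_itv/= /tm; apply/andP; split.
  by rewrite divr_ge0// mulr_ge0// ltW.
rewrite ler_pdivrMr// mulrC; by rewrite ler_pM2l// ler_nat.
Qed.

Let tm0 N : tm N 0 = 0. Proof. by rewrite /tm !mul0r. Qed.

Let tmT N : tm N N.+1 = T.
Proof. by rewrite /tm mulrAC divff ?mul1r// gt_eqF. Qed.

Let tmS N i : tm N i.+1 = tm N i + T / N.+1%:R.
Proof. by rewrite /tm -natr1 !mulrDl mul1r. Qed.

Let tm_le N i j : (i <= j)%N -> tm N i <= tm N j.
Proof.
move=> ij; rewrite /tm ler_pM2r ?invr_gt0// ler_pM2r//.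
by rewrite ler_nat.
Qed.

Let left_coef_bnd N : exists B : R, forall i w, (i < N.+1)%N -> `|H (tm N i) w| <= B.
Proof. by exists M => i w iN; apply: bH; apply: tm_itv; exact: ltnW. Qed.

(** On each of N + 1 equal intervals H is frozen at the left endpoint, where its value is already
    known; continuity of the paths makes this converge. *)
Definition left_approx N : simple_process T F :=
  @SimpleProcess _ _ _ T F N.+1 (tm N) (fun i => H (tm N i))
    (tm0 N) (tmT N) (fun i _ => tm_le N (leqnSn i))
    (fun i iN => aH.1 _ (tm_itv (ltnW iN))) (left_coef_bnd N).

Lemma left_approxE N t w : 0 < t <= T ->
  exists2 s, s \in `[0, T] & `|t - s| <= T / N.+1%:R /\ sp_val (left_approx N) t w = H s w.
Proof.
move=> /andP[t0 tT].
(* The largest such i is the interval containing t. The inequality is strict because the intervals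
   are open on the left, which is why t = 0 is excluded. *)
pose Q i := (i <= N)%N && (tm N i < t).
have Q0 : exists i, Q i by exists 0; rewrite /Q tm0.
have Qb i : Q i -> (i <= N)%N by case/andP.
case: (ex_maxnP Q0 Qb) => i /andP[iN it] imax.
have ti : t <= tm N i.+1.
  move: iN; rewrite leq_eqVlt => /predU1P[->|iN]; first by rewrite tmT.
  rewrite leNgt; apply/negP => h; have := imax i.+1; rewrite /Q iN h => /(_ isT).
  by rewrite ltnn.
exists (tm N i); first by apply: tm_itv; exact: leqW.
split; first by rewrite ger0_norm ?subr_ge0 ?(ltW it)// lerBlDl -tmS.
rewrite /sp_val/= (bigD1 (Ordinal (iN : (i < N.+1)%N)))//= big1 ?addr0 => [|j ji].
  by rewrite indicE mem_set ?mulr1//= in_itv/= it ti.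
rewrite indicE memNset ?mulr0//= in_itv/= => /andP[jt tj].
have {}ji : (j : nat) != i by apply: contra ji => /eqP e; apply/eqP/val_inj.
move: ji; rewrite neq_ltn => /orP[ji|ij].
  by have := tm_le N ji; rewrite leNgt (lt_le_trans it tj).
by have := tm_le N ij; rewrite leNgt (lt_le_trans jt ti).
Qed.

Lemma left_approx_cvg t w : 0 < t <= T ->
  sp_val (left_approx N) t w @[N --> \oo] --> H t w.
Proof.
move=> t0T; have tT : t \in `[0, T] by rewrite in_itv/=; case/andP: t0T => /ltW -> ->.
apply/cvgrPdist_lt => e e0.
have cH := acprocess_continuous T_gt0 (w := w) aH.
have /cvgrPdist_lt/(_ _ e0)/nbhs_ballP[dl /= dl0 Hdl] := cH t.
have k0 : 0 < dl / T by rewrite divr_gt0.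
have [N _ HN] := near_infty_natSinv_lt (PosNum k0).
exists N => // n /HN /= Hn.
have [s sT [ts ->]] := left_approxE n w t0T.
have := Hdl s; rewrite !clamp_id//; apply; apply: (le_lt_trans ts).
by rewrite mulrC -ltr_pdivlMr.
Qed.

Let left_approx_bound N t w : t \in `[0, T] -> `|sp_val (left_approx N) t w - H t w| <= 2 * M.
Proof.
move=> tT; have M0 := le_trans (normr_ge0 _) (bH w tT).
have Ht := bH w tT; apply: (le_trans (ler_normB _ _)).
suff : `|sp_val (left_approx N) t w| <= M by lra.
have := tT; rewrite in_itv/= => /andP[]; rewrite le_eqVlt => /predU1P[<-|t0] tT'.
  rewrite /sp_val big1 ?normr0// => i _; rewrite indicE memNset ?mulr0//=.
  rewrite in_itv/= => /andP[+ _]; rewrite ltNge.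
  have iN : (i <= N.+1)%N by exact: ltnW.
  by have := tm_itv iN; rewrite in_itv/= => /andP[->].
have t0T : 0 < t <= T by rewrite t0.
by have [s sT [_ ->]] := left_approxE N w t0T; exact: bH.
Qed.

(** Dominated convergence twice: in time for each fixed w, with bound (2 M)^2, then in w, with bound
    (2 M)^2 T. *)
Lemma left_approx_sqint2 :
  sqint2 P T (fun t w => sp_val (left_approx N) t w - H t w) @[N --> \oo] --> 0%E.
Proof.
have jD N : jmeasurable T (fun t w => sp_val (left_approx N) t w - H t w).
  apply: jmeasurableB; first exact: (sp_val_jmeasurable uF).
  exact: (acprocess_jmeasurable T_gt0 uF).
pose f N w := sqint (@lebesgue_measure R) `[0, T] (fun t => sp_val (left_approx N) t w - H t w).
have mf N : measurable_fun setT (f N) := measurable_sqint_time (lexx T) (jD N).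
have muT : (@lebesgue_measure R) `[0, T]%classic = T%:E.
  by rewrite lebesgue_measure_itv/= lte_fin T_gt0 oppr0 adde0.
have muToo : ((@lebesgue_measure R) `[0%R, T]%classic < +oo)%E by rewrite muT ltry.
have sqb N t w : t \in `[0, T] -> (sp_val (left_approx N) t w - H t w) ^+ 2 <= (2 * M) ^+ 2.
  move=> tT; rewrite -real_normK ?num_real// lerXn2r ?nnegrE//; last exact: left_approx_bound.
  by apply: le_trans (left_approx_bound N w tT).
have fc w : f N w @[N --> \oo] --> 0%E.
  have [||||||_ _] := @dominated_convergence _ _ _ (@lebesgue_measure R) `[0, T] _
    (fun N t => ((sp_val (left_approx N) t w - H t w) ^+ 2)%:E) (cst 0%E)
    (cst ((2 * M) ^+ 2)%:E).
  - exact: measurable_itv.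
  - by move=> N; apply: measurable_sqE; exact: (jmeasurable_section w (lexx T) (jD N)).
  - exact: measurable_cst.
  (* Simple processes vanish at time 0, so convergence may fail there, but only there. *)
  - exists [set 0]; split.
    + exact: measurable_set1.
    + exact: lebesgue_measure_set1.
    + move=> t /= /not_implyP[tT H0]; apply: contrapT => t0; apply: H0.
      have t0T : 0 < t <= T.
        move: tT; rewrite /= in_itv/= lt_neqAle => /andP[-> ->]; rewrite !andbT.
        by apply/eqP => e; apply: t0.
      apply: cvg_EFin; first exact: nearW.
      have h : sp_val (left_approx N) t w - H t w @[N --> \oo] --> (0 : R).
        rewrite -[X in _ --> X](subrr (H t w)).
        by apply: cvgB; [exact: left_approx_cvg|exact: cvg_cst].
      have h2 : (sp_val (left_approx N) t w - H t w) ^+ 2 @[N --> \oo] --> (0 : R).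
        have := cvgM h h; rewrite mulr0.
        by move=> hh; exact: hh.
      exact: h2.
  - apply/integrableP; split; first exact: measurable_cst.
    by rewrite integral_cst//= muT -EFinM ltry.
  - apply: aeW => t N tT; rewrite gee0_abs ?lee_fin ?sqr_ge0//.
    exact: sqb.
  by rewrite integral0.
have [||||||_ _] := @dominated_convergence _ _ _ P setT _ f (cst 0%E)
    (cst ((2 * M) ^+ 2 * T)%:E).
- exact: measurableT.
- exact: mf.
- exact: measurable_cst.
- by apply: aeW => w _; exact: fc.
- apply/integrableP; split; first exact: measurable_cst.
  rewrite integral_cst//= [X in (_ * X)%E](_ : _ = 1%E) ?mule1 ?ltry//.
  exact: probability_setT.
- apply: aeW => w N _; rewrite gee0_abs ?sqint_ge0//.
  apply: (@le_trans _ _ (\int[@lebesgue_measure R]_(t in `[0%R, T]) ((2 * M) ^+ 2)%:E)%E).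
    apply: ge0_le_integral => //.
    + by move=> t _; rewrite lee_fin sqr_ge0.
    + by apply: measurable_sqE; exact: (jmeasurable_section w (lexx T) (jD N)).
    + by move=> t tT; rewrite lee_fin; exact: sqb.
  by rewrite integral_cst//= muT -EFinM.
by rewrite integral0.
Qed.

Lemma bounded_sqint2_lty : (sqint2 P T H < +oo)%E.
Proof.
apply: (@le_lt_trans _ _ (\int[P]_w (M ^+ 2 * T)%:E)%E); last first.
  rewrite integral_cst//= [X in (_ * X)%E](_ : _ = 1%E) ?mule1 ?ltry//.
  exact: probability_setT.
have jH := acprocess_jmeasurable T_gt0 uF aH.
apply: ge0_le_integral => //.
- by move=> w _; exact: sqint_ge0.
- exact: (measurable_sqint_time (lexx T) jH).
move=> w _.
apply: (@le_trans _ _ (\int[@lebesgue_measure R]_(t in `[0%R, T]) (M ^+ 2)%:E)%E).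
  apply: ge0_le_integral => //.
  + by move=> t _; rewrite lee_fin sqr_ge0.
  + by apply: measurable_sqE; exact: (jmeasurable_section w (lexx T) jH).
  + move=> t tT; rewrite lee_fin -real_normK ?num_real//.
    have h := bH w tT; rewrite lerXn2r ?nnegrE//.
    exact: le_trans h.
rewrite integral_cst//=.
have -> : (@lebesgue_measure R) `[0, T]%classic = T%:E.
  by rewrite lebesgue_measure_itv/= lte_fin T_gt0 oppr0 adde0.
by rewrite -EFinM.
Qed.

(** Choose simple processes with squared error at most 8^-n. The isometry and Doob's inequality
    bound the S^2 increments of their integrals by 16 c 8^-n, so [S2_complete] supplies a continuous
    adapted limit. *)
Lemma ito_integral_exists :
  exists2 I, is_ito_integral P T F W H I & (normS2 P T I < +oo)%E.
Proof.
have jH := acprocess_jmeasurable T_gt0 uF aH.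
have jS (S : simple_process T F) : jmeasurable T (sp_val S) := sp_val_jmeasurable uF S.
have [S HS] : exists S : nat -> simple_process T F, forall n,
    (sqint2 P T (fun t w => sp_val (S n) t w - H t w)%R <= (8^-1 ^+ n)%:E)%E.
  have small n : exists S : simple_process T F,
      (sqint2 P T (fun t w => sp_val S t w - H t w)%R <= (8^-1 ^+ n)%:E)%E.
    have /cvge0P := left_approx_sqint2.
    move=> /(_ (fun N => sqint2_ge0 _ _ _)) /(_ (8^-1 ^+ n)).
    rewrite exprn_gt0 ?invr_gt0// => /(_ isT)[N /(_ N (leqnn N)) HN].
    by exists (left_approx N).
  by have [S HS] := choice small; exists S.
pose J n := sp_integral (S n) W.
have aJ n : acprocess T F (J n) := sp_integral_acprocess T_gt0 uF dW (S n).
have mJ n : martingale2 P T F (J n) := sp_integral_martingale2 T_gt0 uF dW (S n).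
have HJ n : (normS2 P T (fun t w => J n.+1 t w - J n t w)%R <= (16 * c * 8^-1 ^+ n)%:E)%E.
  have mD := martingale2B uF (aJ n.+1).1 (aJ n).1 (mJ n.+1) (mJ n).
  apply: (le_trans (normS2_martingale T_gt0 uF (acprocessB T_gt0 uF (aJ n.+1) (aJ n)) mD)).
  have h1 := sp_integralB_sqint T_gt0 uF dW (S n.+1) (S n) T_itv.
  have h2 := sqint2B_tri P (lexx T) (jS (S n.+1)) jH (jS (S n)).
  rewrite [X in (_ <= _ + _ * X)%E]sqint2_sym in h2.
  have h3 : (sqint2 P T (fun t w => sp_val (S n.+1) t w - sp_val (S n) t w)%R <=
      (4 * 8^-1 ^+ n)%:E)%E.
    apply: (le_trans h2).
    apply: (@le_trans _ _ (2%:E * (8^-1 ^+ n.+1)%:E + 2%:E * (8^-1 ^+ n)%:E)%E).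
      by apply: leeD; apply: lee_wpmul2l => //; exact: HS.
    rewrite -!EFinM -EFinD lee_fin exprS.
    have : 0 <= 8^-1 ^+ n :> R by rewrite exprn_ge0.
    lra.
  apply: (@le_trans _ _ (4%:E * (c%:E * (4 * 8^-1 ^+ n)%:E))%E).
    apply: lee_wpmul2l => //; apply: (le_trans h1).
    by apply: lee_wpmul2l => //; rewrite lee_fin.
  by rewrite -!EFinM lee_fin le_eqVlt; apply/orP; left; apply/eqP; ring.
have [I aI JI] := S2_complete T_gt0 uF aJ HJ.
have aJI n : acprocess T F (fun t w => J n t w - I t w) := acprocessB T_gt0 uF (aJ n) aI.
exists I.
  split => //; [split => //|exact: aI.1|exact: aI.2|].
  - exact: aH.1.
  - exact: bounded_sqint2_lty.
  - exists S; split.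
      apply: (@cvge0_le _ (fun n => (8^-1 ^+ n)%:E)).
      - by move=> n; exact: sqint2_ge0.
      - exact: HS.
      apply: cvg_EFin; first exact: nearW.
      rewrite (_ : fine \o _ = geometric 1 8^-1); last first.
        by apply/funext => n; rewrite /geometric/= mul1r.
      by apply: cvg_geometric; rewrite ger0_norm//; lra.
    move=> t tT; apply: cvge0_le JI => n; first exact: sqint_ge0.
    exact: (sqint_le_normS2 T_gt0 uF (aJI n) tT).
have /cvge0P := JI => /(_ (fun n => normS2_ge0 P T_gt0 _)) /(_ 1 ltr01)[N /(_ N (leqnn N)) HN].
have NJ : (normS2 P T (J N) < +oo)%E.
  apply: (le_lt_trans (normS2_martingale T_gt0 uF (aJ N) (mJ N))).
  by rewrite lte_mul_pinfty//; exact: (mJ N).1.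
have -> : I = fun t w => J N t w + (I t w - J N t w).
  by apply/funext => t; apply/funext => w; ring.
apply: (le_lt_trans (normS2D T_gt0 uF (aJ N) (acprocessB T_gt0 uF aI (aJ N)))).
rewrite normS2_sym lte_add_pinfty// lte_mul_pinfty//; try exact: (normS2_ge0 P T_gt0).
by rewrite (le_lt_trans HN)// ltry.
Qed.

End left_approximation.
End ito_existence.

(** * Regularity of the coefficients *)

Section lipschitz_algebra.
Context {R : realType}.
Implicit Types a b e x y : R.

Lemma bounded_lipschitz_pos (f : R -> R) : bounded_lipschitz f ->
  exists A L : R, [/\ 0 <= A, 0 <= L, (forall x, `|f x| <= A) &
    forall x y, `|f x - f y| <= L * `|x - y|].
Proof.
move=> [A [L [fA fL]]]; exists A, `|L|; split => //.
  exact: le_trans (fA 0).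
by move=> x y; apply: le_trans (fL x y) _; rewrite ler_wpM2r// ler_norm.
Qed.

Lemma lipschitz_continuous (f : R -> R) (L : R) :
  (forall x y, `|f x - f y| <= L * `|x - y|) -> continuous f.
Proof.
move=> fL x; apply/cvgrPdist_lt => e e0.
have L0 : 0 < `|L| + 1 by rewrite ltr_wpDl.
have k0 : 0 < e / (`|L| + 1) by exact: divr_gt0.
apply/nbhs_ballP; exists (e / (`|L| + 1)) => // y xy.
apply: (le_lt_trans (fL x y)).
apply: (@le_lt_trans _ _ ((`|L| + 1) * `|x - y|)).
  by rewrite ler_wpM2r// (le_trans (ler_norm L))// lerDl.
rewrite mulrC -ltr_pdivlMr//; exact: xy.
Qed.

(** All variations are measured against one distance e, so the estimate can be iterated over the
    four factors of the volatility. *)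
Lemma normr_mulB_le a a' b b' (A B La Lb e : R) : `|a| <= A -> `|b'| <= B ->
  `|a - a'| <= La * e -> `|b - b'| <= Lb * e -> 0 <= La * e -> 0 <= Lb * e ->
  `|a * b - a' * b'| <= (A * Lb + B * La) * e.
Proof.
move=> aA bB ha hb La0 Lb0.
have -> : a * b - a' * b' = a * (b - b') + b' * (a - a') by ring.
apply: (le_trans (ler_normD _ _)); rewrite !normrM mulrDl -!mulrA.
by apply: lerD; apply: ler_pM.
Qed.

(** In x - y = (sqrt x - sqrt y) (sqrt x + sqrt y) the second factor is at least sqrt dl. It will be
    applied with dl = [delta]. *)
Lemma sqrt_lipschitz (dl x y : R) : 0 < dl -> dl <= x -> dl <= y ->
  `|Num.sqrt x - Num.sqrt y| <= (Num.sqrt dl)^-1 * `|x - y|.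
Proof.
move=> d0 dx dy.
have x0 : 0 <= x by apply: le_trans dx; exact: ltW.
have y0 : 0 <= y by apply: le_trans dy; exact: ltW.
have s0 : 0 < Num.sqrt dl by rewrite sqrtr_gt0.
have sx : Num.sqrt dl <= Num.sqrt x by rewrite ler_wsqrtr.
have sy := sqrtr_ge0 y.
have -> : x - y = (Num.sqrt x - Num.sqrt y) * (Num.sqrt x + Num.sqrt y).
  by rewrite -subr_sqr !sqr_sqrtr.
rewrite normrM (ger0_norm (_ : 0 <= Num.sqrt x + Num.sqrt y)) ?addr_ge0 ?sqrtr_ge0//.
rewrite mulrC -mulrA ler_peMr// ler_pdivlMr// mul1r.
by apply: (le_trans sx); rewrite lerDl.
Qed.

Lemma inv_sqrt_lipschitz (dl x y : R) : 0 < dl -> dl <= x -> dl <= y ->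
  `|(Num.sqrt x)^-1 - (Num.sqrt y)^-1| <= (dl * Num.sqrt dl)^-1 * `|x - y|.
Proof.
move=> d0 dx dy.
have s0 : 0 < Num.sqrt dl by rewrite sqrtr_gt0.
have sx : Num.sqrt dl <= Num.sqrt x by rewrite ler_wsqrtr.
have sy : Num.sqrt dl <= Num.sqrt y by rewrite ler_wsqrtr.
have x0 : 0 < Num.sqrt x by exact: lt_le_trans sx.
have y0 : 0 < Num.sqrt y by exact: lt_le_trans sy.
have -> : (Num.sqrt x)^-1 - (Num.sqrt y)^-1 =
    (Num.sqrt y - Num.sqrt x) * (Num.sqrt x * Num.sqrt y)^-1.
  by field; rewrite !gt_eqF.
have p0 : 0 < Num.sqrt x * Num.sqrt y by rewrite mulr_gt0.
rewrite normrM (ger0_norm (_ : 0 <= (Num.sqrt x * Num.sqrt y)^-1)); last first.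
  by rewrite invr_ge0 ltW.
rewrite mulrC (invfM dl) -mulrA distrC; apply: ler_pM => //.
- rewrite lef_pV2 ?posrE// -[X in X <= _](sqr_sqrtr (ltW d0)) expr2.
  by apply: ler_pM => //; exact: ltW.
- exact: sqrt_lipschitz.
Qed.

End lipschitz_algebra.

Section coefficient_bounds.
Context d (Omega : measurableType d) (R : realType) (P : probability Omega R).
Variables (T : R) (g : R -> R) (sigma : R -> R -> R) (K : R -> R) (eps delta : R).
Hypothesis K_ge0 : forall u, 0 <= K u.
Hypothesis eps_gt0 : 0 < eps.
Hypothesis delta_gt0 : 0 < delta.
Hypothesis A1 : bounded_lipschitz g.
Hypothesis A2 : local_vol_regular T sigma.
Hypothesis A3 : bounded_lipschitz K.
Implicit Types X Y : {RV P >-> R}.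

Let bnd_int (f : Omega -> R) (M : R) : measurable_fun setT f -> (forall w, `|f w| <= M) ->
  P.-integrable setT (EFin \o f).
Proof.
move=> mf fM; apply: measurable_bounded_integrable => //.
  by rewrite [X in (X < _)%E](_ : _ = 1%E) ?ltry//; exact: probability_setT.
by exists M; split; [exact: num_real|move=> x Mx w _; exact: le_trans (fM w) (ltW Mx)].
Qed.

Let mlip (f : R -> R) : bounded_lipschitz f -> measurable_fun setT f.
Proof.
move=> /bounded_lipschitz_pos[A [L [_ _ _ fL]]].
by apply: continuous_measurable_fun; exact: lipschitz_continuous fL.
Qed.

Let mKx X (x : R) : measurable_fun setT (fun w => K ((X w - x) / eps)).
Proof.
apply: (measurableT_comp (mlip A3)).
by apply: measurable_funM => //; exact: measurable_funB.
Qed.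

(** Moves integrals against a law to Omega, where two pairs of variables are defined together and
    couple their laws. *)
Lemma Rintegral_joint_law X Y (f : R * R -> R) (M : R) : measurable_fun setT f ->
  (forall u, `|f u| <= M) ->
  \int[joint_law X Y]_u f u = \int[P]_w f (X w, Y w).
Proof.
move=> mf fM; rewrite /Rintegral integral_distribution//.
  exact/measurable_EFinP.
apply: (@bnd_int (f \o rpair X Y) M) => //.
  by apply: (measurableT_comp mf); exact: measurable_fun_pair.
by move=> w; exact: fM.
Qed.

Lemma L1_le_L2 (f : Omega -> R) (q : R) : 0 <= q -> measurable_fun setT f ->
  (sqint P setT f <= q%:E)%E ->
  P.-integrable setT (EFin \o f) /\ \int[P]_w `|f w| <= Num.sqrt q.
Proof.
move=> q0 mf fq.
have fi : P.-integrable setT (EFin \o f).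
  apply: sqint_lt0_integrable => //.
    by rewrite [X in (X < _)%E](_ : _ = 1%E) ?ltry//; exact: probability_setT.
  by rewrite (le_lt_trans fq)// ltry.
split => //.
have fin : (\int[P]_w `|f w|%:E)%E \is a fin_num.
  by apply: integrable_fin_num => //; exact: integrable_norm.
have := @sqr_integral_le _ _ _ P setT f 1 measurableT ltr01.
rewrite [X in (X <= _)%E](_ : _ = 1%E); last exact: probability_setT.
move=> /(_ (lexx _) mf); rewrite mul1e => /le_trans/(_ fq).
rewrite -(fineK fin) -EFin_expe lee_fin => h.
have r0 : 0 <= \int[P]_w `|f w| by exact: Rintegral_ge0.
by rewrite -(ger0_norm r0) -sqrtr_sqr ler_wsqrtr.
Qed.

(** Compares two expectations through the coupling: a accounts for a change of parameters, b and b'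
    for a change of law, whose L^1 size is at most sqrt q. *)
Lemma RintegralB_le X Y X' Y' (f f' : Omega -> R) (M a b b' q : R) : 0 <= q ->
  measurable_fun setT f -> measurable_fun setT f' ->
  (forall w, `|f w| <= M) -> (forall w, `|f' w| <= M) -> 0 <= b -> 0 <= b' ->
  (forall w, `|f w - f' w| <= a + b * `|X w - X' w| + b' * `|Y w - Y' w|) ->
  (sqint P setT (fun w => X w - X' w)%R + sqint P setT (fun w => Y w - Y' w)%R <= q%:E)%E ->
  `|\int[P]_w f w - \int[P]_w f' w| <= a + b * Num.sqrt q + b' * Num.sqrt q.
Proof.
move=> q0 mf mf' fM fM' b0 b'0 ff' hq.
have mX : measurable_fun setT (fun w => X w - X' w) by exact: measurable_funB.
have mY : measurable_fun setT (fun w => Y w - Y' w) by exact: measurable_funB.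
have [iX hX] : P.-integrable setT (EFin \o (fun w => X w - X' w)) /\
    \int[P]_w `|X w - X' w| <= Num.sqrt q.
  apply: L1_le_L2 => //; apply: le_trans hq; rewrite leeDl//; exact: sqint_ge0.
have [iY hY] : P.-integrable setT (EFin \o (fun w => Y w - Y' w)) /\
    \int[P]_w `|Y w - Y' w| <= Num.sqrt q.
  apply: L1_le_L2 => //; apply: le_trans hq; rewrite leeDr//; exact: sqint_ge0.
have iX' := integrable_norm iX; have iY' := integrable_norm iY.
have if_ := bnd_int mf fM; have if' := bnd_int mf' fM'.
rewrite -RintegralB//; apply: (le_trans (le_normr_Rintegral _ _)) => //.
  exact: (integrableB measurableT if_ if').
have ia : P.-integrable setT (EFin \o (fun _ : Omega => a)).
  exact: finite_measure_integrable_cst.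
have ibX : P.-integrable setT (EFin \o (fun w => b * `|X w - X' w|)).
  exact: (integrableZl measurableT b iX').
have ibY : P.-integrable setT (EFin \o (fun w => b' * `|Y w - Y' w|)).
  exact: (integrableZl measurableT b' iY').
have iaX : P.-integrable setT (EFin \o (fun w => a + b * `|X w - X' w|)).
  exact: (integrableD measurableT ia ibX).
apply: (@le_trans _ _ (\int[P]_w (a + b * `|X w - X' w| + b' * `|Y w - Y' w|))).
  apply: le_Rintegral => //.
  - exact: (integrable_norm (integrableB measurableT if_ if')).
  - exact: (integrableD measurableT iaX ibY).
rewrite RintegralD// RintegralD// !RintegralZl// Rintegral_cst//.
have -> : fine (P setT) = 1 by rewrite (_ : P setT = 1%E)//; exact: probability_setT.
by rewrite mulr1; apply: lerD; [apply: lerD => //; exact: ler_wpM2l|exact: ler_wpM2l].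
Qed.

(* Squaring turns the sqrt |t - t'| of A2 into |t - t'|; q bounds the mean square
   distance of a coupling of the two laws. *)
Lemma vol_coef_regular : exists V C : R, [/\ 0 <= V, 0 <= C,
  (forall t z X Y, t \in `[0, T] ->
     `|vol_coef g sigma K eps delta t z (joint_law X Y)| <= V) &
  forall t t' z z' X Y X' Y' (q : R), t \in `[0, T] -> t' \in `[0, T] -> 0 <= q ->
    (sqint P setT (fun w => X w - X' w)%R + sqint P setT (fun w => Y w - Y' w)%R <= q%:E)%E ->
    (vol_coef g sigma K eps delta t z (joint_law X Y) -
     vol_coef g sigma K eps delta t' z' (joint_law X' Y')) ^+ 2 <=
    C * (`|t - t'| + (z.1 - z'.1) ^+ 2 + (z.2 - z'.2) ^+ 2 + q)].
Proof.
have [Ag [Lg [Ag0 Lg0 gA gL]]] := bounded_lipschitz_pos A1.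
have [AK [LK [AK0 LK0 KA KL]]] := bounded_lipschitz_pos A3.
have [As [Ls0 [sA sL0]]] := A2.
pose Ls := `|Ls0|; have Ls_ge0 : 0 <= Ls by exact: normr_ge0.
(* The bound in A2 forces its constant to be nonnegative only if [0, T] contains a point; otherwise
   both claims are vacuous. *)
have As0 : 0 <= As \/ forall t, t \notin `[0, T].
  have [T0|T0] := leP 0 T; last first.
    right=> t; apply/negP; rewrite in_itv/= => /andP[h1 h2].
    by move: (le_trans h1 h2); rewrite leNgt T0.
  by left; apply: le_trans (normr_ge0 _) (sA 0 1 _ ltr01); rewrite in_itv/= lexx.
case: As0 => [As0|noT]; last first.
  exists 0, 0; split => //; first by move=> t z X Y tT; move: (noT t); rewrite tT.
  by move=> t t' z z' X Y X' Y' q tT; move: (noT t); rewrite tT.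
have sL t t' x x' : t \in `[0, T] -> t' \in `[0, T] ->
    `|sigma t (expR x) - sigma t' (expR x')| <= Ls * (Num.sqrt `|t - t'| + `|x - x'|).
  move=> tT tT'; apply: le_trans (sL0 _ _ _ _ tT tT') _.
  by rewrite ler_wpM2r ?ler_norm// addr_ge0// sqrtr_ge0.
pose N (x : R) X := \int[P]_w K ((X w - x) / eps).
pose D (x : R) X Y := \int[P]_w (g (Y w) ^+ 2 * K ((X w - x) / eps)).
have volE t z X Y : vol_coef g sigma K eps delta t z (joint_law X Y) =
    (g z.2 * sigma t (expR z.1)) *
    (Num.sqrt (N z.1 X + delta) * (Num.sqrt (D z.1 X Y + delta))^-1).
  rewrite /vol_coef; congr (_ * (Num.sqrt (_ + _) / Num.sqrt (_ + _))).
    rewrite (@Rintegral_joint_law _ _ (fun u => K ((u.1 - z.1) / eps)) AK)//.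
    apply: (measurableT_comp (mlip A3)); apply: measurable_funM => //.
    exact: measurable_funB.
  rewrite (@Rintegral_joint_law _ _ (fun u => g u.2 ^+ 2 * K ((u.1 - z.1) / eps)) (Ag ^+ 2 * AK))//.
    apply: measurable_funM.
      by apply: measurable_funX; exact: (measurableT_comp (mlip A1)).
    apply: (measurableT_comp (mlip A3)); apply: measurable_funM => //.
    exact: measurable_funB.
  move=> u; rewrite normrM normrX ler_pM// ?exprn_ge0//.
  by rewrite lerXn2r ?nnegrE.
have mD x X Y : measurable_fun setT (fun w => g (Y w) ^+ 2 * K ((X w - x) / eps)).
  apply: measurable_funM => //; apply: measurable_funX.
  exact: (measurableT_comp (mlip A1)).
have DA x X Y w : `|g (Y w) ^+ 2 * K ((X w - x) / eps)| <= Ag ^+ 2 * AK.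
  rewrite normrM normrX ler_pM// ?exprn_ge0//.
  by rewrite lerXn2r ?nnegrE.
have N0 x X : 0 <= N x X by apply: Rintegral_ge0.
have NA x X : N x X <= AK.
  have -> : AK = \int[P]_w AK.
    have e1 : fine (P setT) = 1 by rewrite (_ : P setT = 1%E)//; exact: probability_setT.
    by rewrite Rintegral_cst// e1 mulr1.
  apply: le_Rintegral => //.
  - exact: (@bnd_int _ AK).
  - exact: finite_measure_integrable_cst.
  - by move=> w _; rewrite (le_trans (ler_norm _)).
have D0 x X Y : 0 <= D x X Y by apply: Rintegral_ge0 => w _; rewrite mulr_ge0// sqr_ge0.
pose k := LK / eps; have k0 : 0 <= k by rewrite divr_ge0// ltW.
have KB x x' (y y' : R) : `|K ((y - x) / eps) - K ((y' - x') / eps)| <= k * `|x - x'| + k * `|y - y'|.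
  apply: (le_trans (KL _ _)).
  have -> : (y - x) / eps - (y' - x') / eps = ((y - y') - (x - x')) / eps by field; rewrite gt_eqF.
  have ei : 0 <= eps^-1 by rewrite invr_ge0 ltW.
  rewrite normrM (ger0_norm ei).
  rewrite mulrCA mulrC -/k -mulrDr ler_wpM2l// [leRHS]addrC.
  exact: ler_normB.
pose s := Num.sqrt delta; have s0 : 0 < s by rewrite sqrtr_gt0.
(* Lipschitz constants of the two expectations N and D against the total distance e. Moving the
   centre of the kernel and moving the law each cost k = LK / eps; D also feels the variation of
   g^2, of constant 2 Ag Lg. *)
pose LN := 2 * k.
pose LD := 2 * (Ag ^+ 2 * k) + AK * (2 * Ag * Lg).
have LN0 : 0 <= LN by rewrite mulr_ge0.
have LD0 : 0 <= LD.
  apply: addr_ge0; last by rewrite !mulr_ge0.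
  by apply: mulr_ge0 => //; apply: mulr_ge0 => //; exact: exprn_ge0.
pose SA := Num.sqrt (AK + delta).
pose L1 := s^-1 * LN; pose L2 := (delta * s)^-1 * LD.
have ds0 : 0 <= (delta * s)^-1 by rewrite invr_ge0 mulr_ge0// ltW.
have s1 : 0 <= s^-1 by rewrite invr_ge0 ltW.
have L10 : 0 <= L1 by rewrite mulr_ge0.
have L20 : 0 <= L2 by rewrite mulr_ge0.
pose L3 := SA * L2 + s^-1 * L1.
pose L4 := Ag * Ls + As * Lg.
pose L := (Ag * As) * L3 + (SA * s^-1) * L4.
have SA0 : 0 <= SA by exact: sqrtr_ge0.
have NSA x X : `|Num.sqrt (N x X + delta)| <= SA.
  by rewrite ger0_norm ?sqrtr_ge0// ler_wsqrtr// lerD2r.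
have Dinv x X Y : `|(Num.sqrt (D x X Y + delta))^-1| <= s^-1.
  have h : s <= Num.sqrt (D x X Y + delta) by rewrite ler_wsqrtr// lerDr.
  rewrite ger0_norm; last by rewrite invr_ge0 sqrtr_ge0.
  by rewrite lef_pV2 ?posrE// (lt_le_trans s0).
have gsA t z : t \in `[0, T] -> `|g z.2 * sigma t (expR z.1)| <= Ag * As.
  by move=> tT; rewrite normrM ler_pM// sA// expR_gt0.
have rA x X Y : `|Num.sqrt (N x X + delta) * (Num.sqrt (D x X Y + delta))^-1| <= SA * s^-1.
  by rewrite normrM ler_pM.
(* The factor 4 comes from squaring the four-term distance: (e1 + e2 + e3 + e4)^2 <= 4 (e1^2 + e2^2
   + e3^2 + e4^2). *)
exists (Ag * As * (SA * s^-1)), (L ^+ 2 * 4); split.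
- by rewrite !mulr_ge0.
- by rewrite mulr_ge0// sqr_ge0.
- by move=> t z X Y tT; rewrite volE normrM ler_pM// gsA.
move=> t t' z z' X Y X' Y' q tT tT' q0 hq; rewrite !volE.
pose e1 := Num.sqrt `|t - t'|; pose e2 := `|z.1 - z'.1|; pose e3 := `|z.2 - z'.2|.
pose e4 := Num.sqrt q; pose e := e1 + e2 + e3 + e4.
have e10 : 0 <= e1 by exact: sqrtr_ge0.
have e20 : 0 <= e2 by exact: normr_ge0.
have e30 : 0 <= e3 by exact: normr_ge0.
have e40 : 0 <= e4 by exact: sqrtr_ge0.
have e0 : 0 <= e by rewrite !addr_ge0.
have hN : `|N z.1 X - N z'.1 X'| <= LN * e.
  apply: (le_trans (@RintegralB_le X Y X' Y' _ _ AK (k * e2) k 0 q _ _ _ _ _ _ _ _ _)) => //.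
    by move=> w; rewrite mul0r addr0; exact: KB.
  rewrite mul0r addr0 -mulrDr -/e4 /LN /e.
  have : 0 <= k * (e1 + e3) by rewrite mulr_ge0// addr_ge0.
  have : 0 <= k * e by rewrite mulr_ge0.
  rewrite /e; nra.
have hD : `|D z.1 X Y - D z'.1 X' Y'| <= LD * e.
  apply: (le_trans (@RintegralB_le X Y X' Y' _ _ (Ag ^+ 2 * AK) (Ag ^+ 2 * (k * e2))
      (Ag ^+ 2 * k) (AK * (2 * Ag * Lg)) q _ _ _ _ _ _ _ _ _)) => //.
  - by rewrite mulr_ge0// exprn_ge0.
  - by rewrite !mulr_ge0.
  - move=> w.
    have -> : g (Y w) ^+ 2 * K ((X w - z.1) / eps) - g (Y' w) ^+ 2 * K ((X' w - z'.1) / eps) =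
      g (Y w) ^+ 2 * (K ((X w - z.1) / eps) - K ((X' w - z'.1) / eps)) +
      K ((X' w - z'.1) / eps) * ((g (Y w) + g (Y' w)) * (g (Y w) - g (Y' w))) by ring.
    apply: (le_trans (ler_normD _ _)).
    rewrite (normrM (g (Y w) ^+ 2)) normrX (normrM (K _)) (normrM (g _ + g _)).
    have h1 : `|g (Y w)| ^+ 2 * `|K ((X w - z.1) / eps) - K ((X' w - z'.1) / eps)| <=
        Ag ^+ 2 * (k * e2 + k * `|X w - X' w|).
      apply: ler_pM; [exact: exprn_ge0|exact: normr_ge0| |exact: KB].
      by rewrite lerXn2r ?nnegrE.
    have h2 : `|K ((X' w - z'.1) / eps)| * (`|g (Y w) + g (Y' w)| * `|g (Y w) - g (Y' w)|) <=
        AK * (2 * Ag * (Lg * `|Y w - Y' w|)).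
      apply: ler_pM => //.
      apply: ler_pM => //; apply: (le_trans (ler_normD _ _)).
      by have := gA (Y w); have := gA (Y' w); lra.
    apply: (le_trans (lerD h1 h2)); rewrite le_eqVlt; apply/orP; left; apply/eqP; ring.
  rewrite -/e4 /LD /e.
  have a0 : 0 <= Ag ^+ 2 * k by rewrite mulr_ge0// exprn_ge0.
  have b0 : 0 <= AK * (2 * Ag * Lg) by rewrite !mulr_ge0.
  have := mulr_ge0 a0 e0; have := mulr_ge0 a0 e20; have := mulr_ge0 a0 e40.
  have := mulr_ge0 a0 (addr_ge0 e10 e30); have := mulr_ge0 b0 e40.
  have := mulr_ge0 b0 (addr_ge0 (addr_ge0 e10 e20) e30); rewrite /e.
  rewrite [Ag ^+ 2 * (k * e2)]mulrA.
  move: (Ag ^+ 2 * k) (AK * (2 * Ag * Lg)) => a b; lra.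
have hSN : `|Num.sqrt (N z.1 X + delta) - Num.sqrt (N z'.1 X' + delta)| <= L1 * e.
  apply: (le_trans (sqrt_lipschitz delta_gt0 _ _)); rewrite ?lerDr//.
  rewrite -/s /L1 -mulrA ler_wpM2l//.
  by have -> : N z.1 X + delta - (N z'.1 X' + delta) = N z.1 X - N z'.1 X' by ring.
have hSD : `|(Num.sqrt (D z.1 X Y + delta))^-1 - (Num.sqrt (D z'.1 X' Y' + delta))^-1| <= L2 * e.
  apply: (le_trans (inv_sqrt_lipschitz delta_gt0 _ _)); rewrite ?lerDr//.
  rewrite -/s /L2 -mulrA ler_wpM2l//.
  by have -> : D z.1 X Y + delta - (D z'.1 X' Y' + delta) = D z.1 X Y - D z'.1 X' Y' by ring.
have hr := normr_mulB_le (NSA z.1 X) (Dinv z'.1 X' Y') hSN hSD (mulr_ge0 L10 e0) (mulr_ge0 L20 e0).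
have hg : `|g z.2 - g z'.2| <= Lg * e.
  apply: (le_trans (gL _ _)); rewrite ler_wpM2l// /e -/e3; lra.
have hs : `|sigma t (expR z.1) - sigma t' (expR z'.1)| <= Ls * e.
  apply: (le_trans (sL _ _ _ _ tT tT')); rewrite ler_wpM2l// /e -/e1 -/e2; lra.
have hgs := normr_mulB_le (gA z.2) (sA t' (expR z'.1) tT' (expR_gt0 _)) hg hs
  (mulr_ge0 Lg0 e0) (mulr_ge0 Ls_ge0 e0).
have L30 : 0 <= L3 by rewrite addr_ge0// mulr_ge0.
have L40 : 0 <= L4 by rewrite addr_ge0// mulr_ge0.
have hv := normr_mulB_le (gsA t z tT) (rA z'.1 X' Y') hgs hr (mulr_ge0 L40 e0) (mulr_ge0 L30 e0).
rewrite -real_normK ?num_real//.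
have L0 : 0 <= L * e by apply: le_trans hv.
apply: (@le_trans _ _ ((L * e) ^+ 2)); first by rewrite lerXn2r ?nnegrE.
rewrite exprMn -mulrA ler_wpM2l ?sqr_ge0//.
rewrite -[(z.1 - z'.1) ^+ 2]real_normK ?num_real// -[(z.2 - z'.2) ^+ 2]real_normK ?num_real//.
have q_e4 : e4 ^+ 2 = q by rewrite sqr_sqrtr.
have t_e1 : e1 ^+ 2 = `|t - t'| by rewrite sqr_sqrtr.
rewrite -/e2 -/e3 -q_e4 -t_e1 /e.
have := sqr_ge0 (e1 - e2); have := sqr_ge0 (e1 - e3); have := sqr_ge0 (e1 - e4).
have := sqr_ge0 (e2 - e3); have := sqr_ge0 (e2 - e4); have := sqr_ge0 (e3 - e4).
nra.
Qed.

End coefficient_bounds.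

(** * Adapted coefficients and time integrals *)

Section adapted_processes.
Context d (Omega : measurableType d) (R : realType) (P : probability Omega R).
Variables (T : R) (F : R -> set (set Omega)).
Local Notation leb := (@lebesgue_measure R).
Hypothesis T_gt0 : 0 < T.
Hypothesis uF : usual_filtration P T F.
Implicit Types b X Y Z V : R -> Omega -> R.

Let T_ge0 : 0 <= T. Proof. exact: ltW. Qed.
Let T_itv : T \in `[0, T]. Proof. by rewrite in_itv/= lexx ltW. Qed.

Lemma S2_mean_square_continuous Z t : acprocess T F Z -> (normS2 P T Z < +oo)%E ->
  t \in `[0, T] ->
  (\int[P]_w (Z t w - Z (clamp T s) w) ^+ 2) @[s --> t] --> (0 : R).
Proof.
move=> aZ Zoo tT.
have mZ s : measurable_fun setT (Z (clamp T s)).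
  by apply: (acprocess_measurable uF aZ); exact: clamp_itv.
have mZt : measurable_fun setT (Z t) by apply: (acprocess_measurable uF aZ).
have mS := measurable_supsq T_gt0 uF aZ.
have S0 := supsq_ge0 T_gt0 Z.
have iS : P.-integrable setT (supsq T Z).
  apply/integrableP; split => //; apply: le_lt_trans Zoo.
  rewrite le_eqVlt; apply/orP; left; apply/eqP; apply: eq_integral => w _.
  by rewrite gee0_abs.
pose G w := 4 * fine (supsq T Z w).
have iG : P.-integrable setT (EFin \o G).
  apply: (@eq_integrable _ _ _ _ _ measurableT (fun w => 4%:E * (fine (supsq T Z w))%:E)%E).
    by [].
  apply: integrableZl => //; apply: (le_integrable measurableT _ _ iS).
    by apply/measurable_EFinP; exact: (measurableT_comp (fine_measurable measurableT)).
  by move=> w _; case: (supsq T Z w) => [r| |] //=; rewrite ?lexx ?leey.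
have aeS : {ae P, forall w, supsq T Z w \is a fin_num}.
  by have := integrable_ae measurableT iS; apply: filterS => w /(_ Logic.I).
have fin s : s \in `[0, T] -> (sqint P setT (Z s) < +oo)%E.
  by move=> sT; apply: le_lt_trans Zoo; exact: (sqint_le_normS2 T_gt0 uF).
(* Continuity under the integral is used on an open interval of parameters; the clamped process is
   defined on ]-1, T + 1[, which contains [0, T]. *)
have H := @continuity_under_integral R _ Omega P
  (fun s w => (Z t w - Z (clamp T s) w) ^+ 2) setT measurableT (-1) (T + 1) _ _ G iG _.
have tI : t \in `]-1, (T + 1)[%classic.
  by rewrite inE/= in_itv/=; move: tT; rewrite in_itv/= => /andP[h1 h2]; apply/andP; split; lra.
have -> : (0 : R) = \int[P]_w (Z t w - Z (clamp T t) w) ^+ 2.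
  rewrite clamp_id//; under eq_Rintegral do rewrite subrr expr0n.
  by rewrite Rintegral_cst//= mul0r.
apply: H tI.
- move=> s _; apply/integrableP; split.
    by apply/measurable_EFinP; apply: measurable_funX; exact: measurable_funB.
  rewrite [X in (X < _)%E](_ : _ = sqint P setT (fun w => Z t w - Z (clamp T s) w)).
    apply: (sqintB_lty mZt (mZ s)); apply: fin => //; exact: clamp_itv.
  by apply: eq_integral => w _ /=; rewrite ger0_norm// sqr_ge0.
- apply: aeW => w _ s _.
  suff : continuous (fun s => (Z t w - Z (clamp T s) w) ^+ 2) by exact.
  under eq_fun do rewrite expr2.
  move=> u; have cZ := acprocess_continuous T_gt0 (w := w) aZ.
  by apply: cvgM; apply: cvgB; try exact: cvg_cst; exact: cZ.
- move=> s _; apply: filterS aeS => w fw _.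
  rewrite ger0_norm ?sqr_ge0// /G.
  have h1 := le_supsq Z w tT; have h2 := le_supsq Z w (clamp_itv s T_ge0).
  rewrite -(fineK fw) !lee_fin in h1 h2.
  move: (Z t w) (Z (clamp T s) w) h1 h2 => a b h1 h2.
  have := sqr_ge0 (a + b); lra.
Qed.

(* q t s stands for the dependence of c on time through the law of (X t, Y t). *)
Lemma acprocess_comp (c : R -> R * R -> R) (C : R) (q : R -> R -> R) X Y :
  acprocess T F X -> acprocess T F Y ->
  (forall t, t \in `[0, T] -> q t t = 0) ->
  (forall t, t \in `[0, T] -> q t (clamp T s) @[s --> t] --> (0 : R)) ->
  (forall t s z z', t \in `[0, T] -> s \in `[0, T] ->
    (c t z - c s z') ^+ 2 <=
      C * (`|t - s| + (z.1 - z'.1) ^+ 2 + (z.2 - z'.2) ^+ 2 + q t s)) ->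
  acprocess T F (fun t w => c t (X t w, Y t w)).
Proof.
move=> aX aY q0 cq Hc; split.
  move=> t tT; apply/(adapted_sub_measurableP uF _ tT).
  have mX : measurable_fun setT (X t : g_sigma_algebraType (F t) -> R).
    by apply/(adapted_sub_measurableP uF _ tT); apply: aX.1.
  have mY : measurable_fun setT (Y t : g_sigma_algebraType (F t) -> R).
    by apply/(adapted_sub_measurableP uF _ tT); apply: aY.1.
  have lip (f : R -> R) : (forall x y, (f x - f y) ^+ 2 <= C * (x - y) ^+ 2) -> continuous f.
    move=> Hf; apply: (@lipschitz_continuous _ _ (Num.sqrt `|C|)) => x y.
    rewrite -(sqrtr_sqr (f x - f y)) -(sqrtr_sqr (x - y)) -sqrtrM// ler_wsqrtr//; apply: (le_trans (Hf x y)).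
    by rewrite ler_wpM2r ?sqr_ge0// ler_norm.
  (* With the second coordinate already random, c is continuous in x and measurable in w, so
     [measurable_joint] applies; composing with (X t, w) then gives adaptedness. *)
  have mZ : measurable_fun setT (fun p : R * g_sigma_algebraType (F t) => c t (p.1, Y t p.2)).
    apply: (@measurable_joint _ (g_sigma_algebraType (F t)) R (fun x w => c t (x, Y t w))).
      move=> w; apply: lip => x y; apply: (le_trans (Hc _ _ _ _ tT tT)) => /=.
      by rewrite !subrr q0// normr0 expr0n/= !addr0 add0r.
    move=> x; apply: (measurableT_comp (f := fun y => c t (x, y))) => //.
    apply: continuous_measurable_fun; apply: lip => y y'.
    apply: (le_trans (Hc _ _ _ _ tT tT)) => /=.
    by rewrite !subrr q0// normr0 expr0n/= !addr0 !add0r.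
  exact: (measurableT_comp mZ (measurable_fun_pair mX (measurable_id (D := setT)))).
move=> w; apply/within_clamp => //.
have key t : t \in `[0, T] -> c (clamp T s) (X (clamp T s) w, Y (clamp T s) w) @[s --> t] -->
    c t (X t w, Y t w).
  move=> tT.
  have cX := acprocess_continuous T_gt0 (w := w) aX.
  have cY := acprocess_continuous T_gt0 (w := w) aY.
  have cb : C * (`|t - clamp T s| + (X t w - X (clamp T s) w) ^+ 2 +
      (Y t w - Y (clamp T s) w) ^+ 2 + q t (clamp T s)) @[s --> t] --> (0 : R).
    rewrite [X in _ --> X](_ : _ = C * (`|t - clamp T t| + (X t w - X (clamp T t) w) * (X t w - X (clamp T t) w) +
      (Y t w - Y (clamp T t) w) * (Y t w - Y (clamp T t) w) + 0)); last first.
      by rewrite !clamp_id// !subrr normr0; ring.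
    apply: cvgM; first exact: cvg_cst.
    apply: cvgD; last exact: cq.
    under eq_fun do rewrite !expr2.
    apply: cvgD; first apply: cvgD.
    - apply: cvg_norm; apply: cvgB; [exact: cvg_cst|exact: continuous_clamp].
    - by apply: cvgM; apply: cvgB; try exact: cvg_cst; try exact: cX; exact: cY.
    - by apply: cvgM; apply: cvgB; try exact: cvg_cst; try exact: cX; exact: cY.
  apply/cvgrPdist_lt => e e0.
  have e2 : 0 < e ^+ 2 by exact: exprn_gt0.
  move/cvgrPdist_lt : cb => /(_ _ e2); apply: filterS => s.
  rewrite sub0r normrN => hs.
  rewrite -(@ltr_pXn2r _ 2)// ?nnegrE//; last exact: ltW.
  rewrite real_normK ?num_real//; apply: le_lt_trans hs.
  apply: le_trans (ler_norm _); apply: Hc => //; exact: clamp_itv.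
move=> t.
have h := key _ (clamp_itv t T_ge0).
have e : (fun s => c s (X s w, Y s w)) \o clamp T =
    (fun s => c (clamp T s) (X (clamp T s) w, Y (clamp T s) w)) \o clamp T.
  by apply/funext => s /=; rewrite (clamp_id (clamp_itv _ T_ge0)).
suff : (fun s => c s (X s w, Y s w)) \o clamp T @ t --> c (clamp T t) (X (clamp T t) w, Y (clamp T t) w) by [].
by rewrite e; exact: (cvg_comp _ _ (@continuous_clamp _ T t) h).
Qed.

Definition time_integral b t w := \int[lebesgue_measure]_(s in `[0, t]) b s w.

Lemma acprocess_section_integrable b w t : acprocess T F b -> t \in `[0, T] ->
  leb.-integrable `[0, t] (fun s => (b s w)%:E).
Proof.
rewrite in_itv/= => ab /andP[t0 tT].
apply: (@continuous_compact_integrable R (fun s => b s w)); first exact: segment_compact.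
apply: continuous_subspaceW (ab.2 w) => s /=; rewrite !in_itv/= => /andP[-> st].
exact: le_trans tT.
Qed.

(** For adaptedness the process is clamped at t rather than T: all its values are then measurable
    for [F t], and Tonelli on R x (Omega, [F t]) applies to its positive and negative parts. *)
Lemma time_integral_acprocess b : acprocess T F b -> acprocess T F (time_integral b).
Proof.
move=> ab; split; last first.
  by move=> w; apply: parameterized_integral_continuous => //; exact: acprocess_section_integrable.
move=> t tT; apply/(adapted_sub_measurableP uF _ tT).
have /andP[t0 t_le] : 0 <= t <= T by move: tT; rewrite in_itv.
pose O := g_sigma_algebraType (F t).
have jb : measurable_fun setT (fun p : R * O => b (clamp t p.1) p.2).
  apply: (@measurable_joint _ O R (fun s w => b (clamp t s) w)).
    move=> w s; have cb := acprocess_continuous T_gt0 (w := w) ab.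
    have e : b ^~ w \o clamp t = (fun s => b (clamp T s) w) \o clamp t.
      apply/funext => u /=; rewrite (@clamp_id _ T)//.
      by have := clamp_itv u t0; rewrite !in_itv/= => /andP[-> /le_trans->].
    suff : b ^~ w \o clamp t @ s --> b (clamp t s) w by [].
    rewrite e -[clamp t s in X in _ --> X](@clamp_id _ T); last first.
      by have := clamp_itv s t0; rewrite !in_itv/= => /andP[-> /le_trans->].
    exact: (cvg_comp _ _ (@continuous_clamp _ t s) (cb _)).
  move=> s.
  have cs : clamp t s \in `[0, t] by exact: clamp_itv.
  have csT : clamp t s \in `[0, T] by move: cs; rewrite !in_itv/= => /andP[-> /le_trans->].
  apply/(adapted_sub_measurableP uF _ tT); apply: (sub_filtration uF csT tT).
    by move: cs; rewrite in_itv/= => /andP[].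
  exact: ab.1.
have mI (f : R -> O -> \bar R) : measurable_fun setT (fun p : R * O => f p.1 p.2) ->
    (forall s w, 0 <= f s w)%E ->
    measurable_fun setT (fun w => \int[leb]_(s in `[0%R, t]) f s w)%E.
  move=> mf; apply: (@measurable_integral_time _ O R t) => //.
  exact: measurable_funTS.
pose f s w := (b (clamp t s) w)%:E.
have mf : measurable_fun setT (fun p : R * O => f p.1 p.2) by apply/measurable_EFinP.
have -> : time_integral b t = (fun w : O => fine
    (\int[leb]_(s in `[0%R, t]) maxe (f s w) 0 -
     \int[leb]_(s in `[0%R, t]) maxe (- f s w) 0)%E).
  apply/funext => w; rewrite /time_integral /Rintegral integralE.
  congr (fine (_ - _)%E); apply: eq_integral => s /[1!inE] st;
    by rewrite /f clamp_id// ?funeposE ?funenegE.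
suff h : measurable_fun setT (fun w : O =>
    \int[leb]_(s in `[0%R, t]) maxe (f s w) 0 -
    \int[leb]_(s in `[0%R, t]) maxe (- f s w) 0)%E.
  exact: (measurableT_comp (fine_measurable measurableT) h).
apply: emeasurable_funB; apply: mI => //.
- exact: measurable_maxe.
- by move=> s w; rewrite le_max lexx orbT.
- by apply: measurable_maxe => //; exact: measurableT_comp.
- by move=> s w; rewrite le_max lexx orbT.
Qed.

Lemma sqr_time_integral_le b t w : acprocess T F b -> t \in `[0, T] ->
  ((time_integral b t w ^+ 2)%:E <= T%:E * sqint leb `[0%R, t] (b ^~ w))%E.
Proof.
move=> ab tT; have ib := acprocess_section_integrable w ab tT.
have t_le : t <= T by move: tT; rewrite in_itv/= => /andP[].
have mb : measurable_fun `[0, t] (fun s => b s w).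
  by apply/measurable_EFinP; exact: measurable_int ib.
have mu_t : (leb `[0%R, t]%classic <= T%:E)%E.
  rewrite lebesgue_measure_itv/= lte_fin; case: ifPn => _; last by rewrite lee_fin.
  by rewrite -EFinB lee_fin subr0.
apply: (le_trans _ (sqr_integral_le _ T_gt0 mu_t mb)) => //.
have i1 := integrable_norm ib.
have /fineK <- : (\int[leb]_(s in `[0%R, t]) `|b s w|%:E)%E \is a fin_num.
  exact: integrable_fin_num.
rewrite -EFin_expe lee_fin -real_normK ?num_real// lerXn2r ?nnegrE//.
  exact: fine_ge0 (integral_ge0 _ _).
exact: le_normr_Rintegral.
Qed.

Lemma sqint_time_integral_le b t : acprocess T F b -> t \in `[0, T] ->
  (sqint P setT (time_integral b t) <= T%:E * sqint2 P t b)%E.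
Proof.
move=> ab tT; have t_le : t <= T by move: tT; rewrite in_itv/= => /andP[].
have mS := measurable_sqint_time t_le (acprocess_jmeasurable T_gt0 uF ab).
rewrite /sqint2 -ge0_integralZl//; last first.
  by move=> w _; exact: sqint_ge0.
apply: ge0_le_integral => //.
- by move=> w _; rewrite lee_fin sqr_ge0.
- apply: measurable_sqE; apply: (acprocess_measurable uF _ tT).
  exact: time_integral_acprocess.
- exact: emeasurable_funM.
- by move=> w _; exact: sqr_time_integral_le.
Qed.

Lemma normS2_time_integral_le b : acprocess T F b ->
  (normS2 P T (time_integral b) <= T%:E * sqint2 P T b)%E.
Proof.
move=> ab; have jb := acprocess_jmeasurable T_gt0 uF ab.
have mS := measurable_sqint_time (lexx T) jb.
rewrite /sqint2 -ge0_integralZl//; last first.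
  by move=> w _; exact: sqint_ge0.
apply: ge0_le_integral => //.
- by move=> w _; exact: supsq_ge0.
- by apply: (measurable_supsq T_gt0 uF); exact: time_integral_acprocess.
- exact: emeasurable_funM.
- move=> w _; apply: supsq_le => t tT; apply: (le_trans (sqr_time_integral_le w ab tT)).
  rewrite lee_pmul2l ?lte_fin//.
  apply: ge0_subset_integral => //.
  + apply: measurable_sqE; exact: (jmeasurable_section w (lexx T)).
  + by move=> s _; rewrite lee_fin sqr_ge0.
  + move: tT; rewrite in_itv/= => /andP[_ tT] s /=.
    by rewrite !in_itv/= => /andP[-> /le_trans->].
Qed.

Lemma sqint2_le_normS2 V : acprocess T F V -> (sqint2 P T V <= T%:E * normS2 P T V)%E.
Proof.
move=> aV; have jV := acprocess_jmeasurable T_gt0 uF aV.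
have mS := measurable_supsq T_gt0 uF aV.
have S0 := supsq_ge0 T_gt0 V.
rewrite /normS2 -ge0_integralZl//.
apply: ge0_le_integral => //.
- by move=> w _; exact: sqint_ge0.
- exact: (measurable_sqint_time (lexx T) jV).
- exact: emeasurable_funM.
- move=> w _.
  apply: (@le_trans _ _ (\int[leb]_(s in `[0%R, T]) (supsq T V w))%E).
    apply: ge0_le_integral => //.
    + by move=> s _; rewrite lee_fin sqr_ge0.
    + apply: measurable_sqE; exact: (jmeasurable_section w (lexx T)).
    + by move=> s sT; exact: le_supsq.
  rewrite integral_cst//= lebesgue_measure_itv/= lte_fin T_gt0 -EFinB subr0.
  by rewrite muleC.
Qed.

(** Rewrites an L^2(dt x P) distance as the time integral of the mean square distance, the form that
    the Picard estimate iterates. *)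
Lemma sqint2_tonelli V t : acprocess T F V -> t \in `[0, T] ->
  measurable_fun `[0, t] (fun s => sqint P setT (V s)) /\
  sqint2 P t V = (\int[leb]_(s in `[0%R, t]) sqint P setT (V s))%E.
Proof.
move=> aV tT; have t_le : t <= T by move: tT; rewrite in_itv/= => /andP[].
pose TR := measurableTypeR R.
pose g (p : TR * Omega) := (if p.1 \in `[0%R, t] then (V (clamp T p.1) p.2 ^+ 2)%:E else 0)%E.
have mg : measurable_fun setT g.
  have mV : measurable_fun setT (fun p : TR * Omega => (V (clamp T p.1) p.2 ^+ 2)%:E).
    have := measurable_sqE (acprocess_joint T_gt0 uF aV).
    by move=> h mD Y mY; exact: (h mD Y mY).
  apply: measurable_fun_ifT => //.
  apply: (measurable_fun_bool true).
  rewrite setTI (_ : _ @^-1` _ = (`[0, t]%classic : set TR) `*` setT).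
    exact: measurableX.
  by apply/seteqP; split => -[s w] /=; [move=> ->|case=> ->].
have g0 p : (0 <= g p)%E by rewrite /g; case: ifP => // _; rewrite lee_fin sqr_ge0.
have E1 s : fubini_F P g s = if s \in `[0, t] then sqint P setT (V s) else 0%E.
  rewrite /fubini_F /g /=; case: ifPn => st; last by rewrite integral0.
  apply: eq_integral => w _; rewrite clamp_id//.
  by move: st; rewrite !in_itv/= => /andP[-> /le_trans->].
have mF := measurable_fun_fubini_tonelli_F (m2 := P) g mg g0.
split.
  apply: (@eq_measurable_fun _ _ _ _ _ (fubini_F P g)).
    by move=> s; rewrite inE/= => st; rewrite E1 st.
  have : measurable_fun (`[0, t]%classic : set TR) (fubini_F P g) by exact: measurable_funTS.
  by move=> h mD Y mY; exact: (h mD Y mY).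
have := fubini_tonelli (m1 := leb) (m2 := P) g mg g0.
move=> e; transitivity (\int[P]_w \int[leb]_s g (s, w))%E.
  apply: eq_integral => w _; rewrite /sqint [LHS]integral_mkcond.
  apply: eq_integral => s _; rewrite /g patchE mem_setE/=; case: ifPn => // st.
  rewrite clamp_id//.
  by move: st; rewrite !in_itv/= => /andP[-> /le_trans->].
rewrite -e [RHS]integral_mkcond; apply: eq_integral => s _.
by rewrite patchE mem_setE; exact: E1.
Qed.

End adapted_processes.

(** * Ito equations *)

Section ito_equations.
Context d (Omega : measurableType d) (R : realType) (P : probability Omega R).
Variables (T : R) (F : R -> set (set Omega)).
Hypothesis T_gt0 : 0 < T.
Hypothesis uF : usual_filtration P T F.
Variables (c : R) (W : R -> Omega -> R).
Hypothesis c_ge0 : 0 <= c.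
Hypothesis dW : ito_driver P T F c W.
Implicit Types Z b h : R -> Omega -> R.

Let T_ge0 : 0 <= T. Proof. exact: ltW. Qed.
Let T_itv : T \in `[0, T]. Proof. by rewrite in_itv/= lexx ltW. Qed.

Lemma ae_sqint_eq Z Z' t : acprocess T F Z -> acprocess T F Z' -> t \in `[0, T] ->
  {ae P, forall w, forall t, t \in `[0, T] -> Z t w = Z' t w} ->
  sqint P setT (Z t) = sqint P setT (Z' t).
Proof.
move=> aZ aZ' tT ZZ'; apply: ge0_ae_eq_integral => //.
- by apply: measurable_sqE; exact: (acprocess_measurable uF aZ).
- by apply: measurable_sqE; exact: (acprocess_measurable uF aZ').
- by move=> w _; rewrite lee_fin sqr_ge0.
- by move=> w _; rewrite lee_fin sqr_ge0.
- by apply: filterS ZZ' => w e _; rewrite e.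
Qed.

Lemma ae_normS2_eq Z Z' : acprocess T F Z -> acprocess T F Z' ->
  {ae P, forall w, forall t, t \in `[0, T] -> Z t w = Z' t w} ->
  normS2 P T Z = normS2 P T Z'.
Proof.
move=> aZ aZ' ZZ'; apply: ge0_ae_eq_integral => //.
- exact: (measurable_supsq T_gt0 uF).
- exact: (measurable_supsq T_gt0 uF).
- by move=> w _; exact: supsq_ge0.
- by move=> w _; exact: supsq_ge0.
- apply: filterS ZZ' => w e _; congr ereal_sup.
  by apply/seteqP; split => x [s sT <-]; exists s => //; rewrite e.
Qed.

(** The initial values cancel, leaving a time integral plus an Ito integral. One constant serves
    both bounds: 2 from splitting, T from Cauchy-Schwarz, and 64 c, the larger of the constants of
    the two Ito estimates. *)
Lemma ito_equationB Z Z' b b' h h' z0 (C := 2 * T + 128 * c) :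
  acprocess T F Z -> acprocess T F Z' -> acprocess T F b -> acprocess T F b' ->
  ito_equation P T F W Z b h z0 -> ito_equation P T F W Z' b' h' z0 ->
  (forall t, t \in `[0, T] ->
     (sqint P setT (fun w => Z t w - Z' t w)%R <=
      C%:E * (sqint2 P t (fun s w => b s w - b' s w)%R +
              sqint2 P t (fun s w => h s w - h' s w)%R))%E) /\
  (normS2 P T (fun t w => Z t w - Z' t w)%R <=
      C%:E * (sqint2 P T (fun s w => b s w - b' s w)%R +
              sqint2 P T (fun s w => h s w - h' s w)%R))%E.
Proof.
move=> aZ aZ' ab ab' [_ [I hI ZI]] [_ [I' hI' ZI']].
have aI := ito_integral_acprocess hI; have aI' := ito_integral_acprocess hI'.
have aZZ := acprocessB T_gt0 uF aZ aZ'.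
have abb := acprocessB T_gt0 uF ab ab'.
have aII := acprocessB T_gt0 uF aI aI'.
have aB := time_integral_acprocess T_gt0 uF abb.
pose B t w := time_integral (fun t w => b t w - b' t w) t w.
pose J t w := I t w - I' t w.
have aD := acprocessD T_gt0 uF aB aII.
have e : {ae P, forall w, forall t, t \in `[0, T] -> Z t w - Z' t w = B t w + J t w}.
  apply: filterS2 ZI ZI' => w e1 e2 t tT; rewrite e1// e2// /B /J /time_integral.
  have i1 := acprocess_section_integrable w ab tT.
  have i2 := acprocess_section_integrable w ab' tT.
  by rewrite RintegralB//; ring.
have C0 (x y : \bar R) (k : R) : (0 <= x)%E -> (0 <= y)%E -> 0 <= k -> k <= 64 * c ->
    (2%:E * (T%:E * x) + 2%:E * (k%:E * y) <= C%:E * (x + y))%E.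
  move=> x0 y0 k0 kc; rewrite ge0_muleDr// !muleA -!EFinM; apply: leeD.
    by apply: lee_wpmul2r => //; rewrite lee_fin /C; lra.
  by apply: lee_wpmul2r => //; rewrite lee_fin /C; have := T_ge0; lra.
split=> [t tT|].
  have t_le : t <= T by move: tT; rewrite in_itv/= => /andP[].
  rewrite (ae_sqint_eq aZZ aD tT e).
  have mB := acprocess_measurable uF aB tT.
  have mJ := acprocess_measurable uF aII tT.
  apply: (le_trans (sqintD P measurableT mB mJ)).
  apply: le_trans (C0 _ _ (16 * c) (sqint2_ge0 _ _ _) (sqint2_ge0 _ _ _) _ _); last 2 first.
    by rewrite mulr_ge0.
    by have := c_ge0; lra.
  apply: leeD; apply: lee_wpmul2l => //.
    exact: (sqint_time_integral_le T_gt0 uF abb tT).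
  exact: (ito_integralB_sqint T_gt0 uF c_ge0 dW tT hI hI').
rewrite (ae_normS2_eq aZZ aD e).
apply: (le_trans (normS2D T_gt0 uF aB aII)).
apply: le_trans (C0 _ _ (64 * c) (sqint2_ge0 _ _ _) (sqint2_ge0 _ _ _) _ _); last 2 first.
  by rewrite mulr_ge0.
  by [].
apply: leeD; apply: lee_wpmul2l => //.
  exact: (normS2_time_integral_le T_gt0 uF abb).
exact: (ito_integralB_normS2 T_gt0 uF c_ge0 dW hI hI').
Qed.

Lemma ito_equation_exists b h (z0 : Omega -> R) (M : R) :
  acprocess T F b -> (normS2 P T b < +oo)%E ->
  acprocess T F h -> (forall t w, t \in `[0, T] -> `|h t w| <= M) ->
  sigma_of z0 `<=` F 0 -> (sqint P setT z0 < +oo)%E ->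
  exists Z, [/\ acprocess T F Z, (normS2 P T Z < +oo)%E &
    ito_equation P T F W Z b h z0].
Proof.
move=> ab boo ah hM z0F z0oo.
have [I hI Ioo] := ito_integral_exists T_gt0 uF c_ge0 dW ah hM.
have aI := ito_integral_acprocess hI.
have aB := time_integral_acprocess T_gt0 uF ab.
have az0 := acprocess_cst T_gt0 uF z0F.
have aS := acprocessD T_gt0 uF az0 aB.
exists (fun t w => z0 w + time_integral b t w + I t w); split.
- exact: (acprocessD T_gt0 uF aS aI).
- apply: (le_lt_trans (normS2D T_gt0 uF aS aI)).
  rewrite lte_add_pinfty ?lte_mul_pinfty//.
  apply: (le_lt_trans (normS2D T_gt0 uF az0 aB)).
  rewrite lte_add_pinfty ?lte_mul_pinfty//.
    apply: le_lt_trans z0oo; apply: ge0_le_integral => //.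
    + by move=> w _; exact: supsq_ge0.
    + exact: (measurable_supsq T_gt0 uF).
    + apply: measurable_sqE; exact: (acprocess_measurable uF az0 T_itv).
    + by move=> w _; exact: supsq_le.
  apply: (le_lt_trans (normS2_time_integral_le T_gt0 uF ab)).
  rewrite lte_mul_pinfty//.
  apply: (le_lt_trans (sqint2_le_normS2 T_gt0 uF ab)).
  by rewrite lte_mul_pinfty.
- split; last by exists I => //; exact: aeW.
  by apply: aeW => w; exact: (acprocess_section_integrable w ab T_itv).
Qed.

End ito_equations.

(** * The Picard iteration *)

Section mckean_vlasov_step.
Context d (Omega : measurableType d) (R : realType) (P : probability Omega R).
Variables (T : R) (F : R -> set (set Omega)).
Hypothesis T_gt0 : 0 < T.
Hypothesis uF : usual_filtration P T F.
Variables (c : R) (Wx Wy : R -> Omega -> R).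
Hypothesis c_ge0 : 0 <= c.
Hypothesis dWx : ito_driver P T F c Wx.
Hypothesis dWy : ito_driver P T F c Wy.
Variables (g : R -> R) (sigma : R -> R -> R) (K : R -> R) (eps delta : R).
Hypothesis K_ge0 : forall u, 0 <= K u.
Hypothesis eps_gt0 : 0 < eps.
Hypothesis delta_gt0 : 0 < delta.
Hypothesis A1 : bounded_lipschitz g.
Hypothesis A2 : local_vol_regular T sigma.
Hypothesis A3 : bounded_lipschitz K.
Variables (m theta gamma : R) (X0 Y0 : Omega -> R).
Hypothesis X0_F0 : sigma_of X0 `<=` F 0.
Hypothesis Y0_F0 : sigma_of Y0 `<=` F 0.
Hypothesis X0_L2 : (sqint P setT X0 < +oo)%E.
Hypothesis Y0_L2 : (sqint P setT Y0 < +oo)%E.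
Implicit Types X Y U V : R -> {RV P >-> R}.

Let T_ge0 : 0 <= T. Proof. exact: ltW. Qed.
Let T_itv : T \in `[0, T]. Proof. by rewrite in_itv/= lexx ltW. Qed.

Definition S2_process (Z : R -> Omega -> R) :=
  acprocess T F Z /\ (normS2 P T Z < +oo)%E.

Definition vol_process X Y t w :=
  vol_coef g sigma K eps delta t (X t w, Y t w) (joint_law (X t) (Y t)).

Definition drift_process X Y t w :=
  drift_coef g sigma K eps delta t (X t w, Y t w) (joint_law (X t) (Y t)).

(** A relation rather than a function, since its equations fix the images only up to a null set. A
    pair related to itself satisfies [is_MV_solution] by unfolding. *)
Definition picard_step X Y X' Y' :=
  ito_equation P T F Wx X' (drift_process X Y) (vol_process X Y) X0 /\
  ito_equation P T F Wy Y' (fun t w => m * (theta - Y t w)) (fun _ _ => gamma) Y0.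

(** The cost of the coupling given by the common probability space, an upper bound for the squared
    Wasserstein-2 distance of the two laws; it is the q of [vol_coef_regular]. *)
Definition dist2 X Y U V (s : R) : \bar R :=
  (sqint P setT (fun w => X s w - U s w)%R + sqint P setT (fun w => Y s w - V s w)%R)%E.

Lemma dist2_ge0 X Y U V s : (0 <= dist2 X Y U V s)%E.
Proof. by rewrite adde_ge0// sqint_ge0. Qed.

Lemma S2_processZ (k : R) (Z : R -> Omega -> R) : S2_process Z ->
  S2_process (fun t w => k * Z t w).
Proof.
move=> [aZ Zoo]; have aK : acprocess T F (fun t w => k * Z t w).
  by apply: (acprocessM T_gt0 uF) => //; exact: (acprocess_scalar T_gt0 uF).
have mS := measurable_supsq T_gt0 uF aZ.
have S0 := supsq_ge0 T_gt0 Z.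
split => //; apply: (@le_lt_trans _ _ ((k ^+ 2)%:E * normS2 P T Z)%E); last first.
  by rewrite lte_mul_pinfty// lee_fin sqr_ge0.
rewrite /normS2 -ge0_integralZl//; last by rewrite lee_fin sqr_ge0.
apply: ge0_le_integral => //.
- by move=> w _; exact: supsq_ge0.
- exact: (measurable_supsq T_gt0 uF).
- exact: emeasurable_funM.
- move=> w _; apply: supsq_le => t tT; rewrite exprMn EFinM.
  by apply: lee_wpmul2l; [rewrite lee_fin sqr_ge0|exact: le_supsq].
Qed.

Lemma S2_processB (Z Z' : R -> Omega -> R) : S2_process Z -> S2_process Z' ->
  S2_process (fun t w => Z t w - Z' t w).
Proof.
move=> [aZ Zoo] sZ'; have [aN Noo] := S2_processZ (-1) sZ'.
have -> : (fun t w => Z t w - Z' t w) = (fun t w => Z t w + (-1 * Z' t w)).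
  by apply/funext => t; apply/funext => w; rewrite mulN1r.
split; first exact: (acprocessD T_gt0 uF).
apply: (le_lt_trans (normS2D T_gt0 uF aZ aN)).
by rewrite lte_add_pinfty ?lte_mul_pinfty.
Qed.

Lemma S2_sqint_lty (Z : R -> Omega -> R) t : S2_process Z -> t \in `[0, T] ->
  (sqint P setT (Z t) < +oo)%E.
Proof.
by move=> [aZ Zoo] tT; exact: le_lt_trans (sqint_le_normS2 T_gt0 uF aZ tT) Zoo.
Qed.

Lemma dist2_lty X Y U V s : S2_process X -> S2_process Y -> S2_process U -> S2_process V ->
  s \in `[0, T] -> (dist2 X Y U V s < +oo)%E.
Proof.
move=> sX sY sU sV sT.
apply: lte_add_pinfty; first exact: (S2_sqint_lty (S2_processB sX sU) sT).
exact: (S2_sqint_lty (S2_processB sY sV) sT).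
Qed.

Lemma measurable_dist2 X Y U V t : S2_process X -> S2_process Y -> S2_process U ->
  S2_process V -> t \in `[0, T] -> measurable_fun `[0, t] (dist2 X Y U V).
Proof.
move=> sX sY sU sV tT; apply: emeasurable_funD.
  by have [] := sqint2_tonelli T_gt0 uF (S2_processB sX sU).1 tT.
by have [] := sqint2_tonelli T_gt0 uF (S2_processB sY sV).1 tT.
Qed.

Lemma bounded_normS2_lty (Z : R -> Omega -> R) (M : R) : acprocess T F Z ->
  (forall t w, t \in `[0, T] -> `|Z t w| <= M) -> (normS2 P T Z < +oo)%E.
Proof.
move=> aZ ZM; apply: (@le_lt_trans _ _ (\int[P]_w (M ^+ 2)%:E)%E); last first.
  rewrite integral_cst//= [X in (_ * X)%E](_ : _ = 1%E) ?mule1 ?ltry//.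
  exact: probability_setT.
apply: ge0_le_integral => //.
- by move=> w _; exact: supsq_ge0.
- exact: (measurable_supsq T_gt0 uF).
- move=> w _; apply: supsq_le => t tT; rewrite lee_fin -real_normK ?num_real//.
  by rewrite lerXn2r ?nnegrE//; [exact: le_trans (ZM t w tT)|exact: ZM].
Qed.

(** The laws at times t and s are coupled by the process itself, so q is its mean square
    displacement, which tends to 0. *)
Lemma vol_process_acprocess X Y : S2_process X -> S2_process Y ->
  acprocess T F (vol_process X Y).
Proof.
move=> sX sY.
have [V [C [_ _ _ HC]]] := vol_coef_regular P K_ge0 eps_gt0 delta_gt0 A1 A2 A3.
pose q t s := \int[P]_w (X t w - X s w) ^+ 2 + \int[P]_w (Y t w - Y s w) ^+ 2.
have sqE Z t s : S2_process Z -> t \in `[0, T] -> s \in `[0, T] ->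
    sqint P setT (fun w => Z t w - Z s w) = (\int[P]_w (Z t w - Z s w) ^+ 2)%:E.
  move=> sZ tT sT; rewrite fineK//.
  rewrite ge0_fin_numE ?sqint_ge0//; apply: sqintB_lty; try exact: S2_sqint_lty;
    exact: (acprocess_measurable uF sZ.1).
apply: (@acprocess_comp _ _ _ P T F T_gt0 uF
  (fun t z => vol_coef g sigma K eps delta t z (joint_law (X t) (Y t))) C q
  (fun t => X t) (fun t => Y t)).
- exact: sX.1.
- exact: sY.1.
- move=> t _; rewrite /q; under eq_Rintegral do rewrite subrr expr0n.
  under [X in _ + X]eq_Rintegral do rewrite subrr expr0n.
  by rewrite !Rintegral_cst//= !mul0r addr0.
- move=> t tT; rewrite -[X in _ --> X]addr0.
  apply: cvgD.
    exact: (S2_mean_square_continuous T_gt0 uF sX.1 sX.2 tT).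
  exact: (S2_mean_square_continuous T_gt0 uF sY.1 sY.2 tT).
- move=> t s z z' tT sT; apply: HC => //.
    by rewrite addr_ge0//; apply: Rintegral_ge0 => w _; rewrite sqr_ge0.
  by rewrite (sqE (fun t => X t))// (sqE (fun t => Y t)).
Qed.

Lemma drift_processE X Y : drift_process X Y =
  (fun t w => - 2^-1 * (vol_process X Y t w * vol_process X Y t w)).
Proof. by []. Qed.

Lemma drift_process_acprocess X Y : S2_process X -> S2_process Y ->
  acprocess T F (drift_process X Y).
Proof.
move=> sX sY; rewrite drift_processE; have av := vol_process_acprocess sX sY.
apply: (acprocessM T_gt0 uF); first exact: (acprocess_scalar T_gt0 uF).
exact: (acprocessM T_gt0 uF).
Qed.

Lemma reversion_S2 Y : S2_process Y -> S2_process (fun t w => m * (theta - Y t w)).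
Proof.
move=> sY; apply: S2_processZ; apply: S2_processB => //.
have a := @acprocess_scalar _ _ _ P T F T_gt0 uF theta.
by split => //; apply: (@bounded_normS2_lty _ `|theta|).
Qed.

Lemma coef_process_bounded : exists M : R, forall X Y t w, t \in `[0, T] ->
  `|vol_process X Y t w| <= M /\ `|drift_process X Y t w| <= M ^+ 2.
Proof.
have [V [C [V0 _ HV _]]] := vol_coef_regular P K_ge0 eps_gt0 delta_gt0 A1 A2 A3.
exists V => X Y t w tT; have h := HV t (X t w, Y t w) (X t) (Y t) tT.
split => //.
have -> : `|drift_process X Y t w| = 2^-1 * `|vol_process X Y t w| ^+ 2.
  by rewrite /drift_process /drift_coef normrM normrX normrN (ger0_norm (_ : 0 <= 2^-1)) ?invr_ge0.
have h2 : `|vol_process X Y t w| ^+ 2 <= V ^+ 2 by rewrite lerXn2r ?nnegrE.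
apply: le_trans h2; rewrite ler_piMl ?exprn_ge0//; lra.
Qed.

(** Adaptedness gives measurability only for times in [0, T]; clamping the time yields random
    variables at every real time. *)
Lemma S2_process_RV (Z : R -> Omega -> R) : S2_process Z ->
  exists X, S2_process X /\ forall t w, t \in `[0, T] -> X t w = Z t w.
Proof.
move=> [aZ Zoo]; have mZ t : measurable_fun setT (Z (clamp T t)).
  by apply: (acprocess_measurable uF aZ); exact: clamp_itv.
pose X t : {RV P >-> R} := HB.pack (Z (clamp T t)) (isMeasurableFun.Build _ _ _ _ (Z (clamp T t)) (mZ t)).
have XZ t w : t \in `[0, T] -> X t w = Z t w by move=> tT; rewrite /X/= clamp_id.
have aX : acprocess T F X.
  split=> [t tT|w].
    rewrite (_ : (X t : Omega -> R) = Z t); first exact: aZ.1.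
    by apply/funext => w; exact: XZ.
  apply: (@subspace_eq_continuous _ _ _ (fun t => Z t w)); last exact: aZ.2.
  by move=> t; rewrite inE/= => tT; exact/esym/XZ.
exists X; split => //; split => //.
by rewrite (ae_normS2_eq T_gt0 uF aX aZ)//; apply: aeW => w t; exact: XZ.
Qed.

Lemma ito_equation_eq W (Z Z' b h : R -> Omega -> R) z0 :
  {ae P, forall w, forall t, t \in `[0, T] -> Z' t w = Z t w} ->
  ito_equation P T F W Z b h z0 -> ito_equation P T F W Z' b h z0.
Proof.
move=> ZZ' [ib [I hI hZ]]; split => //; exists I => //.
by apply: filterS2 ZZ' hZ => w eZ e t tT; rewrite eZ// e.
Qed.

Lemma picard_step_exists X Y : S2_process X -> S2_process Y ->
  exists X' Y' : R -> {RV P >-> R}, [/\ S2_process X', S2_process Y' & picard_step X Y X' Y'].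
Proof.
move=> sX sY; have [M HM] := coef_process_bounded.
have av := vol_process_acprocess sX sY; have ad := drift_process_acprocess sX sY.
have [sR Roo] := reversion_S2 sY.
have [X' [aX' X'oo eX']] := ito_equation_exists T_gt0 uF c_ge0 dWx ad
  (bounded_normS2_lty ad (fun t w tT => (HM X Y t w tT).2)) av
  (fun t w tT => (HM X Y t w tT).1) X0_F0 X0_L2.
have [Y' [aY' Y'oo eY']] := ito_equation_exists T_gt0 uF c_ge0 dWy sR Roo
  (@acprocess_scalar _ _ _ P T F T_gt0 uF gamma) (fun t w _ => lexx `|gamma|) Y0_F0 Y0_L2.
have [X'' [sX' HX]] := S2_process_RV (conj aX' X'oo).
have [Y'' [sY' HY]] := S2_process_RV (conj aY' Y'oo).
exists X'', Y''; split => //; split.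
  by apply: ito_equation_eq eX'; apply: aeW => w t; exact: HX.
by apply: ito_equation_eq eY'; apply: aeW => w t; exact: HY.
Qed.

Lemma sqint2_le_dist2 (Z : R -> Omega -> R) X Y U V (k : R) t :
  S2_process X -> S2_process Y -> S2_process U -> S2_process V ->
  acprocess T F Z -> t \in `[0, T] -> 0 <= k ->
  (forall s, s \in `[0, T] -> (sqint P setT (Z s) <= k%:E * dist2 X Y U V s)%E) ->
  (sqint2 P t Z <= k%:E * \int[lebesgue_measure]_(s in `[0%R, t]) dist2 X Y U V s)%E.
Proof.
move=> sX sY sU sV aZ tT k0 H.
have md := measurable_dist2 sX sY sU sV tT.
have [mZ ->] := sqint2_tonelli T_gt0 uF aZ tT.
rewrite -ge0_integralZl//; last by move=> s _; exact: dist2_ge0.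
apply: ge0_le_integral => //.
- by move=> s _; exact: sqint_ge0.
- exact: emeasurable_funM.
- move=> s /=; rewrite in_itv/= => /andP[s0 st]; apply: H.
  by move: tT; rewrite !in_itv/= => /andP[_ /(le_trans st)->]; rewrite s0.
Qed.

(** The distance is counted twice, for the arguments and for the laws, whence 2 C. The drift is
    minus half the square of the volatility, which is bounded by M, so its squared variation is at
    most M^2 times larger. *)
Lemma coef_process_lipschitz : exists2 k : R, 0 <= k & forall X Y U V s,
  S2_process X -> S2_process Y -> S2_process U -> S2_process V -> s \in `[0, T] ->
  (sqint P setT (fun w => vol_process X Y s w - vol_process U V s w)%R <=
     k%:E * dist2 X Y U V s)%E /\
  (sqint P setT (fun w => drift_process X Y s w - drift_process U V s w)%R <=
     k%:E * dist2 X Y U V s)%E.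
Proof.
have [M [C [M0 C0 HM HC]]] := vol_coef_regular P K_ge0 eps_gt0 delta_gt0 A1 A2 A3.
exists (2 * C * (1 + M ^+ 2)); first by rewrite !mulr_ge0// addr_ge0// exprn_ge0.
move=> X Y U V s sX sY sU sV sT.
have mm Z : S2_process Z -> measurable_fun setT (Z s).
  by move=> sZ; exact: (acprocess_measurable uF sZ.1 sT).
have mv := acprocess_measurable uF (vol_process_acprocess sX sY) sT.
have mv' := acprocess_measurable uF (vol_process_acprocess sU sV) sT.
have md := acprocess_measurable uF (drift_process_acprocess sX sY) sT.
have md' := acprocess_measurable uF (drift_process_acprocess sU sV) sT.
have mvB : measurable_fun setT (fun w => vol_process X Y s w - vol_process U V s w).
  exact: measurable_funB.
have sq0 (f : Omega -> R) w : (0 <= (f w ^+ 2)%:E)%E by rewrite lee_fin sqr_ge0.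
have finD : dist2 X Y U V s \is a fin_num.
  by rewrite ge0_fin_numE ?dist2_ge0// dist2_lty.
pose q := fine (dist2 X Y U V s).
have q0 : 0 <= q by rewrite fine_ge0// dist2_ge0.
have hv : (sqint P setT (fun w => vol_process X Y s w - vol_process U V s w)%R <=
    (2 * C)%:E * dist2 X Y U V s)%E.
  pose dX w := X s w - U s w; pose dY w := Y s w - V s w.
  have mdX : measurable_fun setT dX by exact: measurable_funB.
  have mdY : measurable_fun setT dY by exact: measurable_funB.
  have msX := measurable_sqE mdX; have msY := measurable_sqE mdY.
  apply: (@le_trans _ _ (\int[P]_w (C%:E * ((dX w ^+ 2)%:E + (dY w ^+ 2)%:E) + (C * q)%:E))%E).
    apply: ge0_le_integral => //.
    - by move=> w _; exact: (sq0 (fun w => vol_process X Y s w - vol_process U V s w)).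
    - exact: measurable_sqE.
    - apply: emeasurable_funD => //; apply: emeasurable_funM => //.
      exact: emeasurable_funD.
    - move=> w _; rewrite -(EFinD (dX w ^+ 2)) -(EFinM C) -(EFinD (C * _)) lee_fin.
      apply: (le_trans (HC _ _ _ _ _ _ _ _ q sT sT q0 _)).
        by rewrite /q fineK.
      by rewrite subrr normr0 add0r/= -mulrDr.
  have f0 w : (0 <= (dX w ^+ 2)%:E + (dY w ^+ 2)%:E)%E by rewrite adde_ge0// sq0.
  have mf : measurable_fun setT (fun w => (dX w ^+ 2)%:E + (dY w ^+ 2)%:E)%E.
    exact: emeasurable_funD.
  rewrite (@ge0_integralD _ _ _ P setT measurableT
    (fun w => C%:E * ((dX w ^+ 2)%:E + (dY w ^+ 2)%:E))%E (fun _ => (C * q)%:E)); first last.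
  - exact: measurable_cst.
  - by move=> w _; rewrite lee_fin mulr_ge0.
  - exact: emeasurable_funM.
  - by move=> w _; rewrite mule_ge0.
  rewrite (@ge0_integralZl _ _ _ P setT measurableT (fun w => (dX w ^+ 2)%:E + (dY w ^+ 2)%:E)%E)//.
  rewrite (@ge0_integralD _ _ _ P setT measurableT (fun w => (dX w ^+ 2)%:E) (fun w => (dY w ^+ 2)%:E))//.
  rewrite integral_cst//= [X in (_ + _ * X)%E](_ : _ = 1%E); last exact: probability_setT.
  rewrite mule1 -/(sqint P setT dX) -/(sqint P setT dY) -/(dist2 X Y U V s).
  by rewrite -(fineK finD) -/q -!EFinM -EFinD lee_fin; lra.
have hk (x : R) : 0 <= x -> x <= 1 + M ^+ 2 -> (x%:E * ((2 * C)%:E * dist2 X Y U V s) <=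
    (2 * C * (1 + M ^+ 2))%:E * dist2 X Y U V s)%E.
  move=> x0 xM; rewrite muleA -EFinM; apply: lee_wpmul2r; first exact: dist2_ge0.
  by rewrite lee_fin mulrC ler_wpM2l// mulr_ge0.
split.
  apply: (le_trans hv); rewrite -[X in (X <= _)%E]mul1e; apply: hk => //.
  by rewrite lerDl exprn_ge0.
have M2 : 0 <= M ^+ 2 by rewrite exprn_ge0.
apply: (le_trans _ (hk (M ^+ 2) M2 _)); last by rewrite lerDr.
apply: (@le_trans _ _ ((M ^+ 2)%:E *
   sqint P setT (fun w => vol_process X Y s w - vol_process U V s w)%R)%E); last first.
  by apply: lee_wpmul2l => //; rewrite lee_fin.
rewrite -sqintZ//; apply: le_sqint => //.
- exact: measurable_funB.
- exact: measurable_funM.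
- move=> w _.
  have h1 := HM s (X s w, Y s w) (X s) (Y s) sT.
  have h2 := HM s (U s w, V s w) (U s) (V s) sT.
  rewrite -/(vol_process X Y s w) in h1; rewrite -/(vol_process U V s w) in h2.
  rewrite !drift_processE.
  move: (vol_process X Y s w) (vol_process U V s w) h1 h2 => v v' h1 h2.
  have -> : - 2^-1 * (v * v) - - 2^-1 * (v' * v') = (- 2^-1 * (v + v')) * (v - v') by field.
  rewrite !normrM; apply: ler_wpM2r => //.
  rewrite normrN (ger0_norm M0) (ger0_norm (_ : 0 <= 2^-1)) ?invr_ge0//.
  by have := ler_normD v v'; lra.
Qed.

Lemma picard_step_dist2 : exists2 k : R, 0 <= k & forall X Y U V X' Y' U' V',
  S2_process X -> S2_process Y -> S2_process U -> S2_process V ->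
  S2_process X' -> S2_process Y' -> S2_process U' -> S2_process V' ->
  picard_step X Y X' Y' -> picard_step U V U' V' ->
  (forall t, t \in `[0, T] -> (dist2 X' Y' U' V' t <=
     k%:E * \int[lebesgue_measure]_(s in `[0%R, t]) dist2 X Y U V s)%E) /\
  (normS2 P T (fun t w => X' t w - U' t w)%R + normS2 P T (fun t w => Y' t w - V' t w)%R <=
     k%:E * \int[lebesgue_measure]_(s in `[0%R, T]) dist2 X Y U V s)%E.
Proof.
have [k k0 Hk] := coef_process_lipschitz.
pose C := 2 * T + 128 * c.
have C0 : 0 <= C by rewrite addr_ge0// mulr_ge0.
(* One k for the drift, one for the volatility, and m^2 for the mean reversion; the constant
   diffusion [gamma] cancels. *)
exists (C * (2 * k + m ^+ 2)); first by rewrite mulr_ge0// addr_ge0 ?sqr_ge0// mulr_ge0.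
move=> X Y U V X' Y' U' V' sX sY sU sV sX' sY' sU' sV' [eX eY] [eU eV].
have av := vol_process_acprocess sX sY; have av' := vol_process_acprocess sU sV.
have ad := drift_process_acprocess sX sY; have ad' := drift_process_acprocess sU sV.
have [ar _] := reversion_S2 sY; have [ar' _] := reversion_S2 sV.
have [HX1 HX2] := ito_equationB T_gt0 uF c_ge0 dWx sX'.1 sU'.1 ad ad' eX eU.
have [HY1 HY2] := ito_equationB T_gt0 uF c_ge0 dWy sY'.1 sV'.1 ar ar' eY eV.
have key t : t \in `[0, T] ->
    (C%:E * (sqint2 P t (fun s w => drift_process X Y s w - drift_process U V s w)%R +
             sqint2 P t (fun s w => vol_process X Y s w - vol_process U V s w)%R) +
     C%:E * (sqint2 P t (fun s w => m * (theta - Y s w) - m * (theta - V s w))%R +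
             sqint2 P t (fun s w => gamma - gamma)%R) <=
     (C * (2 * k + m ^+ 2))%:E * \int[lebesgue_measure]_(s in `[0%R, t]) dist2 X Y U V s)%E.
  move=> tT.
  have h1 := sqint2_le_dist2 sX sY sU sV (acprocessB T_gt0 uF ad ad') tT k0
    (fun s sT => (Hk _ _ _ _ _ sX sY sU sV sT).2).
  have h2 := sqint2_le_dist2 sX sY sU sV (acprocessB T_gt0 uF av av') tT k0
    (fun s sT => (Hk _ _ _ _ _ sX sY sU sV sT).1).
  have h3 := sqint2_le_dist2 sX sY sU sV (acprocessB T_gt0 uF ar ar') tT (sqr_ge0 m) _.
  have -> : sqint2 P t (fun s w => gamma - gamma)%R = 0%E.
    apply: integral0_eq => w _; apply: integral0_eq => s _.
    by rewrite subrr expr0n.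
  set J := (\int[lebesgue_measure]_(s in `[0%R, t]) dist2 X Y U V s)%E in h1 h2 h3 *.
  have J0 : (0 <= J)%E by apply: integral_ge0 => s _; exact: dist2_ge0.
  rewrite adde0 -ge0_muleDr; [|by rewrite adde_ge0// sqint2_ge0|exact: sqint2_ge0].
  rewrite EFinM -muleA; apply: lee_wpmul2l; first by rewrite lee_fin.
  rewrite EFinD ge0_muleDl ?lee_fin ?sqr_ge0// ?mulr_ge0//; apply: leeD.
    rewrite mulrDl mul1r EFinD ge0_muleDl ?lee_fin//; exact: leeD.
  apply: h3 => s sT.
  rewrite (@sqint_eq _ _ _ _ _ _ (fun w => m * (Y s w - V s w))); last first.
    by move=> w _; rewrite -sqrrN; congr (_ ^+ 2); ring.
  rewrite sqintZ//; last exact: measurable_funB.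
  apply: lee_wpmul2l; first by rewrite lee_fin sqr_ge0.
  by rewrite leeDr// sqint_ge0.
split=> [t tT|].
  by apply: le_trans (key t tT); apply: leeD; [exact: HX1|exact: HY1].
by apply: le_trans (key T T_itv); apply: leeD.
Qed.

End mckean_vlasov_step.

(** The integral is exp (l t) - 1. Each integration of the weight exp (l s) thus gains a factor 1 /
    l, the source of the contraction. *)
Lemma integral_expR_le (R : realType) (l t : R) : 0 < l -> 0 <= t ->
  (\int[lebesgue_measure]_(s in `[0%R, t]) (l * expR (l * s))%:E <= (expR (l * t))%:E)%E.
Proof.
move=> l0; rewrite le_eqVlt => /predU1P[<-|t0].
  by rewrite set_itv1 integral_set1 lee_fin expR_ge0.
have cE (k : R) : continuous (fun s : R => k * expR (l * s)).
  move=> s; apply: cvgM; first exact: cvg_cst.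
  apply: continuous_comp; last exact: continuous_expR.
  by apply: cvgM; [exact: cvg_cst|exact: cvg_id].
have cF : continuous (fun s : R => expR (l * s)).
  by have := cE 1; under eq_fun do rewrite mul1r.
rewrite (@continuous_FTC2 _ _ (fun s => expR (l * s)))//.
- by rewrite -EFinB lee_fin lerBlDr lerDl expR_ge0.
- exact: continuous_subspaceT.
- split; first by move=> x _; exact: ex_derive.
  + by apply: cvg_at_right_filter; exact: cF.
  + by apply: cvg_at_left_filter; exact: cF.
- by move=> x _; rewrite derive1E derive_val /GRing.scale/= mulr1 mulrC.
Qed.

(** * Convergence of the Picard iterates and uniqueness of the fixed point *)

Section picard_iteration.
Context d (Omega : measurableType d) (R : realType) (P : probability Omega R).
Variables (T : R) (F : R -> set (set Omega)).
Hypothesis T_gt0 : 0 < T.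
Hypothesis uF : usual_filtration P T F.
Implicit Types X Y U V : R -> {RV P >-> R}.
Local Notation S2 := (S2_process P T F).
Local Notation dS2 Z Z' := (normS2 P T (fun t w => Z t w - Z' t w)%R).

Let T_ge0 : 0 <= T. Proof. exact: ltW. Qed.
Let T_itv : T \in `[0, T]. Proof. by rewrite in_itv/= lexx ltW. Qed.

(* By induction a n t <= A 8^-n exp (l t), as k \int_0^t exp (l s) ds <= exp (l t) / 8
   for l = 8 (k + 1). *)
Lemma iterated_integral_le (a : nat -> R -> \bar R) (k A : R) : 0 <= k -> 0 <= A ->
  (forall n t, 0 <= a n t)%E ->
  (forall n t, t \in `[0, T] -> measurable_fun `[0, t] (a n)) ->
  (forall t, t \in `[0, T] -> (a 0%N t <= A%:E)%E) ->
  (forall n t, t \in `[0, T] ->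
     (a n.+1 t <= k%:E * \int[lebesgue_measure]_(s in `[0%R, t]) a n s)%E) ->
  exists B : R, forall n,
    (k%:E * \int[lebesgue_measure]_(s in `[0%R, T]) a n s <= (B * 8^-1 ^+ n)%:E)%E.
Proof.
move=> k0 A0 a0 ma aA ak; pose l := 8 * (k + 1).
have l0 : 0 < l by rewrite mulr_gt0// ltr_wpDl.
have key n : (forall t, t \in `[0, T] -> (a n t <= (A * 8^-1 ^+ n * expR (l * t))%:E)%E) ->
    forall t, t \in `[0, T] ->
    (k%:E * \int[lebesgue_measure]_(s in `[0%R, t]) a n s <=
     (A * 8^-1 ^+ n.+1 * expR (l * t))%:E)%E.
  move=> Ha t tT; have /andP[t0 t_le] : 0 <= t <= T by move: tT; rewrite in_itv.
  pose C := A * 8^-1 ^+ n / l.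
  have C0 : 0 <= C by rewrite !mulr_ge0 ?invr_ge0 ?exprn_ge0// ltW.
  have mE : measurable_fun `[0, t] (fun s : R => (l * expR (l * s))%:E).
    apply/measurable_EFinP; apply: measurable_funM => //.
    apply: (measurableT_comp (measurable_funP (@expR R))).
    exact: measurable_funM.
  apply: (@le_trans _ _ (k%:E * (C%:E *
      \int[lebesgue_measure]_(s in `[0%R, t]) (l * expR (l * s))%:E))%E).
    apply: lee_wpmul2l; first by rewrite lee_fin.
    rewrite -ge0_integralZl//; last first.
      by move=> s _; rewrite lee_fin mulr_ge0 ?expR_ge0// ltW.
    apply: ge0_le_integral => //.
    - exact: ma.
    - exact: emeasurable_funM.
    - move=> s /=; rewrite in_itv/= => /andP[s0 st].
      apply: (le_trans (Ha s _)); first by rewrite in_itv/= s0 (le_trans st).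
      rewrite -EFinM lee_fin /C le_eqVlt; apply/orP; left; apply/eqP.
      by field; rewrite gt_eqF.
  apply: (@le_trans _ _ (k%:E * (C%:E * (expR (l * t))%:E))%E).
    apply: lee_wpmul2l; first by rewrite lee_fin.
    apply: lee_wpmul2l; first by rewrite lee_fin.
    exact: integral_expR_le.
  rewrite -!EFinM lee_fin mulrA; apply: ler_wpM2r; first exact: expR_ge0.
  have -> : k * C = A * 8^-1 ^+ n * (k / l) by rewrite /C mulrCA.
  rewrite exprSr (mulrA A); apply: ler_wpM2l; first by rewrite mulr_ge0// exprn_ge0.
  by rewrite ler_pdivrMr// /l; lra.
have Ha n : forall t, t \in `[0, T] -> (a n t <= (A * 8^-1 ^+ n * expR (l * t))%:E)%E.
  elim: n => [|n IH] t tT; last by apply: le_trans (ak n t tT) _; exact: key.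
  apply: (le_trans (aA t tT)); rewrite lee_fin expr0 mulr1 ler_peMr//.
  rewrite -expR0 ler_expR mulr_ge0 ?(ltW l0)//.
  by move: tT; rewrite in_itv/= => /andP[].
exists (A * 8^-1 * expR (l * T)) => n.
apply: (le_trans (key n (Ha n) T T_itv)).
by rewrite lee_fin exprSr le_eqVlt; apply/orP; left; apply/eqP; ring.
Qed.

Lemma normS2B_tri (Z1 Z2 Z3 : R -> Omega -> R) :
  acprocess T F Z1 -> acprocess T F Z2 -> acprocess T F Z3 ->
  (dS2 Z1 Z3 <=
   2%:E * dS2 Z1 Z2 +
   2%:E * dS2 Z2 Z3)%E.
Proof.
move=> a1 a2 a3.
rewrite (_ : (fun t w => Z1 t w - Z3 t w) =
  (fun t w => (Z1 t w - Z2 t w) + (Z2 t w - Z3 t w))).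
  by apply: (normS2D T_gt0 uF); exact: (acprocessB T_gt0 uF).
by apply/funext => t; apply/funext => w; ring.
Qed.

Lemma dist2_le_normS2 X Y U V t : S2 X -> S2 Y ->
  S2 U -> S2 V -> t \in `[0, T] ->
  (dist2 X Y U V t <= dS2 X U +
                      dS2 Y V)%E.
Proof.
move=> sX sY sU sV tT; apply: leeD.
  exact: (sqint_le_normS2 T_gt0 uF (acprocessB T_gt0 uF sX.1 sU.1) tT).
exact: (sqint_le_normS2 T_gt0 uF (acprocessB T_gt0 uF sY.1 sV.1) tT).
Qed.

(** The iteration is carried out for an abstract relation: images exist, they satisfy the integral
    estimate, and they may be replaced by indistinguishable processes. *)
Variable step : (R -> {RV P >-> R}) -> (R -> {RV P >-> R}) ->
  (R -> {RV P >-> R}) -> (R -> {RV P >-> R}) -> Prop.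
Variable k : R.
Hypothesis k_ge0 : 0 <= k.
Hypothesis step_exists : forall X Y, S2 X -> S2 Y ->
  exists X' Y', [/\ S2 X', S2 Y' & step X Y X' Y'].
Hypothesis step_dist2 : forall X Y U V X' Y' U' V',
  S2 X -> S2 Y -> S2 U -> S2 V ->
  S2 X' -> S2 Y' -> S2 U' -> S2 V' ->
  step X Y X' Y' -> step U V U' V' ->
  (forall t, t \in `[0, T] -> (dist2 X' Y' U' V' t <=
     k%:E * \int[lebesgue_measure]_(s in `[0%R, t]) dist2 X Y U V s)%E) /\
  (dS2 X' U' + dS2 Y' V' <=
     k%:E * \int[lebesgue_measure]_(s in `[0%R, T]) dist2 X Y U V s)%E.
Hypothesis step_indistinguishable : forall X Y X' Y' U V, step X Y X' Y' ->
  {ae P, forall w, forall t, t \in `[0, T] -> U t w = X' t w} ->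
  {ae P, forall w, forall t, t \in `[0, T] -> V t w = Y' t w} ->
  step X Y U V.

Let normS2_fin X Y U V : S2 X -> S2 Y ->
  S2 U -> S2 V ->
  exists2 A : R, 0 <= A & (dS2 X U +
    dS2 Y V)%E = A%:E.
Proof.
move=> sX sY sU sV; have [_ h1] := S2_processB T_gt0 uF sX sU.
have [_ h2] := S2_processB T_gt0 uF sY sV.
have h0 : (0 <= dS2 X U +
    dS2 Y V)%E by rewrite adde_ge0// normS2_ge0.
exists (fine (dS2 X U +
    dS2 Y V)%E); first exact: fine_ge0.
by rewrite fineK// ge0_fin_numE// lte_add_pinfty.
Qed.

(** Fixed points are their own images, so the constant sequence of their distance satisfies the
    recursion of [iterated_integral_le] and is below B 8^-n for every n. *)
Lemma picard_fixpoint_unique X Y X' Y' :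
  S2 X -> S2 Y ->
  S2 X' -> S2 Y' ->
  step X Y X Y -> step X' Y' X' Y' ->
  {ae P, forall w, forall t, t \in `[0, T] -> X' t w = X t w /\ Y' t w = Y t w}.
Proof.
move=> sX sY sX' sY' hX hX'.
have [A A0 HA] := normS2_fin sX' sY' sX sY.
have [H1 H2] := step_dist2 sX' sY' sX sY sX' sY' sX sY hX' hX.
have [||||B HB] := @iterated_integral_le (fun _ => dist2 X' Y' X Y) k A k_ge0 A0.
- by move=> _ t; exact: dist2_ge0.
- by move=> _ t tT; exact: (measurable_dist2 T_gt0 uF).
- by move=> t tT; rewrite -HA; exact: dist2_le_normS2.
- by move=> _ t tT; exact: H1.
have N0 := normS2_ge0 P T_gt0.
have e0 : (dS2 X' X +
    dS2 Y' Y = 0)%E.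
  apply: (@le_geometric_eq0 _ _ B); first exact: adde_ge0.
  by move=> n; exact: le_trans H2 (HB n).
have /andP[/eqP eX /eqP eY] : (dS2 X' X == 0%E) &&
    (dS2 Y' Y == 0%E).
  by rewrite -padde_eq0// e0.
have := normS2_eq0 T_gt0 uF (acprocessB T_gt0 uF sY'.1 sY.1) eY.
have := normS2_eq0 T_gt0 uF (acprocessB T_gt0 uF sX'.1 sX.1) eX.
apply: filterS2 => w hx hy t tT.
by split; apply/eqP; rewrite -subr_eq0; apply/eqP; [exact: hx|exact: hy].
Qed.

(** Dependent choice from the zero pair. S^2 membership is carried in a subtype, as the existence of
    an image depends on it. *)
Lemma picard_sequence : exists X Y : nat -> R -> {RV P >-> R}, forall n,
  [/\ S2 (X n), S2 (Y n) &
      step (X n) (Y n) (X n.+1) (Y n.+1)].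
Proof.
have s0 : S2 (fun _ _ => 0 : R).
  have a0 := @acprocess_scalar _ _ _ P T F T_gt0 uF 0.
  by split => //; apply: (bounded_normS2_lty T_gt0 uF (M := 0) a0) => t w _; rewrite normr0.
have [Z0 [sZ0 _]] := S2_process_RV T_gt0 uF s0.
pose St := {p : (R -> {RV P >-> R}) * (R -> {RV P >-> R}) |
  S2 p.1 /\ S2 p.2}.
have nxt (p : St) : {q : St | step (sval p).1 (sval p).2 (sval q).1 (sval q).2}.
  apply: cid; case: p => -[X Y] [sX sY].
  have [X' [Y' [sX' sY' h]]] := step_exists sX sY.
  by exists (exist _ (X', Y') (conj sX' sY')).
pose z n : St := iter n (fun p => sval (nxt p)) (exist _ (Z0, Z0) (conj sZ0 sZ0)).
exists (fun n => (sval (z n)).1), (fun n => (sval (z n)).2) => n.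
by have [? ?] := svalP (z n); split => //; exact: (svalP (nxt (z n))).
Qed.

(** The index is shifted because the S^2 estimate concerns images only, so the first increment it
    controls is the one from Z 1 to Z 2. *)
Lemma S2_limit (Z : nat -> R -> {RV P >-> R}) (B : R) :
  (forall n, S2 (Z n)) ->
  (forall n, dS2 (Z n.+2) (Z n.+1) <= (B * 8^-1 ^+ n)%:E)%E ->
  exists2 Zoo : R -> {RV P >-> R}, S2 Zoo &
    dS2 (Z n.+1) Zoo @[n --> \oo] --> 0%E.
Proof.
move=> sZ HZ.
have [Zo aZo cZ] := S2_complete T_gt0 uF (Z := fun n t => Z n.+1 t) (fun n => (sZ n.+1).1) HZ.
have sZo : S2 Zo.
  split => //.
  have N0 n : (0 <= dS2 (Z n.+1) Zo)%E by exact: normS2_ge0.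
  have [N /(_ N (leqnn N)) HN] := (cvge0P N0).1 cZ 1 ltr01.
  have aN := acprocessB T_gt0 uF aZo (sZ N.+1).1.
  rewrite (_ : Zo = (fun t w => (Zo t w - Z N.+1 t w) + Z N.+1 t w)).
    apply: (le_lt_trans (normS2D T_gt0 uF aN (sZ N.+1).1)).
    rewrite lte_add_pinfty// lte_mul_pinfty//; last exact: (sZ N.+1).2.
    by rewrite normS2_sym (le_lt_trans HN)// ltry.
  by apply/funext => t; apply/funext => w; ring.
have [Zoo [sZoo e]] := S2_process_RV T_gt0 uF sZo.
exists Zoo => //; move: cZ; apply: cvg_trans.
rewrite (_ : (fun n => dS2 (Z n.+1) Zoo) =
  (fun n => dS2 (Z n.+1) Zo))//.
apply/funext => n; apply: eq_integral => w _; congr ereal_sup.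
by apply/seteqP; split => x [t tT <-]; exists t => //; rewrite e.
Qed.

(** Apply the step once more, to the limit. The iterates converge both to the limit and to its
    image, which are therefore indistinguishable, and [step_indistinguishable] turns the limit into
    a fixed point. *)
Lemma picard_fixpoint_exists : exists X Y,
  [/\ S2 X, S2 Y & step X Y X Y].
Proof.
have [X [Y XY]] := picard_sequence.
have sX n : S2 (X n) by case: (XY n).
have sY n : S2 (Y n) by case: (XY n).
have hXY n : step (X n) (Y n) (X n.+1) (Y n.+1) by case: (XY n).
have [A A0 HA] := normS2_fin (sX 1%N) (sY 1%N) (sX 0%N) (sY 0%N).
have Hn n := step_dist2 (sX n.+1) (sY n.+1) (sX n) (sY n) (sX n.+2) (sY n.+2)
  (sX n.+1) (sY n.+1) (hXY n.+1) (hXY n).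
have [||||B HB] := @iterated_integral_le
  (fun n => dist2 (X n.+1) (Y n.+1) (X n) (Y n)) k A k_ge0 A0.
- by move=> n t; exact: dist2_ge0.
- by move=> n t tT; exact: (measurable_dist2 T_gt0 uF).
- by move=> t tT; rewrite -HA; exact: dist2_le_normS2.
- by move=> n t tT; have [H1 _] := Hn n; exact: H1.
have N0 := normS2_ge0 P T_gt0.
have HX n : (dS2 (X n.+2) (X n.+1) <= (B * 8^-1 ^+ n)%:E)%E.
  by apply: le_trans (HB n); apply: le_trans (Hn n).2; rewrite leeDl.
have HY n : (dS2 (Y n.+2) (Y n.+1) <= (B * 8^-1 ^+ n)%:E)%E.
  by apply: le_trans (HB n); apply: le_trans (Hn n).2; rewrite leeDr.
have [Xo sXo cX] := S2_limit sX HX.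
have [Yo sYo cY] := S2_limit sY HY.
have [X' [Y' [sX' sY' hXo]]] := step_exists sXo sYo.
pose e n := (dS2 (X n.+1) Xo +
             dS2 (Y n.+1) Yo)%E.
have e0 n : (0 <= e n)%E by exact: adde_ge0.
have ce : e n @[n --> \oo] --> 0%E.
  have := @cvge0_lincomb _ _ _ 1 1 ler01 ler01 _ _ cX cY.
  rewrite /e; under eq_fun do rewrite !mul1e; apply.
  - by move=> n; exact: N0.
  - by move=> n; exact: N0.
(* The distance at each time is at most the S^2 distance [e n], and integrating over [0, T] yields
   the factor T: the step is Lipschitz in S^2. *)
have Hd n : (dS2 (X n.+2) X' +
    dS2 (Y n.+2) Y' <= (k * T)%:E * e n)%E.
  have [_ H2] := step_dist2 (sX n.+1) (sY n.+1) sXo sYo (sX n.+2) (sY n.+2) sX' sY' (hXY n.+1) hXo.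
  apply: (le_trans H2); rewrite EFinM -muleA; apply: lee_wpmul2l; first by rewrite lee_fin.
  apply: (@le_trans _ _ (\int[lebesgue_measure]_(s in `[0%R, T]) e n)%E).
    apply: ge0_le_integral => //.
    - by move=> s _; exact: dist2_ge0.
    - exact: (measurable_dist2 T_gt0 uF).
    - by move=> s sT; exact: dist2_le_normS2.
  by rewrite integral_cst//= lebesgue_measure_itv/= lte_fin T_gt0 -EFinB subr0 muleC.
have ce2 : (2%:E * e n.+1 + (2 * (k * T))%:E * e n)%E @[n --> \oo] --> 0%E.
  apply: cvge0_lincomb => //; first by rewrite !mulr_ge0.
  by have := ce; rewrite -(cvg_shiftS e).
have lim0 (Z : nat -> R -> {RV P >-> R}) Zo Z' : (forall n, S2 (Z n)) ->
    S2 Zo -> S2 Z' ->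
    (forall n, dS2 (Z n.+2) Zo <= e n.+1)%E ->
    (forall n, dS2 (Z n.+2) Z' <= (k * T)%:E * e n)%E ->
    {ae P, forall w, forall t, t \in `[0, T] -> Zo t w = Z' t w}.
  move=> sZ sZo sZ' h1 h2.
  have aB := acprocessB T_gt0 uF sZo.1 sZ'.1.
  suff /(normS2_eq0 T_gt0 uF aB) : dS2 Zo Z' = 0%E.
    by apply: filterS => w h t tT; apply/eqP; rewrite -subr_eq0 h.
  apply/eqP; rewrite eq_le N0 andbT; apply: (le_cvge0 _ ce2) => n.
  apply: (le_trans (normS2B_tri sZo.1 (sZ n.+2).1 sZ'.1)).
  rewrite EFinM -muleA; apply: leeD; apply: lee_wpmul2l => //.
  by rewrite normS2_sym.
exists Xo, Yo; split => //; apply: (step_indistinguishable hXo).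
- apply: (lim0 X) => // n; first by rewrite /e leeDl.
  by apply: le_trans (Hd n); rewrite leeDl.
- apply: (lim0 Y) => // n; first by rewrite /e leeDr.
  by apply: le_trans (Hd n); rewrite leeDr.
Qed.

End picard_iteration.

(** * The augmented filtration and the moments of the initial value *)

Section augmented_filtrations.
Context d (Omega : measurableType d) (R : realType) (P : probability Omega R).

(** Completeness of P makes the adjoined negligible sets measurable; the other generators are
    measurable by assumption and increase with t. *)
Lemma augmented_usual_filtration (T : R) (G0 : set (set Omega)) (n : nat)
    (B : 'I_n -> R -> {RV P >-> R}) (F : R -> set (set Omega)) :
  measure_is_complete P -> G0 `<=` measurable ->
  (forall t : R, t \in `[0, T] -> F t = augmented_filtration P G0 B t) ->
  usual_filtration P T F.
Proof.
move=> Pc G0m FE.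
have PM : sigma_algebra setT (@measurable d Omega) := sigma_algebra_measurable Omega.
split=> [t tT|t tT|s t sT tT st|t tT]; rewrite ?(FE _ sT) (FE _ tT).
- exact: smallest_sigma_algebra.
- apply: smallest_sub => // A [[/G0m//|]|]; last exact: Pc.
  apply: smallest_sub => // {}A [i [s [_ [Y mY <-]]]].
  by apply: measurable_funP.
- apply: smallest_sub; first exact: smallest_sigma_algebra.
  move=> A [[G0A|BA]|NA]; apply: sub_gen_smallest; [by left; left| |by right].
  left; right; move: A BA; apply: smallest_sub; first exact: smallest_sigma_algebra.
  move=> A [i [u [us uA]]]; apply: sub_gen_smallest; exists i, u; split => //.
  by move: us => /=; rewrite !in_itv/= => /andP[-> /le_trans->].
- by move=> A NA; apply: sub_gen_smallest; right.
Qed.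

(** With r the Euclidean norm of the pair, r^2 <= 1 + r^p for p >= 2, by distinguishing r <= 1 from
    r > 1. *)
Lemma sqint_lty_of_Lp (X Y Z : {RV P >-> R}) (p : R) : 2 <= p ->
  (forall w, Z w ^+ 2 <= X w ^+ 2 + Y w ^+ 2) ->
  (\int[P]_w ((Num.sqrt (X w ^+ 2 + Y w ^+ 2)) `^ p)%:E < +oo)%E ->
  (sqint P setT Z < +oo)%E.
Proof.
move=> p2 ZXY foo; pose r w := Num.sqrt (X w ^+ 2 + Y w ^+ 2).
have mr : measurable_fun setT r.
  apply: (measurableT_comp (continuous_measurable_fun (@sqrt_continuous R))).
  by apply: measurable_funD; exact: measurable_funX.
have mrp : measurable_fun setT (fun w => (r w `^ p)%:E).
  by apply/measurable_EFinP; exact: (measurableT_comp (measurable_powR _)).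
apply: (@le_lt_trans _ _ (\int[P]_w (1%:E + (r w `^ p)%:E))%E).
  apply: ge0_le_integral => //.
  - by move=> w _; rewrite lee_fin sqr_ge0.
  - exact: measurable_sqE.
  - exact: emeasurable_funD.
  - move=> w _; rewrite -EFinD lee_fin; apply: (le_trans (ZXY w)).
    have s0 : 0 <= X w ^+ 2 + Y w ^+ 2 by rewrite addr_ge0// sqr_ge0.
    have r0 : 0 <= r w by exact: sqrtr_ge0.
    rewrite -(sqr_sqrtr s0) -/(r w); have [r1|/ltW r1] := leP (r w) 1.
      apply: (@le_trans _ _ 1); last by rewrite lerDl powR_ge0.
      by rewrite exprn_ile1.
    apply: (@le_trans _ _ (r w `^ p)); last by rewrite lerDr.
    by rewrite -powR_mulrn// ler_powR.
rewrite ge0_integralD//; last by move=> w _; rewrite lee_fin powR_ge0.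
rewrite lte_add_pinfty// integral_cst//= mul1e.
by rewrite [X in (X < _)%E](_ : _ = 1%E) ?ltry//; exact: probability_setT.
Qed.

End augmented_filtrations.

Theorem theorem1 (R : realType) (d : measure_display) (Omega : measurableType d)
  (P : probability Omega R) (Pcomplete : measure_is_complete P)
  (T : R) (T_gt0 : 0 < T)
  (* the Brownian filtration, with initial sigma-algebra G0 *)
  (G0 : set (set Omega)) (G0_sigma : sigma_algebra setT G0)
  (G0_meas : G0 `<=` measurable)
  (n : nat) (B : 'I_n -> R -> {RV P >-> R}) (F : R -> set (set Omega))
  (F_def : forall t : R, t \in `[0, T] -> F t = augmented_filtration P G0 B t)
  (B_brownian : brownian_motion P T F 1%:M B)
  (rho : R) (rho_itv : -1 <= rho <= 1) (Wx Wy : R -> {RV P >-> R})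
  (W_brownian : brownian_motion P T F
     (\matrix_(i < 2, j < 2) (if i == j then 1 else rho))
     (fun i : 'I_2 => if i == ord0 then Wx else Wy))
  (m theta gamma : R) (m_gt0 : 0 < m)
  (g : R -> R) (sigmaDup : R -> R -> R) (K : R -> R)
  (K_ge0 : forall u, 0 <= K u)
  (K_int1 : (\int[lebesgue_measure]_u (K u)%:E = 1)%E)
  (K_even : forall u, K u = K (- u))
  (eps delta : R) (eps_gt0 : 0 < eps) (delta_gt0 : 0 < delta)
  (A1 : bounded_lipschitz g)
  (A2 : local_vol_regular T sigmaDup)
  (A3 : bounded_lipschitz K)
  (X0 Y0 : {RV P >-> R})
  (B1_meas : sigma_of (rpair X0 Y0) `<=` F 0)
  (B1_Lp : exists2 p : R, 2 <= p &
     (\int[P]_w ((Num.sqrt (X0 w ^+ 2 + Y0 w ^+ 2)) `^ p)%:E < +oo)%E)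
  (B1_indep : independent P (sigma_of (rpair X0 Y0))
     (sigma_of_process `[0, T] B))
  (B2 : (\int[P]_w ((\int[lebesgue_measure]_(t in `[0%R, T])
            `|drift_coef g sigmaDup K eps delta t (0, 0)
                (joint_law X0 Y0)|%:E) ^+ 2) +
         \int[P]_w ((\int[lebesgue_measure]_(t in `[0%R, T])
            `|vol_coef g sigmaDup K eps delta t (0, 0)
                (joint_law X0 Y0)|%:E) ^+ 2) < +oo)%E) :
  let solution (X Y : R -> {RV P >-> R}) :=
    [/\ in_S2 P T F X, in_S2 P T F Y &
        is_MV_solution T F (drift_coef g sigmaDup K eps delta)
          (vol_coef g sigmaDup K eps delta) m theta gamma Wx Wy X0 Y0 X Y] in
  exists X Y : R -> {RV P >-> R},
    solution X Y /\
    forall X' Y' : R -> {RV P >-> R}, solution X' Y' ->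
      {ae P, forall w, forall t : R, t \in `[0, T] ->
        X' t w = X t w /\ Y' t w = Y t w}.
Proof.
have uF : usual_filtration P T F by exact: (augmented_usual_filtration Pcomplete G0_meas F_def).
pose c : R := 4 * Num.sqrt 2.
have c_ge0 : 0 <= c by rewrite mulr_ge0// sqrtr_ge0.
have dWx : ito_driver P T F c Wx.
  by apply: (brownian_ito_driver uF (i := ord0) _ W_brownian); rewrite mxE.
have dWy : ito_driver P T F c Wy.
  by apply: (brownian_ito_driver uF (i := lift ord0 ord0) _ W_brownian); rewrite mxE eqxx.
(* An event of one coordinate is an event of the pair, through a cylinder set. *)
have X0_F0 : sigma_of X0 `<=` F 0.
  move=> A [Z mZ <-]; apply: B1_meas; exists (Z `*` setT); first exact: measurableX.
  by apply/seteqP; split => w //= [] // _ [].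
have Y0_F0 : sigma_of Y0 `<=` F 0.
  move=> A [Z mZ <-]; apply: B1_meas; exists (setT `*` Z); first exact: measurableX.
  by apply/seteqP; split => w //= [] // _ [].
have [p p2 hp] := B1_Lp.
have X0_L2 : (sqint P setT X0 < +oo)%E.
  by apply: (sqint_lty_of_Lp p2 _ hp) => w; rewrite lerDl sqr_ge0.
have Y0_L2 : (sqint P setT Y0 < +oo)%E.
  by apply: (sqint_lty_of_Lp p2 _ hp) => w; rewrite lerDr sqr_ge0.
pose step := @picard_step _ _ _ P T F Wx Wy g sigmaDup K eps delta m theta gamma X0 Y0.
have step_ex X Y := @picard_step_exists _ _ _ P T F T_gt0 uF c Wx Wy c_ge0 dWx dWy g sigmaDup K
  eps delta K_ge0 eps_gt0 delta_gt0 A1 A2 A3 m theta gamma X0 Y0 X0_F0 Y0_F0 X0_L2 Y0_L2 X Y.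
have [k k0 step_d] := @picard_step_dist2 _ _ _ P T F T_gt0 uF c Wx Wy c_ge0 dWx dWy g sigmaDup K
  eps delta K_ge0 eps_gt0 delta_gt0 A1 A2 A3 m theta gamma X0 Y0.
have step_ind (X Y X' Y' U V : R -> {RV P >-> R}) : step X Y X' Y' ->
    {ae P, forall w, forall t, t \in `[0, T] -> U t w = X' t w} ->
    {ae P, forall w, forall t, t \in `[0, T] -> V t w = Y' t w} -> step X Y U V.
  by move=> [hX hY] UX VY; split; [exact: ito_equation_eq UX hX|exact: ito_equation_eq VY hY].
(* The equations of a solution are literally those of a self-related pair; only the two forms of S^2
   membership need translating. *)
have solE (X Y : R -> {RV P >-> R}) : [/\ in_S2 P T F X, in_S2 P T F Y &
    is_MV_solution T F (drift_coef g sigmaDup K eps delta)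
      (vol_coef g sigmaDup K eps delta) m theta gamma Wx Wy X0 Y0 X Y] <->
    [/\ S2_process P T F X, S2_process P T F Y & step X Y X Y].
  by split=> -[sX sY h]; split => //; apply/in_S2E.
move=> solution.
have [X [Y [sX sY hXY]]] := picard_fixpoint_exists T_gt0 uF k0 step_ex step_d step_ind.
exists X, Y; split; first exact/solE.
move=> X' Y' /solE[sX' sY' hXY'].
exact: (picard_fixpoint_unique T_gt0 uF k0 step_d sX sY sX' sY' hXY hXY').
Qed.
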